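(* Let $L,P,R,M\in\mathbb{N}$ with $R\ge L$ and $L+P\le M$. Let $\psi=\psi^1\otimes\phi^1$ be a separable shearlet, where $\psi^1,\phi^1\in C^L(\mathbb{R})\cap L_2(\mathbb{R})$ are compactly supported and $\psi^1$ has $M$ vanishing moments. Let $u=g_1+\chi_Bg_2$ with $g_1,g_2\in C^P(\mathbb{R}^2)$ and $B\subset(0,1)^2$ such that $\gamma=\partial B\in C^R$ and $\gamma$ has bounded curvature. Let $(j,k,m,\iota)\in\Lambda$ be such that there exists $t\in\operatorname{supp}\psi_{j,k,m,\iota}\cap\gamma$ for which the normal $n(t)$ of $\gamma$ at $t$ obeys $n(t)=\pm(\cos\rho_0,\sin\rho_0)$ for some $\rho_0\in[-\pi/2,\pi/2]$ with $$d_{[-\pi/2,\pi/2]}\big(\arctan((2^{-j/2}k)^\iota),\rho_0\big)\ge\beta>0.$$ Then $$|\langle\psi_{j,k,m,\iota},u\rangle|\le C_u\left(2^{-(P+1)\frac j2}+2^{-(L+1)\frac j2+\frac34j}\right),$$ where $C_u$ is a constant depending only on $u$.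
   Context: $\chi_B$ is the characteristic function of $B$. $(\psi^1\otimes\phi^1)(x_1,x_2)=\psi^1(x_1)\phi^1(x_2)$. $\psi^1$ has $M$ vanishing moments if $\int_{\mathbb{R}}x^i\psi^1(x)\,dx=0$ for $0\le i<M$. The metric on the torus $[-\pi/2,\pi/2]$ is $d_{[-\pi/2,\pi/2]}(a,b)=\min(|a-b|,\ \pi+\min\{a,b\}-\max\{a,b\})$. By convention $\arctan(0^{-1})=\pi/2$. The functions $\psi_{j,k,m,\iota}$ are the elements of a cone-adapted shearlet system $\mathcal{SH}(\phi,\psi,\tilde\psi,c)$: for $k\in\mathbb{Z}$, $j\in\mathbb{N}_0$ let $S_k=\begin{pmatrix}1&k\\0&1\end{pmatrix}$, $A_j=\begin{pmatrix}2^j&0\\0&2^{j/2}\end{pmatrix}$, $\tilde A_j=\begin{pmatrix}2^{j/2}&0\\0&2^j\end{pmatrix}$. For $\phi,\psi\in L_2(\mathbb{R}^2)$ and $c=(c_1,c_2)$ with $c_1,c_2>0$, let $M_c=\mathrm{diag}(c_1,c_2)$, $M_{\tilde c}=\mathrm{diag}(c_2,c_1)$ and $\tilde\psi(x_1,x_2)=\psi(x_2,x_1)$. The system consists of - $\psi_{0,0,m,0}=\phi(\cdot-c_1m)$, $m\in\mathbb{Z}^2$; - $\psi_{j,k,m,1}=2^{3j/4}\psi(S_kA_j\cdot-M_cm)$, $j\in\mathbb{N}_0$, $k\in\mathbb{Z}$, $|k|\le2^{\lceil j/2\rceil}$, $m\in\mathbb{Z}^2$; - $\psi_{j,k,m,-1}=2^{3j/4}\tilde\psi(S_k^T\tilde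 A_j\cdot-M_{\tilde c}m)$, $j\in\mathbb{N}_0$, $k\in\mathbb{Z}$, $|k|\le2^{\lceil j/2\rceil}$, $m\in\mathbb{Z}^2$. $\Lambda$ is the set of all indices $(j,k,m,\iota)$ occurring above.
   Formalization: The constant C_u may also depend on the fixed shearlet system (ψ, φ, c), on L, P, R, M and on β (scaling ψ, or letting β tend to 0, refutes dependence on u alone); for ι = 0, u is assumed to lie in L_2 so that the pairing with φ makes sense. *)

(* Defs.v *)
From HB Require Import structures.
From mathcomp Require Import all_boot all_order all_algebra.
From mathcomp Require Import all_classical all_reals all_analysis.
Set Implicit Arguments.
Unset Strict Implicit.
Unset Printing Implicit Defensive.
Import Order.TTheory GRing.Theory Num.Theory.
Import numFieldNormedType.Exports.
Local Open Scope classical_set_scope.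
Local Open Scope ring_scope.

Section Smoothness.
Variable K : realType.

Definition class_C (n : nat) (f : K -> K) : Prop :=
  (forall i x, (i < n)%N -> derivable (derive1n i f) x 1) /\
  continuous (derive1n n f).

Definition slice1 (f : K * K -> K) (x : K * K) : K -> K := fun s => f (s, x.2).
Definition slice2 (f : K * K -> K) (x : K * K) : K -> K := fun s => f (x.1, s).
Definition partial1 (f : K * K -> K) (x : K * K) : K := derive1 (slice1 f x) x.1.
Definition partial2 (f : K * K -> K) (x : K * K) : K := derive1 (slice2 f x) x.2.

Fixpoint class_C2 (n : nat) (f : K * K -> K) : Prop :=
  continuous f /\
  if n is n'.+1 then
    [/\ forall x, derivable (slice1 f x) x.1 1 /\ derivable (slice2 f x) x.2 1,
        class_C2 n' (partial1 f) & class_C2 n' (partial2 f)]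
  else True.

Definition supp (T : topologicalType) (f : T -> K) : set T :=
  closure [set x | f x != 0].

Definition lebesgue2 := ((@lebesgue_measure K) \x (@lebesgue_measure K))%E.

(* The pairing is \bar K-valued, so that a finite bound on it also asserts
   that it is finite. *)
Definition inner (f g : K * K -> K) : \bar K :=
  (\int[lebesgue2]_x (f x * g x)%:E)%E.

Definition vanishing_moments (M : nat) (f : K -> K) : Prop :=
  forall i, (i < M)%N ->
    (\int[@lebesgue_measure K]_x (x ^+ i * f x)%:E = 0)%E.

Definition tensor (f g : K -> K) : K * K -> K := fun x => f x.1 * g x.2.

End Smoothness.

Section Curves.
Variable K : realType.

Definition boundary (B : set (K * K)) : set (K * K) := closure B `\` interior B.

(* In the orthonormal frame at t rotated by theta, the set gamma is near t the
   graph of the C^n function f, with t at the origin. *)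
Definition local_graph (n : nat) (gamma : set (K * K)) (t : K * K)
    (theta : K) (f : K -> K) : Prop :=
  [/\ class_C n f, f 0 = 0 &
      exists2 r : K, 0 < r & forall a b : K, `|a| < r -> `|b| < r ->
        gamma (t.1 + a * cos theta - b * sin theta,
               t.2 + a * sin theta + b * cos theta) <-> b = f a].

Definition curve_of_class (n : nat) (gamma : set (K * K)) : Prop :=
  forall t, gamma t -> exists theta f, local_graph n gamma t theta f.

(* (cos theta - f'(0) sin theta, sin theta + f'(0) cos theta) is the tangent
   direction, at t, of the graph of f in the frame rotated by theta. *)
Definition unit_normal (gamma : set (K * K)) (t n : K * K) : Prop :=
  n.1 ^+ 2 + n.2 ^+ 2 = 1 /\
  exists theta f, local_graph 1 gamma t theta f /\
    n.1 * (cos theta - derive1 f 0 * sin theta)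
    + n.2 * (sin theta + derive1 f 0 * cos theta) = 0.

Definition has_curvature (gamma : set (K * K)) (t : K * K) (kappa : K) : Prop :=
  exists theta f, [/\ local_graph 1 gamma t theta f,
    derivable (derive1 f) 0 1 &
    kappa = `|derive1n 2 f 0| / (1 + derive1 f 0 ^+ 2) `^ (3 / 2)].

Definition bounded_curvature (gamma : set (K * K)) : Prop :=
  exists kmax : K, forall t, gamma t ->
    exists2 kappa, has_curvature gamma t kappa & kappa <= kmax.

End Curves.

Section Shearlets.
Variable K : realType.

Definition mx2 (a b c d : K) : 'M[K]_2 :=
  \matrix_(p < 2, q < 2)
    if p == 0 then (if q == 0 then a else b) else (if q == 0 then c else d).

Definition mxact (A : 'M[K]_2) (x : K * K) : K * K :=
  (A 0 0 * x.1 + A 0 1 * x.2, A 1 0 * x.1 + A 1 1 * x.2).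

Definition shear_mx (k : int) : 'M[K]_2 := mx2 1 k%:~R 0 1.
Definition scale_mx (j : nat) : 'M[K]_2 :=
  mx2 (2 ^+ j) 0 0 (2 `^ (j%:R / 2)).
Definition scale_mx' (j : nat) : 'M[K]_2 :=
  mx2 (2 `^ (j%:R / 2)) 0 0 (2 ^+ j).

Definition lattice_pt (m : int * int) : K * K := (m.1%:~R, m.2%:~R).

Definition swap_args (f : K * K -> K) : K * K -> K := fun x => f (x.2, x.1).

(* The index (j, k, m, i) of a cone-adapted system; m ranges over all of Z^2,
   and uphalf j is the ceiling of j / 2. *)
Definition shearlet_index (j : nat) (k : int) (m : int * int) (i : int) : Prop :=
  [/\ j = 0%N, k = 0 & i = 0] \/
  ((`|k| <= 2 ^ uphalf j)%N /\ (i = 1 \/ i = -1)).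

(* Only meaningful for indices satisfying shearlet_index. *)
Definition shearlet (phi psi : K * K -> K) (c : K * K)
    (j : nat) (k : int) (m : int * int) (i : int) : K * K -> K :=
  fun x =>
    if i == 0 then phi (x - mxact (mx2 c.1 0 0 c.1) (lattice_pt m))
    else if i == 1 then
      2 `^ (3 / 4 * j%:R) *
      psi (mxact (shear_mx k *m scale_mx j) x
           - mxact (mx2 c.1 0 0 c.2) (lattice_pt m))
    else
      2 `^ (3 / 4 * j%:R) *
      swap_args psi (mxact ((shear_mx k)^T *m scale_mx' j) x
                     - mxact (mx2 c.2 0 0 c.1) (lattice_pt m)).

(* arctan (s ^ i), with arctan (0 ^ -1) = pi / 2; the special case is needed
   because 0 ^ -1 = 0 in a MathComp field. *)
Definition atan_exp (s : K) (i : int) : K :=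
  if (s == 0) && (i == -1) then pi / 2 else atan (s ^ i).

Definition torus_dist (a b : K) : K :=
  Num.min `|a - b| (pi + Num.min a b - Num.max a b).

End Shearlets.

(* Main.v *)
Require Import Defs.
From HB Require Import structures.
From mathcomp Require Import all_boot all_order all_algebra.
From mathcomp Require Import all_classical all_reals all_analysis.
From mathcomp Require Import measurable_realfun.
From mathcomp Require Import ring lra.
Set Implicit Arguments.
Unset Strict Implicit.
Unset Printing Implicit Defensive.
Import Order.TTheory GRing.Theory Num.Theory.
Import numFieldNormedType.Exports.
Local Open Scope classical_set_scope.
Local Open Scope ring_scope.

(** Why the estimate holds.  Put eps = 2^(-j/2) and kap = eps * k.  Up to the
    factor 2^(3j/4), a shearlet of the first cone is psi1 z * phi1 y in the
    adapted coordinates z = eps^-2 (x1 + kap x2) - mu1, y = eps^-1 x2 - mu2; in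
    the second cone x1 and x2 are exchanged.  The change of variables has
    Jacobian eps^3 and psi1, phi1 vanish outside [-r, r], so everything takes
    place in a window of diameter O(eps), elongated along the ridge of the
    shearlet.  With L = n + 1 it suffices to bound the integral of
    psi1 z * phi1 y * u by C eps^3 (eps^P + eps^n).

    In the window g1 and g2 are replaced by Taylor polynomials, at the cost
    eps^P ([taylor_coord]).  The curve is locally the graph of a function f of
    class C^L in a rotated frame, and the hypothesis on the normal makes the
    ridge transversal to it, at an angle whose sine is at least sin beta
    ([torus_dist_sin], [ridge_transversal], [transversality]).  Hence, inside
    the window, the curve is also a graph y = e z ([chart_zero]), and since B is
    constant on each side of it ([graph_side]), u is up to O(eps^P) a sum of
    terms z^l y^c and z^l y^c 1_{y <= e z} with l < P.  Integrating in y first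
    leaves sums of z^l and z^l H_c (e z), with H_c a primitive of y^c phi1 y.

    The heart of the matter is that H_c (e z) is close to a polynomial in z of
    degree less than n.  The window is thinner by a factor eps in the variable
    z than in y, so a function of z coming from geometry at unit scale has a
    Taylor coefficient of z^d of size eps^d.  A family of functions of z with
    this property up to O(eps^n) is called [approximable]; the notion is stable
    under sums, products and composition with smooth functions
    ([approximable_comp]), and holds for e because e solves an implicit equation
    whose nonlinear part carries one more factor eps than its linear part, so
    that each substitution of the equation into itself gains one order
    ([approximable_implicit]).  The integral over y is therefore, up to
    O(eps^n), a polynomial in z of degree less than P + n <= M, which the
    vanishing moments of psi1 annihilate ([moments_bound], [core_estimate]).

    Near a given boundary point the argument needs eps below some threshold;
    above it the trivial size estimate suffices ([coarse_estimate]).  The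
    constants are made uniform in the boundary point by compactness of the
    boundary ([global_estimate]).  On the coarsest level, where j = 0 and the
    bound is a constant, the pairing with a translate of phi is at most the sum
    of the squared norms of phi and u ([scaling_estimate]).

    The set B is arbitrary on its own boundary, so u may fail to be measurable.
    The integral is a difference of two suprema over simple functions and is
    monotone without any measurability; squeezing the integrand between two
    measurable functions that are infinite on the null set of the curve is enough
    ([integral_near_any]). *)

(** * Functions of class C^n and their Taylor polynomials *)

Section ClassC.
Variable K : realType.
Implicit Types (f g : K -> K) (n : nat).

Lemma class_C0 f : class_C 0 f <-> continuous f.
Proof. by split=> [[]|cf]; rewrite ?derive1n0//; split. Qed.

Lemma class_CS n f :
  class_C n.+1 f <-> (forall x, derivable f x 1) /\ class_C n (derive1 f).
Proof.
split=> [[df cf]|[df [df' cf']]].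
- split; first by move=> x; have := df 0%N x isT; rewrite derive1n0.
  split; last by rewrite -derive1Sn.
  by move=> i x ilt; rewrite -derive1Sn; exact: df.
- split; last by rewrite derive1Sn.
  move=> [|i] x ilt; first by rewrite derive1n0.
  by rewrite derive1Sn; exact: df'.
Qed.

Lemma derivable1_continuous f : (forall x, derivable f x 1) -> continuous f.
Proof. by move=> df x; apply/differentiable_continuous/derivable1_diffP. Qed.

Lemma class_C_continuous n f : class_C n f -> continuous f.
Proof.
by case: n => [/class_C0//|n /class_CS[df _]]; exact: derivable1_continuous.
Qed.

Lemma class_C_leS n f : class_C n.+1 f -> class_C n f.
Proof.
elim: n f => [|n IH] f /class_CS[df cf].
  by apply/class_C0; exact: derivable1_continuous.
by apply/class_CS; split=> //; exact: IH.
Qed.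

Lemma class_C_le m n f : (m <= n)%N -> class_C n f -> class_C m f.
Proof.
move=> /subnK <-; elim: (n - m)%N => [//|d IH]; rewrite addSn.
by move=> /class_C_leS.
Qed.

Lemma class_CD n f g : class_C n f -> class_C n g -> class_C n (f \+ g).
Proof.
elim: n f g => [|n IH] f g.
  move=> /class_C0 cf /class_C0 cg; apply/class_C0 => x.
  exact: (continuousD (cf x) (cg x)).
move=> /class_CS[df cf] /class_CS[dg cg]; apply/class_CS; split.
  by move=> x; exact: derivableD.
have -> : derive1 (f \+ g) = derive1 f \+ derive1 g.
  by apply/funext => x; rewrite /= !derive1E deriveD.
exact: IH.
Qed.

Lemma class_CM n f g : class_C n f -> class_C n g -> class_C n (f \* g).
Proof.
elim: n f g => [|n IH] f g.
  move=> /class_C0 cf /class_C0 cg; apply/class_C0 => x.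
  exact: (continuousM (cf x) (cg x)).
move=> Cf Cg; have [df cf] := (class_CS n f).1 Cf.
have [dg cg] := (class_CS n g).1 Cg; apply/class_CS; split.
  by move=> x; exact: derivableM.
have -> : derive1 (f \* g) = (f \* derive1 g) \+ (g \* derive1 f).
  by apply/funext => x; rewrite /= !derive1E deriveM.
by apply: class_CD; apply: IH => //; exact: class_C_leS.
Qed.

Lemma class_C_horner n (p : {poly K}) : class_C n (horner p).
Proof.
elim: n p => [|n IH] p; first by apply/class_C0; exact: continuous_horner.
apply/class_CS; split; first by move=> x; exact: derivable_horner.
by rewrite -derivE; exact: IH.
Qed.

Lemma mvt_bound f (C a b : K) : (forall x, derivable f x 1) ->
  (forall x, Num.min a b <= x <= Num.max a b -> `|derive1 f x| <= C) ->
  `|f b - f a| <= C * `|b - a|.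
Proof.
move=> df fC.
have isd (x : K) : is_derive x (1 : K) f (derive1 f x).
  by rewrite derive1E; exact: derivableP.
have cf (u v : K) : {within `[u, v], continuous f}.
  by apply: continuous_subspaceT; exact: derivable1_continuous.
have [ab|ba] := leP a b.
- have [c cin ->] := MVT_segment ab (fun x _ => isd x) (cf a b).
  rewrite normrM ler_wpM2r// fC//.
  by move: cin; rewrite in_itv/= min_l// max_r.
- have [c cin] := MVT_segment (ltW ba) (fun x _ => isd x) (cf b a).
  rewrite -normrN opprB => ->; rewrite normrM (distrC b a) ler_wpM2r// fC//.
  by move: cin; rewrite in_itv/= min_r ?max_l// ltW.
Qed.

Lemma between_norm (a b x r : K) : `|a| <= r -> `|b| <= r ->
  Num.min a b <= x <= Num.max a b -> `|x| <= r.
Proof.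
by rewrite !ler_norml ge_min le_max => /andP[? ?] /andP[? ?];
  case: (leP a b) => ab /andP[h1 h2]; lra.
Qed.

Lemma between_dist (a b x : K) :
  Num.min a b <= x <= Num.max a b -> `|x - a| <= `|b - a|.
Proof.
move=> xab; apply: (@between_norm 0 (b - a)); rewrite ?normr0//.
by move: xab; case: (leP a b) => ab; case: (leP 0 (b - a)) => ab'; lra.
Qed.

Lemma continuous_bounded_segment f (r : K) : continuous f ->
  exists A, forall x, `|x| <= r -> `|f x| <= A.
Proof.
move=> cf; have [r0|r0] := leP 0 r; last first.
  by exists 0 => x xr; have := normr_ge0 x; lra.
have cnf : {within `[- r, r], continuous (fun x => `|f x|)}.
  apply: continuous_subspaceT => x.
  by apply: continuous_comp; [exact: cf|exact: norm_continuous].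
have [|c _ hc] := EVT_max _ cnf; first by lra.
exists `|f c| => x; rewrite ler_norml => xr; apply: hc.
by rewrite in_itv.
Qed.

Definition taylor_poly f (x0 : K) n : {poly K} :=
  \sum_(d < n) (derive1n d f x0 / d`!%:R) *: ('X - x0%:P) ^+ d.

Lemma taylor_poly_self f x0 n : (taylor_poly f x0 n.+1).[x0] = f x0.
Proof.
rewrite /taylor_poly big_ord_recl hornerD hornerZ expr0 hornerC horner_sum big1.
  by rewrite addr0 derive1n0 fact0; field.
by move=> i _; rewrite hornerZ horner_exp hornerXsubC subrr expr0n /= mulr0.
Qed.

Lemma deriv_taylor_poly f x0 n :
  (taylor_poly f x0 n.+1)^`()%R = taylor_poly (derive1 f) x0 n.
Proof.
rewrite /taylor_poly raddf_sum big_ord_recl /= expr0 derivZ derivC scaler0 add0r.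
apply: eq_bigr => i _; rewrite derivZ deriv_exp derivXsubC mul1r.
rewrite -[X in _ *: X = _]scaler_nat scalerA.
rewrite (_ : bump 0 i = i.+1)// add0n -derive1nS derive1Sn; congr (_ *: _).
rewrite factS natrM; field.
by rewrite pnatr_eq0 -lt0n fact_gt0 -[1 + _](natrD _ 1) pnatr_eq0.
Qed.

(** The remainder f - T has derivative f' - T', which is the remainder of f' at
    one order less, so the mean value inequality gains a factor |x - x0|.
    Boundedness of the n-th derivative, from its continuity, suffices: the Taylor
    polynomial has degree less than n. *)
Lemma taylor_remainder n f (r : K) : class_C n f ->
  exists2 A : K, 0 <= A & forall x0 x, `|x0| <= r -> `|x| <= r ->
    `|f x - (taylor_poly f x0 n).[x]| <= A * `|x - x0| ^+ n.
Proof.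
elim: n f => [|n IH] f.
  move=> /class_C0 cf; have [A hA] := continuous_bounded_segment r cf.
  exists `|A| => // x0 x _ xr; rewrite /taylor_poly big_ord0 horner0 subr0 expr0 mulr1.
  exact: le_trans (hA _ xr) (ler_norm _).
move=> /class_CS[df /IH[A A0 hA]]; exists A => // x0 x x0r xr.
pose p := taylor_poly f x0 n.+1; pose g y := f y - p.[y].
have dp (y : K) : derivable (horner p) y 1 by exact: derivable_horner.
have dg y : derivable g y 1 by exact: (derivableB (df y) (dp y)).
have dgE y : derive1 g y = derive1 f y - (taylor_poly (derive1 f) x0 n).[y].
  rewrite derive1E (deriveB (df y) (dp y)).
  by rewrite -!derive1E -derivE deriv_taylor_poly.
have := @mvt_bound g (A * `|x - x0| ^+ n) x0 x dg.
rewrite {2 3}/g taylor_poly_self subrr subr0 exprSr mulrA; apply=> y yx.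
have yr : `|y| <= r := between_norm x0r xr yx.
rewrite dgE; apply: le_trans (hA x0 y x0r yr) _.
by rewrite ler_wpM2l// lerXn2r ?nnegrE// between_dist.
Qed.

Lemma derive1n_bounded n f d (r : K) : class_C n f -> (d <= n)%N ->
  exists A, forall x, `|x| <= r -> `|derive1n d f x| <= A.
Proof.
elim: n f d => [|n IH] f [|d]// Cf; rewrite ?ltnS => dn.
- by apply: continuous_bounded_segment; rewrite derive1n0; exact/class_C0.
- apply: continuous_bounded_segment; rewrite derive1n0.
  exact: class_C_continuous Cf.
- have [A hA] := IH _ d ((class_CS _ _).1 Cf).2 dn.
  by exists A => x xr; rewrite derive1Sn; exact: hA.
Qed.

(** A polynomial approximation of the derivative integrates to one of the
    function, with an error multiplied by the length of the interval. *)
Lemma antiderivative_remainder f (c : nat -> K) n (x0 x delta : K) :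
  (forall s, derivable f s 1) ->
  (forall s, Num.min x0 x <= s <= Num.max x0 x ->
     `|derive1 f s - \sum_(b < n) c b * (s - x0) ^+ b| <= delta) ->
  `|f x - (f x0 + \sum_(b < n) c b / b.+1%:R * (x - x0) ^+ b.+1)|
    <= delta * `|x - x0|.
Proof.
move=> df hd.
pose p : {poly K} := \sum_(b < n) (c b / b.+1%:R) *: ('X - x0%:P) ^+ b.+1.
have pE s : p.[s] = \sum_(b < n) c b / b.+1%:R * (s - x0) ^+ b.+1.
  rewrite horner_sum; apply: eq_bigr => b _.
  by rewrite hornerZ horner_exp hornerXsubC.
have dpE s : (deriv p).[s] = \sum_(b < n) c b * (s - x0) ^+ b.
  rewrite /p raddf_sum horner_sum; apply: eq_bigr => b _ /=.
  rewrite derivZ deriv_exp derivXsubC mul1r /= hornerZ hornerMn horner_exp.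
  rewrite hornerXsubC -[_ *+ _]mulr_natr; field.
  by rewrite -[1 + _](natrD _ 1) pnatr_eq0.
have dp (y : K) : derivable (horner p) y 1 by exact: derivable_horner.
have p0 : p.[x0] = 0.
  by rewrite pE big1// => b _; rewrite subrr expr0n mulr0.
rewrite -pE opprD addrA -[X in `|X|]addrAC.
have := @mvt_bound (fun s => f s - p.[s]) delta x0 x.
rewrite p0 subr0; apply=> [s|s xs]; first exact: (derivableB (df s) (dp s)).
rewrite derive1E (deriveB (df s) (dp s)) -!derive1E -derivE dpE.
exact: hd.
Qed.

Lemma continuous_bounded_box (g : K * K -> K) (r : K) : continuous g ->
  exists2 A : K, 0 <= A &
    forall x, `|x.1| <= r -> `|x.2| <= r -> `|g x| <= A.
Proof.
move=> cg; have [r0|r0] := leP 0 r; last first.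
  by exists 0 => // x xr; have := normr_ge0 x.1; lra.
pose S := `[- r, r]%classic `*` `[- r, r]%classic.
have cS : compact S by apply: compact_setX; exact: segment_compact.
have [||c cS' hc] := @compact_EVT_max _ K (fun x => `|g x|) S _ cS.
- by exists (0, 0); split; rewrite /= in_itv/=; lra.
- apply: continuous_subspaceT => x.
  by apply: continuous_comp; [exact: cg|exact: norm_continuous].
- exists `|g c| => // x; rewrite 2!ler_norml => x1 x2; apply: hc.
  by rewrite inE; split; rewrite /= in_itv.
Qed.

Lemma class_C2_continuous n (g : K * K -> K) : class_C2 n g -> continuous g.
Proof. by case: n => [|n] []. Qed.

(** Going from x0 to x first along the first axis and then along the second,
    each leg integrates the approximation that induction gives for the
    corresponding partial derivative.  The polynomial obtained this way has
    degree less than n in each variable separately rather than in total; only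
    the size of its coefficients and its degree in a single variable matter
    later. *)
Lemma taylor2_remainder n (g : K * K -> K) (r : K) : class_C2 n g ->
  exists2 A : K, 0 <= A & forall x0 : K * K, `|x0.1| <= r -> `|x0.2| <= r ->
  exists2 t : nat -> nat -> K, (forall a b, `|t a b| <= A) &
    forall x : K * K, `|x.1| <= r -> `|x.2| <= r ->
    `|g x - \sum_(a < n) \sum_(b < n)
         t a b * (x.1 - x0.1) ^+ a * (x.2 - x0.2) ^+ b|
    <= A * (`|x.1 - x0.1| + `|x.2 - x0.2|) ^+ n.
Proof.
elim: n g => [|n IH] g.
  move=> /class_C2_continuous cg; have [A A0 hA] := continuous_bounded_box r cg.
  exists A => // x0 _ _; exists (fun _ _ => 0); first by move=> *; rewrite normr0.
  by move=> x x1 x2; rewrite big_ord0 subr0 expr0 mulr1 hA.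
move=> [cg [dg /IH[A1 A10 h1] /IH[A2 A20 h2]]].
have [A3 A30 h3] := continuous_bounded_box r cg.
exists (A1 + A2 + A3) => [|x0 x01 x02]; first by rewrite !addr_ge0.
have [t1 t1A t1P] := h1 x0 x01 x02.
have [t2 t2A t2P] := h2 x0 x01 x02.
(* The first leg runs on the line x.2 = x0.2, where only the terms of the
   derivative approximation with b = 0 survive. *)
pose t a b := if b is b'.+1 then (if (a < n)%N then t2 a b' / b%:R else 0)
  else (if a is a'.+1 then t1 a' 0%N / a%:R else g x0).
have divA (c A : K) m : 0 <= A -> `|c| <= A -> `|c / m.+1%:R| <= A.
  move=> A_ge0 cA; rewrite normrM normfV ler_pdivrMr ?normr_gt0 ?pnatr_eq0//.
  rewrite (le_trans cA)// ler_peMr// ger0_norm// ler1n//.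
exists t => [[|a] [|b]|x xr1 xr2] /=.
- by apply: le_trans (h3 _ x01 x02) _; rewrite lerDr addr_ge0.
- case: ifP => _; last by rewrite normr0 !addr_ge0.
  by rewrite (le_trans (divA _ _ _ A20 (t2A _ _)))// -addrA addrCA lerDl addr_ge0.
- by rewrite (le_trans (divA _ _ _ A10 (t1A _ _)))// -addrA lerDl addr_ge0.
- case: ifP => _; last by rewrite normr0 !addr_ge0.
  by rewrite (le_trans (divA _ _ _ A20 (t2A _ _)))// -addrA addrCA lerDl addr_ge0.
pose d1 := x.1 - x0.1; pose d2 := x.2 - x0.2.
pose P1 := \sum_(a < n) t1 a 0%N / a.+1%:R * d1 ^+ a.+1.
pose c b := \sum_(a < n) t2 a b * d1 ^+ a.
pose P2 := \sum_(b < n) c b / b.+1%:R * d2 ^+ b.+1.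
have TE : \sum_(a < n.+1) \sum_(b < n.+1) t a b * d1 ^+ a * d2 ^+ b =
    g x0 + P1 + P2.
  rewrite exchange_big/= big_ord_recl/=; congr (_ + _).
    rewrite big_ord_recl/= !expr0 !mulr1; congr (_ + _).
    by apply: eq_bigr => a _; rewrite mulr1.
  apply: eq_bigr => b _; rewrite big_ord_recr/= ltnn !mul0r addr0.
  rewrite /c !mulr_suml; apply: eq_bigr => a _; rewrite ltn_ord /bump/= add1n.
  by rewrite -!mulrA; congr (_ * _); rewrite mulrCA.
rewrite TE; set H := `|d1| + `|d2|.
have E1 : `|g (x.1, x0.2) - (g x0 + P1)| <= A1 * H ^+ n * `|d1|.
  have := @antiderivative_remainder (fun s => g (s, x0.2)) (t1^~ 0%N) n x0.1 x.1
    (A1 * H ^+ n); rewrite -surjective_pairing; apply.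
    by move=> s; exact: (dg (s, x0.2)).1.
  move=> s sx; have sr : `|s| <= r := between_norm x01 xr1 sx.
  have := t1P (s, x0.2) sr x02; rewrite /= subrr normr0 addr0.
  rewrite (_ : \sum_(a < n) _ = \sum_(a < n) t1 a 0%N * (s - x0.1) ^+ a); last first.
    apply: eq_bigr => a _.
    rewrite (bigD1 (Ordinal (leq_ltn_trans (leq0n a) (ltn_ord a))))//=.
    rewrite expr0 mulr1 big1 ?addr0// => b b0.
    by rewrite expr0n (_ : (b == 0%N :> nat) = false) ?mulr0//; exact: negbTE.
  move=> /le_trans; apply; rewrite ler_wpM2l// lerXn2r ?nnegrE//.
    by rewrite addr_ge0.
  by rewrite (le_trans (between_dist sx))// lerDl.
have E2 : `|g x - (g (x.1, x0.2) + P2)| <= A2 * H ^+ n * `|d2|.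
  have := @antiderivative_remainder (fun s => g (x.1, s)) c n x0.2 x.2
    (A2 * H ^+ n); rewrite -surjective_pairing; apply.
    by move=> s; exact: (dg (x.1, s)).2.
  move=> s sx; have sr : `|s| <= r := between_norm x02 xr2 sx.
  have := t2P (x.1, s) xr1 sr; rewrite /=.
  rewrite exchange_big/= (_ : \sum_(b < n) _ = \sum_(b < n) c b * (s - x0.2) ^+ b); last first.
    by apply: eq_bigr => b _; rewrite /c mulr_suml.
  move=> /le_trans; apply; rewrite ler_wpM2l// lerXn2r ?nnegrE ?addr_ge0//.
  by rewrite lerD2l between_dist.
have -> : g x - (g x0 + P1 + P2) =
    (g (x.1, x0.2) - (g x0 + P1)) + (g x - (g (x.1, x0.2) + P2)) by ring.
apply: le_trans (ler_normD _ _) _; apply: le_trans (lerD E1 E2) _.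
have H0 : 0 <= H by rewrite addr_ge0.
have h1H : `|d1| <= H by rewrite lerDl.
have h2H : `|d2| <= H by rewrite lerDr.
rewrite exprSr -!mulrA !mulrDl.
have X1 : A1 * (H ^+ n * `|d1|) <= A1 * (H ^+ n * H).
  by rewrite ler_wpM2l// ler_wpM2l// exprn_ge0.
have X2 : A2 * (H ^+ n * `|d2|) <= A2 * (H ^+ n * H).
  by rewrite ler_wpM2l// ler_wpM2l// exprn_ge0.
have X3 : 0 <= A3 * (H ^+ n * H) by rewrite !mulr_ge0// exprn_ge0.
by rewrite -[leLHS]addr0 lerD// lerD.
Qed.
End ClassC.

(** * Families of functions with polynomial approximations of increasing order *)

Section Approximable.
Variables (K : realType) (I : Type) (eps : I -> K) (r : K).
Hypothesis eps_gt0 : forall i, 0 < eps i.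
Hypothesis eps_le1 : forall i, eps i <= 1.
Hypothesis r_ge0 : 0 <= r.

Definition bounded_family (a : I -> K) := exists A, forall i, `|a i| <= A.

(** Here [I] indexes the shearlets under consideration and [eps] is their scale.
    The coefficient of x^d may be as large as eps^d only, which is what makes the
    notion stable under products: a term of degree at least m is already of the
    order of the error. *)
Definition approximable (m : nat) (F : I -> K -> K) :=
  exists2 A : K, 0 <= A & forall i, exists p : {poly K},
    [/\ (size p <= m)%N, forall d, `|p`_d| <= A * eps i ^+ d &
        forall x, `|x| <= r -> `|F i x - p.[x]| <= A * eps i ^+ m].

Lemma eps_exp_le (i : I) m d : (m <= d)%N -> eps i ^+ d <= eps i ^+ m.
Proof.
by move=> md; rewrite ler_wiXn2l// ?ltW.
Qed.

Lemma coef_sum_bound (p : {poly K}) (A x : K) N : (size p <= N)%N ->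
  (forall d, `|p`_d| <= A) -> `|x| <= r -> `|p.[x]| <= \sum_(d < N) A * r ^+ d.
Proof.
move=> sp pA xr; rewrite (horner_coef_wide _ sp).
apply: le_trans (ler_norm_sum _ _ _) (ler_sum _ _) => d _.
by rewrite normrM normrX ler_pM// lerXn2r// nnegrE.
Qed.

(** The bound on the degree comes for free: the terms of degree m and more have
    coefficients at most A eps^m and are moved into the error. *)
Lemma approximable_poly m N (F : I -> K -> K) (A : K) :
  (forall i, exists p : {poly K},
    [/\ (size p <= N)%N, forall d, `|p`_d| <= A * eps i ^+ d &
        forall x, `|x| <= r -> `|F i x - p.[x]| <= A * eps i ^+ m]) ->
  approximable m F.
Proof.
move=> FP; pose S := \sum_(d < N) `|A| * r ^+ d.
have S0 : 0 <= S by apply: sumr_ge0 => d _; rewrite mulr_ge0// exprn_ge0.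
have eps0 i d : 0 <= eps i ^+ d by rewrite exprn_ge0// ltW.
exists (`|A| + S) => [|i]; first by rewrite addr_ge0.
have [p [sp pA Fp]] := FP i.
exists (take_poly m p); split; first exact: size_take_poly.
  move=> d; rewrite coef_take_poly; case: ifP => _.
    apply: le_trans (pA d) _; rewrite ler_wpM2r//.
    by rewrite (le_trans (ler_norm A))// lerDl.
  by rewrite normr0 mulr_ge0// addr_ge0.
move=> x xr; rewrite -{1}(poly_take_drop m p) in Fp.
have := Fp x xr; rewrite hornerD opprD addrA => Fp'.
set q := drop_poly m p * 'X^m in Fp'.
have qA d : `|q`_d| <= `|A| * eps i ^+ m.
  rewrite coefMXn; case: ltnP => [_|md]; first by rewrite normr0 mulr_ge0.
  rewrite coef_drop_poly subnK// (le_trans (pA d))//.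
  rewrite (le_trans (ler_wpM2r (eps0 _ _) (ler_norm A)))//.
  by rewrite ler_wpM2l// eps_exp_le.
have qN : (size q <= N)%N.
  apply/leq_sizeP => d Nd; rewrite coefMXn; case: ltnP => // md.
  by rewrite coef_drop_poly subnK//; move/leq_sizeP: sp => ->.
have := coef_sum_bound qN qA xr.
under eq_bigr do rewrite mulrAC.
rewrite -mulr_suml -/S => qS.
rewrite -[X in `|X|](subrK q.[x]) (le_trans (ler_normD _ _))// mulrDl lerD//.
by rewrite (le_trans Fp')// ler_wpM2r// ler_norm.
Qed.

Lemma approximable_near m (F G : I -> K -> K) (A : K) :
  approximable m F ->
  (forall i x, `|x| <= r -> `|G i x - F i x| <= A * eps i ^+ m) ->
  approximable m G.
Proof.
move=> [B B0 FB] GF; apply: (@approximable_poly m m _ (`|A| + B)) => i.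
have eps0 d : 0 <= eps i ^+ d by rewrite exprn_ge0// ltW.
have [p [sp pB Fp]] := FB i; exists p; split=> // [d|x xr].
  by rewrite (le_trans (pB d))// ler_wpM2r// lerDr.
rewrite -[X in `|X|](subrKA (F i x)) (le_trans (ler_normD _ _))// mulrDl lerD//.
  by rewrite (le_trans (GF _ _ xr))// ler_wpM2r// ler_norm.
exact: Fp.
Qed.

Lemma approximable_eq m (F G : I -> K -> K) :
  (forall i x, `|x| <= r -> F i x = G i x) -> approximable m F -> approximable m G.
Proof.
move=> FG aF; apply: (@approximable_near m F G 0 aF) => i x xr.
by rewrite FG// subrr normr0 mul0r.
Qed.

Lemma approximable_cst m (a : I -> K) : bounded_family a ->
  approximable m (fun i _ => a i).
Proof.
move=> [A aA]; apply: (@approximable_poly m 1 _ `|A|) => i.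
have eps0 d : 0 <= eps i ^+ d by rewrite exprn_ge0// ltW.
exists (a i)%:P; split=> [|d|x _]; first exact: size_polyC_leq1.
  rewrite coefC; case: eqP => [->|_]; last by rewrite normr0 mulr_ge0.
  by rewrite expr0 mulr1 (le_trans (aA i))// ler_norm.
by rewrite hornerC subrr normr0 mulr_ge0.
Qed.

Lemma approximable_epsX m : approximable m (fun i x => eps i * x).
Proof.
apply: (@approximable_poly m 2 _ 1) => i.
have eps0 d : 0 <= eps i ^+ d by rewrite exprn_ge0// ltW.
exists (eps i *: 'X); split=> [|d|x _].
- by rewrite (leq_trans (size_scale_leq _ _))// size_polyX.
- rewrite coefZ coefX mul1r; case: eqP => [->|_]; last by rewrite mulr0 normr0.
  by rewrite expr1 mulr1 ger0_norm// ltW.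
- by rewrite hornerZ hornerX subrr normr0 mul1r.
Qed.

Lemma approximableD m (F G : I -> K -> K) :
  approximable m F -> approximable m G ->
  approximable m (fun i x => F i x + G i x).
Proof.
move=> [A A0 FA] [B B0 GB]; apply: (@approximable_poly m m _ (A + B)) => i.
have [p [sp pA Fp]] := FA i; have [q [sq qB Gq]] := GB i.
exists (p + q); split=> [|d|x xr].
- by rewrite (leq_trans (size_polyD _ _))// geq_max sp.
- by rewrite coefD mulrDl (le_trans (ler_normD _ _))// lerD.
- by rewrite hornerD opprD addrACA mulrDl (le_trans (ler_normD _ _))// lerD ?Fp ?Gq.
Qed.

Lemma approximable_bounded m (F : I -> K -> K) : approximable m F ->
  exists2 A : K, 0 <= A & forall i x, `|x| <= r -> `|F i x| <= A.
Proof.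
move=> [A A0 FA]; exists (A + \sum_(d < m) A * r ^+ d) => [|i x xr].
  by rewrite addr_ge0// sumr_ge0// => d _; rewrite mulr_ge0// exprn_ge0.
have [p [sp pA Fp]] := FA i.
have e1 d : A * eps i ^+ d <= A.
  by rewrite ler_piMr// exprn_ile1// ltW.
rewrite -[X in `|X|](subrK p.[x]) (le_trans (ler_normD _ _))// lerD//.
  exact: le_trans (Fp x xr) (e1 _).
by apply: coef_sum_bound => // d; exact: le_trans (pA d) (e1 _).
Qed.

Lemma approximableM m (F G : I -> K -> K) :
  approximable m F -> approximable m G ->
  approximable m (fun i x => F i x * G i x).
Proof.
move=> aF aG; have [A' A'0 FA'] := approximable_bounded aF.
have [B' B'0 GB'] := approximable_bounded aG.
case: aF aG => [A A0 FA] [B B0 GB].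
pose C := A * \sum_(d < m) B * r ^+ d.
have s0 : 0 <= \sum_(d < m) B * r ^+ d.
  by rewrite sumr_ge0// => d _; rewrite mulr_ge0// exprn_ge0.
apply: (@approximable_poly m (m + m) _ (A' * B + C + (m + m)%:R * (A * B))) => i.
have [p [sp pA Fp]] := FA i; have [q [sq qB Gq]] := GB i.
have eps0 d : 0 <= eps i ^+ d by rewrite exprn_ge0// ltW.
have C0 : 0 <= A' * B + C by rewrite addr_ge0// mulr_ge0.
have mAB : 0 <= (m + m)%:R * (A * B) by rewrite !mulr_ge0.
have spq : (size (p * q)%R <= m + m)%N.
  by rewrite (leq_trans (size_polyMleq _ _))// (leq_trans (leq_pred _))// leq_add.
exists (p * q); split=> // [d|x xr].
- have [dm|dm] := leqP (m + m) d.
    by move/leq_sizeP: spq => ->//; rewrite normr0 mulr_ge0// addr_ge0.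
  rewrite coefM (le_trans (ler_norm_sum _ _ _))//.
  apply: (@le_trans _ _ (\sum_(j < d.+1) A * B * eps i ^+ d)).
    apply: ler_sum => j _; rewrite normrM.
    have -> : eps i ^+ d = eps i ^+ j * eps i ^+ (d - j)%N.
      by rewrite -exprD subnKC// -ltnS.
    by rewrite mulrACA ler_pM.
  rewrite sumr_const card_ord -[leLHS]mulr_natl mulrA ler_wpM2r//.
  apply: (@le_trans _ _ ((m + m)%:R * (A * B))); last by rewrite lerDr.
  by rewrite ler_wpM2r ?mulr_ge0// ler_nat.
- rewrite hornerM.
  have -> : F i x * G i x - p.[x] * q.[x] =
      F i x * (G i x - q.[x]) + (F i x - p.[x]) * q.[x] by ring.
  rewrite (le_trans (ler_normD _ _))// !normrM.
  rewrite (@le_trans _ _ ((A' * B + C) * eps i ^+ m))//; last first.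
    by rewrite ler_wpM2r// lerDl.
  rewrite mulrDl lerD//.
    by rewrite -mulrA ler_pM ?FA'// Gq.
  rewrite /C mulrAC ler_pM ?Fp//; apply: coef_sum_bound => // d.
  by rewrite (le_trans (qB d))// ler_piMr// exprn_ile1// ltW.
Qed.

Lemma approximableX m (F : I -> K -> K) l :
  approximable m F -> approximable m (fun i x => F i x ^+ l).
Proof.
move=> aF; elim: l => [|l IH].
  apply: (@approximable_eq _ (fun _ _ => 1)) => //.
  by apply: approximable_cst; exists `|1 : K|.
apply: (@approximable_eq _ (fun i x => F i x * F i x ^+ l)).
  by move=> i x _; rewrite exprS.
exact: approximableM.
Qed.

Lemma approximable_sum m n (F : nat -> I -> K -> K) :
  (forall l, (l < n)%N -> approximable m (F l)) ->
  approximable m (fun i x => \sum_(l < n) F l i x).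
Proof.
elim: n => [|n IH] FP.
  apply: (@approximable_eq _ (fun _ _ => 0)); first by move=> i x _; rewrite big_ord0.
  by apply: approximable_cst; exists `|0 : K|.
apply: (@approximable_eq _ (fun i x => \sum_(l < n) F l i x + F n i x)).
  by move=> i x _; rewrite big_ord_recr.
by apply: approximableD; [apply: IH => l ln; apply: FP; exact: ltnW|exact: FP].
Qed.

Lemma approximable_scale m (a : I -> K) (F : I -> K -> K) : bounded_family a ->
  approximable m F -> approximable m (fun i x => a i * F i x).
Proof. by move=> ba; apply: approximableM; exact: approximable_cst. Qed.

(** The one mechanism that improves the order. *)
Lemma approximable_eps m (F : I -> K -> K) :
  approximable m F -> approximable m.+1 (fun i x => eps i * F i x).
Proof.
move=> [A A0 FA]; apply: (@approximable_poly m.+1 m _ A) => i.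
have eps0 d : 0 <= eps i ^+ d by rewrite exprn_ge0// ltW.
have [p [sp pA Fp]] := FA i.
exists (eps i *: p); split=> [|d|x xr].
- by rewrite (leq_trans (size_scale_leq _ _)).
- rewrite coefZ normrM (le_trans _ (pA d))// ler_piMl//.
  by rewrite gtr0_norm.
- rewrite hornerZ -mulrBr normrM gtr0_norm// exprS mulrCA.
  by rewrite ler_wpM2l ?Fp// ltW.
Qed.

Lemma bounded_family_cst (c : K) : bounded_family (fun=> c).
Proof. by exists `|c|. Qed.

Lemma bounded_familyM (a b : I -> K) : bounded_family a -> bounded_family b ->
  bounded_family (fun i => a i * b i).
Proof.
move=> [A aA] [B bB]; exists (A * B) => i; rewrite normrM ler_pM//.
Qed.

Lemma bounded_familyB (a b : I -> K) : bounded_family a -> bounded_family b ->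
  bounded_family (fun i => a i - b i).
Proof.
move=> [A aA] [B bB]; exists (A + B) => i.
by rewrite (le_trans (ler_normB _ _))// lerD.
Qed.

Lemma bounded_family_taylor_coef m (H : K -> K) (y0 : I -> K) d :
  class_C m H -> (d <= m)%N -> bounded_family y0 ->
  bounded_family (fun i => derive1n d H (y0 i) / d`!%:R).
Proof.
move=> CH dm [Y hY]; have [A hA] := derive1n_bounded Y CH dm.
exists A => i; rewrite normrM normfV.
rewrite ler_pdivrMr ?normr_gt0 ?pnatr_eq0 -?lt0n ?fact_gt0//.
rewrite (le_trans (hA _ (hY i)))// ler_peMr//.
  exact: le_trans (normr_ge0 _) (hA _ (hY i)).
by rewrite ger0_norm// ler1n fact_gt0.
Qed.

Lemma horner_taylor_poly (H : K -> K) (y0 y : K) m :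
  (taylor_poly H y0 m).[y] =
  \sum_(d < m) derive1n d H y0 / d`!%:R * (y - y0) ^+ d.
Proof.
rewrite horner_sum; apply: eq_bigr => d _.
by rewrite hornerZ horner_exp hornerXsubC.
Qed.

(** The Taylor polynomial of H at y0 has degree less than m in w, and its
    remainder is O(|w|^m) = O(eps^m). *)
Lemma approximable_comp m (H : K -> K) (y0 : I -> K) (w : I -> K -> K) (A : K) :
  class_C m H -> bounded_family y0 -> approximable m w ->
  (forall i x, `|x| <= r -> `|w i x| <= A * eps i) ->
  approximable m (fun i x => H (y0 i + w i x)).
Proof.
move=> CH by0 aw wA; have [Y hY] := by0.
have [B B0 hB] := taylor_remainder (Y + `|A|) CH.
apply: (@approximable_near m (fun i x =>
    \sum_(d < m) derive1n d H (y0 i) / d`!%:R * w i x ^+ d) _ (B * `|A| ^+ m)).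
  apply: (@approximable_sum m m
    (fun d i x => derive1n d H (y0 i) / d`!%:R * w i x ^+ d)) => d dm.
  apply: approximable_scale; last exact: approximableX.
  by apply: bounded_family_taylor_coef CH _ by0; exact: ltnW.
move=> i x xr.
have wA' : `|w i x| <= `|A| * eps i.
  by rewrite (le_trans (wA _ _ xr))// ler_wpM2r ?ler_norm// ltW.
have wA1 : `|w i x| <= `|A|.
  by rewrite (le_trans wA')// ler_piMr.
have y0r : `|y0 i| <= Y + `|A| by rewrite (le_trans (hY i))// lerDl.
have ywr : `|y0 i + w i x| <= Y + `|A| by rewrite (le_trans (ler_normD _ _))// lerD.
have := hB _ _ y0r ywr; rewrite horner_taylor_poly addrAC subrr add0r.
move=> /le_trans; apply; rewrite -mulrA -exprMn.
rewrite ler_wpM2l//.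
by rewrite lerXn2r ?nnegrE// mulr_ge0// ltW.
Qed.

(** With X = a2 w + a1 ell, expand f (a0 + eps X) - f a0 to order m, divide by
    eps and move the linear part to the left: lam w equals a multiple of ell plus
    eps times a polynomial in X, up to O(eps^m), where lam = b2 - f'(a0) a2 stays
    away from 0.  If w is approximable to order k, so is the polynomial in X, and
    the factor eps makes w approximable to order k + 1.  The induction starts
    with k = 0, which only says that w is bounded. *)
Lemma approximable_implicit m (f : K -> K) (a0 a1 a2 b1 b2 : I -> K)
    (w ell : I -> K -> K) (eta : K) :
  class_C m.+1 f -> 0 < eta ->
  bounded_family a0 -> bounded_family a1 -> bounded_family a2 ->
  bounded_family b1 ->
  (forall i, eta <= `|b2 i - derive1 f (a0 i) * a2 i|) ->
  (forall d, approximable d ell) ->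
  (exists A, forall i x, `|x| <= r -> `|w i x| <= A) ->
  (forall i x, `|x| <= r ->
     eps i * (b2 i * w i x + b1 i * ell i x) =
     f (a0 i + eps i * (a2 i * w i x + a1 i * ell i x)) - f (a0 i)) ->
  approximable m w.
Proof.
move=> Cf eta0 ba0 ba1 ba2 bb1 lamP aell [W hW] eqw.
suff: forall k, (k <= m)%N -> approximable k w by exact.
elim=> [_|k IH km].
  apply: (@approximable_poly 0 0 _ W) => i; exists 0; split=> [|d|x xr].
  - by rewrite size_poly0.
  - rewrite coef0 normr0 mulr_ge0//; last by rewrite exprn_ge0// ltW.
    by apply: le_trans (normr_ge0 _) (hW i 0 _); rewrite normr0.
  - by rewrite horner0 subr0 expr0 mulr1 hW.
have {}IH := IH (ltnW km).
case: m Cf km => // m Cf km.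
pose lam i := b2 i - derive1 f (a0 i) * a2 i.
have lam0 i : lam i != 0.
  by rewrite -normr_gt0 (lt_le_trans eta0)// lamP.
have blam : bounded_family (fun i => (lam i)^-1).
  exists eta^-1 => i; rewrite normfV lef_pV2 ?posrE ?normr_gt0//; exact: lamP.
pose X i x := a2 i * w i x + a1 i * ell i x.
have aX : approximable k X.
  by apply: approximableD; apply: approximable_scale.
pose c l i := derive1n l f (a0 i) / l`!%:R.
have bc l : (l <= m.+2)%N -> bounded_family (c l).
  by move=> lm; exact: bounded_family_taylor_coef Cf lm ba0.
pose R i x := \sum_(l < m) c l.+2 i * (eps i ^+ l * X i x ^+ l.+2).
have aR : approximable k R.
  apply: (@approximable_sum k m
    (fun l i x => c l.+2 i * (eps i ^+ l * X i x ^+ l.+2))) => l lm.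
  apply: approximable_scale; first by apply: bc; rewrite !ltnS ltnW.
  apply: approximable_scale; last exact: approximableX.
  by exists 1 => i; rewrite normrX exprn_ile1// ger0_norm// ltW.
have [Y hY] := ba0.
have [XA XA0 hX] := approximable_bounded aX.
have [B B0 hB] := taylor_remainder (Y + XA) Cf.
apply: (@approximable_near k.+1 (fun i x => (lam i)^-1 *
   (- (b1 i - derive1 f (a0 i) * a1 i) * ell i x + eps i * R i x)) _
   (eta^-1 * (B * XA ^+ m.+2))).
  apply: approximable_scale => //; apply: approximableD.
    apply: approximable_scale => //.
    have bf : bounded_family (fun i => derive1 f (a0 i) * a1 i).
      apply: bounded_familyM => //; have [D hD] := bc 1%N isT.
      by exists D => i; have := hD i; rewrite /c derive1n1 divr1.
    have [D hD] := bounded_familyB bb1 bf.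
    by exists D => i; rewrite normrN; exact: hD.
  exact: approximable_eps.
move=> i x xr; have e0 := eps_gt0 i.
have E0 : eps i != 0 by rewrite gt_eqF.
have y0r : `|a0 i| <= Y + XA by rewrite (le_trans (hY i))// lerDl.
have eX : `|eps i * X i x| <= eps i * XA.
  by rewrite normrM gtr0_norm// ler_wpM2l ?hX// ltW.
have ywr : `|a0 i + eps i * X i x| <= Y + XA.
  rewrite (le_trans (ler_normD _ _))// lerD// (le_trans eX)// ler_piMl//.
have := hB _ _ y0r ywr; rewrite horner_taylor_poly.
rewrite [X in `|_ - X|](_ : _ = f (a0 i) + derive1 f (a0 i) * (eps i * X i x)
     + eps i ^+ 2 * R i x); last first.
  rewrite 2!big_ord_recl expr0 addrA.
  congr (_ + _ + _).
  - by rewrite mulr1 divr1.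
  - by rewrite /bump/= divr1 expr1 addrAC subrr add0r.
  - rewrite mulr_sumr; apply: eq_bigr => l _.
    change (c l.+2 i * (a0 i + eps i * X i x - a0 i) ^+ l.+2 =
      eps i ^+ 2 * (c l.+2 i * (eps i ^+ l * X i x ^+ l.+2))).
    by rewrite [_ - a0 i]addrAC subrr add0r exprMn -addn2 exprD; ring.
rewrite [a0 i + _ - a0 i]addrAC subrr add0r.
have -> : f (a0 i + eps i * X i x) -
  (f (a0 i) + derive1 f (a0 i) * (eps i * X i x) + eps i ^+ 2 * R i x) =
  eps i * (lam i * w i x - (- (b1 i - derive1 f (a0 i) * a1 i) * ell i x + eps i * R i x)).
  have := eqw i x xr; rewrite -/(X i x) => /eqP; rewrite eq_sym subr_eq => /eqP ->.
  by rewrite /lam /X; ring.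
set Q := - _ * _ + _.
have -> : w i x - (lam i)^-1 * Q = (lam i)^-1 * (lam i * w i x - Q) by field.
rewrite !normrM gtr0_norm// => le1.
have {le1} le2 : `|lam i * w i x - Q| <= B * XA ^+ m.+2 * eps i ^+ k.+1.
  rewrite -(ler_pM2l e0) (le_trans le1)//.
  apply: (@le_trans _ _ (B * (eps i * XA) ^+ m.+2)).
    have t : eps i * `|X i x| <= eps i * XA by rewrite ler_wpM2l ?hX// ltW.
    by rewrite ler_wpM2l// lerXn2r// nnegrE mulr_ge0// ltW.
  have -> : eps i * (B * XA ^+ m.+2 * eps i ^+ k.+1) =
      B * (eps i ^+ k.+2 * XA ^+ m.+2) by rewrite [eps i ^+ k.+2]exprS; ring.
  rewrite exprMn.
  rewrite ler_wpM2l// ler_wpM2r ?exprn_ge0//.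
  by rewrite eps_exp_le.
rewrite -mulrA ler_pM// normfV lef_pV2 ?posrE ?normr_gt0//; exact: lamP.
Qed.

End Approximable.

(** * Integrals of arbitrary functions, and affine changes of variables *)

Section AnyFunction.
Local Open Scope ereal_scope.
Context d (T : measurableType d) (R : realType).
Variable mu : {measure set T -> \bar R}.

(** The integral is the difference of the suprema over the simple functions below
    the positive and the negative part, which makes it monotone for arbitrary
    functions. *)
Lemma le_integral_any (f g : T -> \bar R) : (forall x, f x <= g x) ->
  \int[mu]_x f x <= \int[mu]_x g x.
Proof.
move=> fg; rewrite /integral/= !patch_setT; apply: leeB.
- apply: ereal_sup_le => _ [h hf <-]; exists h => // x.
  apply: le_trans (hf x) _.
  by apply: (@funepos_le _ _ setT) => [y _|]; rewrite ?inE.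
- apply: ereal_sup_le => _ [h hf <-]; exists h => // x.
  apply: le_trans (hf x) _; rewrite !funenegE.
  by rewrite ge_max le_max leeN2 fg/= le_max lexx orbT.
Qed.

(** Both f0 - b and f0 + b are measurable and enclose f.  The bound b may take
    the value +oo, which allows f to be arbitrary on a null set. *)
Lemma integral_near_any (f : T -> \bar R) (f0 : T -> R) (b : T -> \bar R) :
  mu.-integrable setT (EFin \o f0) -> measurable_fun setT b ->
  (forall x, `|f x - (f0 x)%:E| <= b x) ->
  `|\int[mu]_x f x| <= `|\int[mu]_x (f0 x)%:E| + \int[mu]_x b x.
Proof.
move=> if0 mb fb.
have b0 x : 0 <= b x by exact: le_trans (abse_ge0 _) (fb x).
have Ib0 : 0 <= \int[mu]_x b x by exact: integral_ge0.
have [Iby|Iby] := eqVneq (\int[mu]_x b x) +oo.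
  rewrite Iby addey ?leey//.
  by rewrite -ltNye (lt_le_trans _ (abse_ge0 _)).
have ib : mu.-integrable setT b.
  apply/integrableP; split=> //.
  rewrite (_ : \int[mu]_x `|b x| = \int[mu]_x b x) ?ltey//.
  by apply: eq_integral => x _; rewrite gee0_abs.
have fin0 := integrable_fin_num measurableT if0.
have finb := integrable_fin_num measurableT ib.
have le1 : \int[mu]_x f x <= \int[mu]_x (f0 x)%:E + \int[mu]_x b x.
  rewrite -(integralD measurableT if0 ib).
  apply: le_integral_any => x.
  rewrite -leeBlDl//; exact: le_trans (lee_abs _) (fb x).
have le2 : \int[mu]_x (f0 x)%:E - \int[mu]_x b x <= \int[mu]_x f x.
  rewrite -(integralB measurableT if0 ib).
  apply: le_integral_any => x /=.
  have [->|by'] := eqVneq (b x) +oo; first by rewrite leNye.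
  have bf : b x \is a fin_num by rewrite fin_numElt (lt_le_trans _ (b0 x))//= ltey.
  have := fb x; rewrite -(fineK bf); case: (f x) => [r| |] //=.
  by rewrite !lee_fin ler_norml => /andP[? _]; lra.
move: le1 le2; rewrite -(fineK fin0) -(fineK finb).
set I0 := fine _; set Ib := fine _.
case: (\int[mu]_x f x) => [r| |]//=.
rewrite !lee_fin => le1 le2.
have := ler_norm I0; have := ler_norm (- I0); rewrite normrN => h1 h2.
by rewrite ler_norml; apply/andP; split; lra.
Qed.
End AnyFunction.

Lemma funepos_comp (T U : Type) (R : realDomainType) (F : U -> \bar R) (g : T -> U) :
  (funepos (F \o g) = funepos F \o g)%E.
Proof. by apply: funext => x; rewrite /= !funeposE. Qed.

Lemma funeneg_comp (T U : Type) (R : realDomainType) (F : U -> \bar R) (g : T -> U) :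
  (funeneg (F \o g) = funeneg F \o g)%E.
Proof. by apply: funext => x; rewrite /= !funenegE. Qed.

Section AffineChange.
Local Open Scope ereal_scope.
Variable K : realType.
Notation mu := (@lebesgue_measure K).

Lemma measurable_affine (a b : K) : measurable_fun setT (fun x : K => a * x + b)%R.
Proof. by apply: measurable_funD => //; apply: measurable_funM. Qed.

(** The structure of measure is given by hand since it depends on a proof that the
    map is measurable. *)
Definition affine_pushforward (a b : K) : {measure set (measurableTypeR K) -> \bar K} :=
  @measure_function_pushforward__canonical__measure_function_Measure _ _
    (measurableTypeR K) (measurableTypeR K) K mu _ (@measurable_affine a b).

(** Both sides agree on half-open intervals, which characterise Lebesgue
    measure. *)
Lemma lebesgue_measure_affine (a : {posnum K}) (b : K) (A : set (measurableTypeR K)) :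
  measurable A ->
  mu A = mscale (a%:num%:nng)%R (affine_pushforward a%:num b) A.
Proof.
move=> mA; apply: lebesgue_measure_unique => //= _ [[u v]] _ <-.
rewrite /mscale /affine_pushforward /pushforward/=.
rewrite [X in _ * mu X](_ : _ =
  `]((u - b) / a%:num)%R, ((v - b) / a%:num)%R]%classic); last first.
  apply/seteqP; split=> x /=; rewrite !in_itv/= ltr_pdivrMr// ler_pdivlMr// mulrC;
    by rewrite ltrBlDr lerBrDr.
rewrite !lebesgue_measure_itv/= !lte_fin ltr_pM2r ?invr_gt0// ltrD2r.
case: ifP => _; rewrite ?mule0// -EFinB -EFinM; congr EFin.
by field.
Qed.

Lemma ge0_integral_affine (a b : K) (f : K -> \bar K) : (0 < a)%R ->
  measurable_fun setT f -> (forall x, 0 <= f x) ->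
  \int[mu]_x f (a * x + b)%R = (a^-1)%:E * \int[mu]_x f x.
Proof.
move=> a0 mf f0; pose a' := PosNum a0.
have mphi := @measurable_affine a b.
have -> : \int[mu]_x f x = \int[mscale (a'%:num%:nng)%R (affine_pushforward a b)]_x f x.
  apply: eq_measure_integral => A mA _.
  exact: (@lebesgue_measure_affine a').
rewrite ge0_integral_mscale//= muleA -EFinM mulVf ?gt_eqF// mul1e.
by rewrite ge0_integral_pushforward//=.
Qed.

Definition shear_map (s1 s2 kap m1 m2 : K) (x : K * K) : K * K :=
  (s1 * (x.1 + kap * x.2) - m1, s2 * x.2 - m2)%R.

Lemma measurable_shear_map s1 s2 kap m1 m2 :
  measurable_fun setT (shear_map s1 s2 kap m1 m2).
Proof.
apply: measurable_fun_pair; apply: measurable_funB => //.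
  apply: measurable_funM => //; apply: measurable_funD => //.
  by apply: measurable_funM.
by apply: measurable_funM.
Qed.

(** By Tonelli it suffices to substitute in one variable at a time: for fixed y
    the shear is a translation in x. *)
Lemma ge0_integral_shear s1 s2 kap m1 m2 (F : K * K -> \bar K) :
  (0 < s1)%R -> (0 < s2)%R -> measurable_fun setT F -> (forall x, 0 <= F x) ->
  \int[@lebesgue2 K]_x F (shear_map s1 s2 kap m1 m2 x) =
  ((s1 * s2)^-1)%:E * \int[@lebesgue2 K]_x F x.
Proof.
move=> s10 s20 mF F0.
have mFs : measurable_fun setT (F \o shear_map s1 s2 kap m1 m2).
  by apply: measurableT_comp => //; exact: measurable_shear_map.
pose H y := \int[mu]_x F (x, y).
have mH : measurable_fun setT H by exact: measurable_fun_fubini_tonelli_G.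
have H0 y : 0 <= H y by exact: integral_ge0.
rewrite /lebesgue2 (@fubini_tonelli2 _ _ _ _ _ mu mu (F \o _) mFs); last first.
  by move=> x; exact: F0.
rewrite [in RHS](@fubini_tonelli2 _ _ _ _ _ mu mu F)// /fubini_G/= -/H.
transitivity (\int[mu]_y ((s1^-1)%:E * H (s2 * y - m2)%R)).
  apply: eq_integral => y _; rewrite /shear_map/=.
  rewrite -(@ge0_integral_affine s1 (s1 * (kap * y) - m1)%R (fun x => F (x, s2 * y - m2)%R))//.
    by apply: eq_integral => x _; rewrite mulrDr addrA.
  by apply: measurableT_comp => //; apply: measurable_fun_pair.
rewrite ge0_integralZl_EFin//; last 2 first.
- by apply: measurableT_comp => //; exact: measurable_affine.
- by rewrite invr_ge0 ltW.
by rewrite ge0_integral_affine// muleA -EFinM -invfM.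
Qed.

Lemma integral_shear s1 s2 kap m1 m2 (F : K * K -> \bar K) :
  (0 < s1)%R -> (0 < s2)%R -> measurable_fun setT F ->
  \int[@lebesgue2 K]_x F (shear_map s1 s2 kap m1 m2 x) =
  ((s1 * s2)^-1)%:E * \int[@lebesgue2 K]_x F x.
Proof.
move=> s10 s20 mF; rewrite integralE [in RHS]integralE.
have -> := funepos_comp F (shear_map s1 s2 kap m1 m2).
have -> := funeneg_comp F (shear_map s1 s2 kap m1 m2).
rewrite /= !ge0_integral_shear//; last 2 first.
- exact: measurable_funeneg.
- exact: measurable_funepos.
set X := \int[_]_x _; set Y := \int[_]_x _.
have c0 : (0 < (s1 * s2)^-1)%R by rewrite invr_gt0 mulr_gt0.
have c0' : 0 < ((s1 * s2)^-1)%:E by rewrite lte_fin.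
case: X => [a| |]; case: Y => [b| |]; rewrite ?(gt0_muley c0') ?(gt0_muleNy c0')//=;
  rewrite ?(gt0_muley c0') ?(gt0_muleNy c0')//.
set e := (_^-1)%R; change ((e * a + - (e * b))%:E = (e * (a + - b))%:E); congr EFin; ring.
Qed.

Let flip (x : K * K) := (x.2, x.1).

Lemma integral_swap (F : K * K -> \bar K) : measurable_fun setT F ->
  \int[@lebesgue2 K]_x F (x.2, x.1) = \int[@lebesgue2 K]_x F x.
Proof.
move=> mF; rewrite integralE [in RHS]integralE.
have gen (G : K * K -> \bar K) : measurable_fun setT G -> (forall x, 0 <= G x) ->
    \int[@lebesgue2 K]_x G (flip x) = \int[@lebesgue2 K]_x G x.
  move=> mG G0; rewrite /lebesgue2 (@fubini_tonelli2 _ _ _ _ _ mu mu (G \o flip)).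
  - by rewrite [in RHS](@fubini_tonelli1 _ _ _ _ _ mu mu G).
  - by apply: measurableT_comp => //; apply: measurable_fun_pair.
  - by move=> x; exact: G0.
have -> := funepos_comp F flip; have -> := funeneg_comp F flip.
by rewrite /= !gen//; [exact: measurable_funeneg|exact: measurable_funepos].
Qed.
End AffineChange.

(** * Integration against a function of one variable with compact support *)

Section OneDim.
Variable K : realType.
Notation mu := (@lebesgue_measure K).

Lemma integrable_bounded_support d (T : measurableType d)
    (nu : {measure set T -> \bar K}) (E : set T) (f : T -> K) (A : K) :
  measurable_fun setT f -> measurable E -> (nu E < +oo)%E -> 0 <= A ->
  (forall x, `|f x| <= A * \1_E x) ->
  nu.-integrable setT (EFin \o f).
Proof.
move=> mf mE finE A0 fA; apply/integrableP; split; first exact/measurable_EFinP.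
apply: (@le_lt_trans _ _ (\int[nu]_x (A%:E * (\1_E x)%:E))%E).
  by apply: le_integral_any => x; rewrite /= -EFinM lee_fin.
rewrite ge0_integralZl_EFin//; last first.
  by apply/measurable_EFinP; exact: measurable_indic.
rewrite integral_indic// setIT lte_mul_pinfty//.
Qed.

Lemma lebesgue_segment_sym (r : K) : 0 <= r ->
  mu (`[- r, r]%classic : set K) = (2 * r)%:E.
Proof.
move=> r0; rewrite lebesgue_measure_itv/= lte_fin.
by case: ltP => [_|rr]; rewrite -?EFinB; congr EFin; lra.
Qed.

Lemma integrable_compact_support (f : K -> K) (r A : K) : 0 <= r -> 0 <= A ->
  measurable_fun setT f -> (forall x, `|f x| <= A) ->
  (forall x, r < `|x| -> f x = 0) ->
  mu.-integrable setT (EFin \o f).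
Proof.
move=> r0 A0 mf fA f0.
apply: (@integrable_bounded_support _ _ mu `[- r, r]%classic f A) => //.
  by have := ltry (2 * r); rewrite -(lebesgue_segment_sym r0).
move=> x; rewrite indicE; case: (boolP (x \in _)) => xr; first by rewrite mulr1.
rewrite mulr0 f0 ?normr0// ltNge ler_norml; apply: contra xr => xr.
by rewrite inE/= in_itv.
Qed.

Lemma vanishing_outside_bounded (f : K -> K) (r : K) : continuous f ->
  (forall x, r < `|x| -> f x = 0) -> exists2 A, 0 <= A & forall x, `|f x| <= A.
Proof.
move=> cf f0; have [A hA] := continuous_bounded_segment r cf.
exists `|A| => // x; have [xr|xr] := leP `|x| r.
  exact: le_trans (hA _ xr) (ler_norm _).
by rewrite f0// normr0.
Qed.

Variables (phi : K -> K) (r : K).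
Hypothesis r0 : 0 <= r.
Hypothesis phi_out : forall x, r < `|x| -> phi x = 0.

Definition weighted_pow (c : nat) (t : K) := phi t * t ^+ c.

Definition primitive (c : nat) (y : K) := (\int[mu]_(t in `]-oo, y]) weighted_pow c t)%R.

Lemma class_C_weighted_pow n c : class_C n phi -> class_C n (weighted_pow c).
Proof.
move=> Cphi; have := class_CM Cphi (class_C_horner n 'X^c).
by congr class_C; apply/funext => t; rewrite /weighted_pow/= hornerXn.
Qed.

Lemma weighted_pow_bounded c : continuous phi ->
  exists2 A, 0 <= A & forall t, `|weighted_pow c t| <= A.
Proof.
move=> cphi; apply: (@vanishing_outside_bounded _ r).
  by apply/class_C0/class_C_weighted_pow/class_C0.
by move=> t tr; rewrite /weighted_pow phi_out// mul0r.
Qed.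

Lemma integrable_weighted_pow c : continuous phi -> mu.-integrable setT (EFin \o weighted_pow c).
Proof.
move=> cphi; have [A A0 hA] := weighted_pow_bounded c cphi.
apply: (integrable_compact_support r0 A0) => // [|x rx].
  apply: continuous_measurable_fun.
  by apply/class_C0/class_C_weighted_pow/class_C0.
by rewrite /weighted_pow phi_out// mul0r.
Qed.

(** Integration gains one derivative, by the fundamental theorem of calculus. *)
Lemma class_C_primitive n c : class_C n phi -> class_C n.+1 (primitive c).
Proof.
move=> Cphi; have cphi := class_C_continuous Cphi.
have Cm := class_C_weighted_pow c Cphi; have cm := class_C_continuous Cm.
have dH x : derivable (primitive c) x 1 /\ derive1 (primitive c) x = weighted_pow c x.
  apply: (@continuous_FTC1 K (weighted_pow c) -oo%O x (x + 1)) => //.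
  - by rewrite ltrDl.
  - apply: (@integrableS _ _ _ mu setT) => //; exact: integrable_weighted_pow.
  - by rewrite ltNyr.
  - exact: cm.
apply/class_CS; split; first by move=> x; case: (dH x).
by have -> : derive1 (primitive c) = weighted_pow c by apply/funext => x; case: (dH x).
Qed.

Lemma integral_weighted_pow_below c (e : K) : continuous phi ->
  (\int[mu]_y (weighted_pow c y * (y <= e)%R%:R)%:E)%E = (primitive c e)%:E.
Proof.
move=> cphi; rewrite /primitive /Rintegral fineK; last first.
  apply: integrable_fin_num => //.
  by apply: (@integrableS _ _ _ mu setT) => //; exact: integrable_weighted_pow.
rewrite [RHS]integral_mkcond; apply: eq_integral => y _.
rewrite patchE; case: ifPn; rewrite ?inE ?notin_setE/= in_itv/=.
  by move=> ->; rewrite mulr1.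
by move=> /negP/negbTE ->; rewrite mulr0.
Qed.

Lemma integral_weighted_pow c : continuous phi ->
  (\int[mu]_y (weighted_pow c y)%:E)%E = (fine (\int[mu]_y (weighted_pow c y)%:E))%:E.
Proof.
move=> cphi; rewrite fineK//; apply: integrable_fin_num => //.
exact: integrable_weighted_pow.
Qed.

Lemma integral_moments_poly M (p : {poly K}) : continuous phi ->
  vanishing_moments M phi -> (size p <= M)%N ->
  (\int[mu]_x (phi x * p.[x])%:E = 0)%E.
Proof.
move=> cphi vm sp.
transitivity (\int[mu]_x (\sum_(i < M) (p`_i)%:E * (weighted_pow i x)%:E)%E)%E.
  apply: eq_integral => x _; rewrite (horner_coef_wide _ sp) mulr_sumr -sumEFin.
  by apply: eq_bigr => i _; rewrite -EFinM /weighted_pow; congr EFin; ring.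
rewrite integral_sum//; last first.
  by move=> i; apply: integrableZl => //; exact: integrable_weighted_pow.
rewrite big1// => i _; rewrite integralZl//; last exact: integrable_weighted_pow.
have := vm i (ltn_ord i).
rewrite (_ : (\int[mu]_x _)%E = (\int[mu]_x (weighted_pow i x)%:E)%E) => [->|].
  by rewrite mule0.
by apply: eq_integral => x _; rewrite /weighted_pow mulrC.
Qed.

(** Subtracting p from W costs nothing, since phi is orthogonal to p; what is left
    is at most delta on an interval of length 2 r. *)
Lemma moments_bound M (W : K -> K) (p : {poly K}) (B delta : K) : continuous phi ->
  vanishing_moments M phi -> (size p <= M)%N ->
  0 <= B -> 0 <= delta ->
  (forall x, `|phi x| <= B) ->
  (forall x, `|x| <= r -> `|W x - p.[x]| <= delta) ->
  (`|\int[mu]_x (phi x * W x)%:E| <= (B * delta * (2 * r))%:E)%E.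
Proof.
move=> cphi vm sp B0 d0 phiB Wp.
have ip : mu.-integrable setT (EFin \o (fun x => phi x * p.[x])).
  have [A hA] := continuous_bounded_segment r (@continuous_horner K p).
  apply: (@integrable_compact_support _ r (B * `|A|)) => //.
  - by rewrite mulr_ge0.
  - apply: continuous_measurable_fun => x.
    by apply: continuousM; [exact: cphi|exact: continuous_horner].
  - move=> x; rewrite normrM; have [xr|xr] := leP `|x| r.
      by rewrite ler_pM// (le_trans (hA _ xr))// ler_norm.
    by rewrite phi_out// normr0 mul0r mulr_ge0.
  - by move=> x xr; rewrite phi_out// mul0r.
pose b x := ((B * delta)%:E * (\1_(`[- r, r]%classic) x)%:E)%E : \bar K.
have := @integral_near_any _ _ _ mu (fun x => (phi x * W x)%:E) _ b ip.
rewrite (integral_moments_poly cphi vm sp) abse0 add0e.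
rewrite /b ge0_integralZl_EFin//; last 2 first.
- by apply/measurable_EFinP; exact: measurable_indic.
- by rewrite mulr_ge0.
rewrite integral_indic// setIT.
rewrite [X in (_ <= _ * X)%E](_ : _ = (2 * r)%:E); last exact: lebesgue_segment_sym.
rewrite -EFinM; apply.
  apply/measurable_EFinP/measurable_funM => //; exact: measurable_indic.
move=> x; rewrite -EFinB -EFinM lee_fin -mulrBr normrM indicE.
have [xr|xr] := leP `|x| r.
  rewrite mem_set ?mulr1; first by rewrite ler_pM// Wp.
  by rewrite /= in_itv/= -ler_norml.
by rewrite phi_out// normr0 mul0r !mulr_ge0.
Qed.

End OneDim.

(** * The integral of a function with a jump along a graph *)

Lemma integral_weighted_pow_sum (K : realType) (phi : K -> K) (r : K) (D : nat)
    (a b : nat -> K) (e : K) : 0 <= r -> (forall x, r < `|x| -> phi x = 0) ->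
  continuous phi ->
  (\int[@lebesgue_measure K]_y (\sum_(c < D)
     (a c * weighted_pow phi c y + b c * (weighted_pow phi c y * (y <= e)%R%:R)))%:E)%E =
  (\sum_(c < D) (a c * fine (\int[@lebesgue_measure K]_y (weighted_pow phi c y)%:E)%E
     + b c * primitive phi c e))%:E.
Proof.
move=> r0 phi_out cphi; set mu := @lebesgue_measure K.
have im c := @integrable_weighted_pow K phi r r0 phi_out c cphi.
have imb c : mu.-integrable setT (EFin \o (fun y => weighted_pow phi c y * (y <= e)%R%:R)).
  have [A A0 hA] := @weighted_pow_bounded K phi r phi_out c cphi.
  apply: (@integrable_compact_support _ _ r A) => //.
  - apply: measurable_funM.
      apply: continuous_measurable_fun.
      by apply/class_C0/class_C_weighted_pow/class_C0.
    rewrite (_ : (fun _ => _) = \1_(`]-oo, e]%classic)).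
      exact: measurable_indic.
    apply/funext => y; rewrite indicE; case: (boolP (y \in _)).
      by rewrite inE/= in_itv/= => ->.
    by rewrite notin_setE/= in_itv/= => /negP/negbTE ->.
  - by move=> y; rewrite normrM (le_trans _ (hA y))// ler_piMr// normr_nat lern1 leq_b1.
  - by move=> y yr; rewrite /weighted_pow phi_out// !mul0r.
under eq_integral do rewrite -sumEFin.
rewrite integral_sum//; last first.
  move=> c; rewrite /=.
  exact: (integrableD measurableT (integrableZl measurableT (a c) (im c))
    (integrableZl measurableT (b c) (imb c))).
rewrite -sumEFin; apply: eq_bigr => c _.
under eq_integral do rewrite EFinD [X in (X + _)%E]EFinM [X in (_ + X)%E]EFinM.
rewrite (integralD measurableT (integrableZl measurableT (a c) (im c))
    (integrableZl measurableT (b c) (imb c))).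
rewrite (integralZl measurableT (im c)) (integralZl measurableT (imb c)).
rewrite (@integral_weighted_pow_below _ _ r)// (@integral_weighted_pow _ _ r)//.
Qed.

Section Core.
Variables (K : realType) (I : Type) (eps : I -> K) (r : K).
Hypothesis eps_gt0 : forall i, 0 < eps i.
Hypothesis eps_le1 : forall i, eps i <= 1.
Hypothesis r_ge0 : 0 <= r.
Notation mu := (@lebesgue_measure K).
Notation approximable := (approximable eps r).

(** The factor z^l comes with no power of eps, so the sum is not approximable in
    the above sense; it is still close to a polynomial of degree less than
    P + n. *)
Lemma approximable_weighted n P (q : nat -> I -> K -> K) :
  (forall l, (l < P)%N -> approximable n (q l)) ->
  exists2 A : K, 0 <= A & forall i, exists2 p : {poly K}, (size p <= P + n)%N &
    forall x, `|x| <= r ->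
      `|\sum_(l < P) x ^+ l * q l i x - p.[x]| <= A * eps i ^+ n.
Proof.
elim: P => [|P IH] qP.
  exists 0 => // i; exists 0 => [|x _]; first by rewrite size_poly0.
  by rewrite big_ord0 horner0 subr0 normr0 mul0r.
have [|A A0 hA] := IH; first by move=> l lP; apply: qP; exact: ltnW.
have [B B0 hB] := qP P (ltnSn P).
have rP : 0 <= r ^+ P by rewrite exprn_ge0.
exists (A + r ^+ P * B) => [|i]; first by rewrite addr_ge0// mulr_ge0.
have [p sp hp] := hA i; have [s [ss _ hs]] := hB i.
exists (p + 'X^P * s) => [|x xr].
  rewrite (leq_trans (size_polyD _ _))// geq_max.
  rewrite (leq_trans sp) ?leq_add2r//= (leq_trans (size_polyMleq _ _))//.
  by rewrite size_polyXn addSn /= (leq_trans _ (leqnSn _))// leq_add2l.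
rewrite big_ord_recr/= hornerD hornerM hornerXn opprD addrACA -mulrBr.
rewrite (le_trans (ler_normD _ _))// mulrDl lerD ?hp//.
by rewrite normrM -mulrA normrX ler_pM ?exprn_ge0 ?hs// lerXn2r ?nnegrE.
Qed.

Variables (psi phi : K -> K).
Hypothesis cpsi : continuous psi.
Hypothesis cphi : continuous phi.
Hypothesis psi_out : forall x, r < `|x| -> psi x = 0.
Hypothesis phi_out : forall x, r < `|x| -> phi x = 0.
Variables (M n P D : nat).
Hypothesis PnM : (P + n <= M)%N.
Hypothesis psi_moments : vanishing_moments M psi.
Variables (t s : I -> nat -> nat -> K) (A : K).
Hypothesis A0 : 0 <= A.
Hypothesis tA : forall i l c, `|t i l c| <= A.
Hypothesis sA : forall i l c, `|s i l c| <= A.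
Variables (e : I -> K -> K) (S : I -> set (K * K)).
Hypothesis approx_e : forall c, approximable n (fun i z => primitive phi c (e i z)).
Hypothesis mS : forall i, measurable (S i).
Hypothesis SP : forall i z y, `|z| <= r -> `|y| <= r -> S i (z, y) <-> y <= e i z.

Let psi_bound := vanishing_outside_bounded cpsi psi_out.
Let phi_bound := vanishing_outside_bounded cphi phi_out.

(** What is left of u in the adapted coordinates once g1 and g2 are replaced by
    polynomials: the indicator of B equals, off the curve, a constant plus a
    multiple of the indicator of S. *)
Definition model i (x : K * K) : K :=
  \sum_(l < P) \sum_(c < D)
    (t i l c + s i l c * \1_(S i) x) * x.1 ^+ l * x.2 ^+ c.

Let box := (`[- r, r]%classic `*` `[- r, r]%classic : set (K * K)).

Let in_box x : box x <-> `|x.1| <= r /\ `|x.2| <= r.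
Proof. by rewrite /box /= /setX/= !in_itv/= -!ler_norml. Qed.

Let mbox : measurable box. Proof. by apply: measurableX. Qed.

Let box_area : (@lebesgue2 K) box = ((2 * r) ^+ 2)%:E.
Proof.
rewrite /lebesgue2 /box product_measure1E//.
rewrite [X in (X * _)%E](lebesgue_segment_sym r_ge0).
by rewrite [X in (_ * X)%E](lebesgue_segment_sym r_ge0).
Qed.

Let F0 i (x : K * K) : K := psi x.1 * phi x.2 * model i x.

Let measurable_F0 i : measurable_fun setT (F0 i).
Proof.
apply: measurable_funM; first apply: measurable_funM.
- by apply: measurableT_comp => //; exact: continuous_measurable_fun.
- by apply: measurableT_comp => //; exact: continuous_measurable_fun.
apply: measurable_sum => l; apply: measurable_sum => c.
apply: measurable_funM; last exact: measurable_funX.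
apply: measurable_funM; last exact: measurable_funX.
apply: measurable_funD => //; apply: measurable_funM => //.
Qed.

Let F0_out i x : ~ box x -> F0 i x = 0.
Proof.
move=> /in_box/not_andP[] /negP; rewrite -ltNge => h; rewrite /F0.
- by rewrite psi_out// !mul0r.
- by rewrite phi_out// mulr0 mul0r.
Qed.

Let integrable_F0 i : (@lebesgue2 K).-integrable setT (EFin \o F0 i).
Proof.
have [B1 B10 hB1] := psi_bound; have [B2 B20 hB2] := phi_bound.
pose V := \sum_(l < P) \sum_(c < D) (A + A) * r ^+ l * r ^+ c.
have V0 : 0 <= V.
  by do 2!apply: sumr_ge0 => ? _; rewrite !mulr_ge0 ?exprn_ge0// addr_ge0.
rewrite /lebesgue2.
apply: (@integrable_bounded_support _ _ _ (mu \x mu)%E box _ (B1 * B2 * V)).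
- exact: measurable_F0.
- exact: mbox.
- by have := ltry ((2 * r) ^+ 2); rewrite -box_area.
- by rewrite !mulr_ge0.
move=> x; rewrite indicE; case: (boolP (x \in box)) => [|xb]; last first.
  by move: xb; rewrite notin_setE => xb; rewrite mulr0 F0_out ?normr0.
rewrite inE => /in_box[x1 x2]; rewrite mulr1 /F0 !normrM ler_pM//.
  by rewrite ler_pM.
rewrite (le_trans (ler_norm_sum _ _ _))// ler_sum// => l _.
rewrite (le_trans (ler_norm_sum _ _ _))// ler_sum// => c _.
rewrite !normrM !normrX !ler_pM ?exprn_ge0 ?mulr_ge0 ?exprn_ge0 ?lerXn2r ?nnegrE//.
rewrite (le_trans (ler_normD _ _))// lerD// normrM (le_trans _ (sA i l c))//.
by rewrite ler_piMr// indicE normr_nat lern1 leq_b1.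
Qed.

Let J c := fine (\int[mu]_y (weighted_pow phi c y)%:E)%E.
Let q l i z := \sum_(c < D) (t i l c * J c + s i l c * primitive phi c (e i z)).
(** For fixed z the inner integral is psi z times this function. *)
Let W i z := \sum_(l < P) z ^+ l * q l i z.

Let inner_integral i z : (\int[mu]_y (F0 i (z, y))%:E)%E = (psi z * W i z)%:E.
Proof.
have [zr|zr] := leP `|z| r; last first.
  rewrite psi_out// mul0r integral0_eq// => y _.
  by rewrite /F0 psi_out// !mul0r.
pose a c := psi z * \sum_(l < P) z ^+ l * t i l c.
pose b c := psi z * \sum_(l < P) z ^+ l * s i l c.
transitivity (\int[mu]_y (\sum_(c < D)
   (a c * weighted_pow phi c y + b c * (weighted_pow phi c y * (y <= e i z)%R%:R)))%:E)%E.
  apply: eq_integral => y _; congr EFin; rewrite /F0/=.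
  have [yr|yr] := leP `|y| r; last first.
    rewrite phi_out// mulr0 mul0r big1// => c _.
    by rewrite /weighted_pow phi_out// !mul0r !mulr0 addr0.
  have -> : model i (z, y) = \sum_(c < D) \sum_(l < P)
      (t i l c + s i l c * (y <= e i z)%R%:R) * z ^+ l * y ^+ c.
    rewrite /model exchange_big/=; apply: eq_bigr => c _; apply: eq_bigr => l _.
    rewrite indicE; congr ((_ + _ * _%:R) * _ * _).
    congr nat_of_bool; apply/idP/idP => [|h].
      by rewrite inE => /(SP i zr yr).
    by rewrite inE; exact/(SP i zr yr).
  rewrite mulr_sumr; apply: eq_bigr => c _; rewrite /a /b /weighted_pow.
  rewrite !mulr_sumr !mulr_suml -big_split/=.
  by apply: eq_bigr => l _; ring.
rewrite (@integral_weighted_pow_sum _ _ r)//; congr EFin.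
rewrite /W /q /a /b mulr_sumr.
under [RHS]eq_bigr do rewrite 2!mulr_sumr.
rewrite [RHS]exchange_big/=; apply: eq_bigr => c _; rewrite -/(J c).
by rewrite !mulr_sumr !mulr_suml -big_split/=; apply: eq_bigr => l _; ring.
Qed.

Let approx_q l : approximable n (q l).
Proof.
pose G c i z := t i l c * J c + s i l c * primitive phi c (e i z).
apply: (@approximable_sum K I eps r eps_gt0 eps_le1 r_ge0 n D G) => c _.
apply: approximableD => //.
  apply: approximable_cst => //; exists (A * `|J c|) => i.
  by rewrite normrM ler_wpM2r.
by apply: approximable_scale => //; exists A => i.
Qed.

(** Integrate in y first: the inner integral is psi z * W z, where W is close to a
    polynomial of degree less than P + n, and the moments of psi vanish. *)
Lemma model_integral : exists2 C : K, 0 <= C & forall i,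
  (`|\int[@lebesgue2 K]_x (psi x.1 * phi x.2 * model i x)%:E| <= (C * eps i ^+ n)%:E)%E.
Proof.
have [B1 B10 hB1] := psi_bound.
have C0h := approximable_weighted (fun l (_ : (l < P)%N) => approx_q l).
have [C C0 hC] := C0h.
exists (B1 * C * (2 * r)) => [|i]; first by rewrite !mulr_ge0.
have e0 : 0 <= C * eps i ^+ n by rewrite mulr_ge0// exprn_ge0// ltW.
have [p sp hp] := hC i.
rewrite -/(F0 i) /lebesgue2 -(integral12_prod_meas1 (integrable_F0 i)).
rewrite /fubini_F/=; under eq_integral do rewrite inner_integral.
have := @moments_bound K psi r r_ge0 psi_out M (W i) p B1 (C * eps i ^+ n) cpsi
  psi_moments (leq_trans sp PnM) B10 e0 hB1 hp.
by move=> /le_trans; apply; rewrite lee_fin; lra.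
Qed.

(** The integrand is now read in the original variables, through the change of
    coordinates [T i] with Jacobian [k i].  The function [u] is compared with the
    model only off the graph [N i], and need not be measurable. *)
Variables (T : I -> K * K -> K * K) (k : I -> K).
Hypothesis k_ge0 : forall i, 0 <= k i.
Hypothesis mT : forall i, measurable_fun setT (T i).
Hypothesis integral_T : forall i (F : K * K -> \bar K), measurable_fun setT F ->
  (\int[@lebesgue2 K]_x F (T i x) = (k i)%:E * \int[@lebesgue2 K]_x F x)%E.
Variables (u : I -> K * K -> K) (N : I -> set (K * K)).
Hypothesis mN : forall i, measurable (N i).
Hypothesis NP : forall i z y, `|z| <= r -> `|y| <= r -> N i (z, y) <-> y = e i z.
Hypothesis uP : forall i x, `|(T i x).1| <= r -> `|(T i x).2| <= r ->
  (T i x).2 <> e i (T i x).1 -> `|u i x - model i (T i x)| <= A * eps i ^+ P.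

Let graph_null i : (@lebesgue2 K (N i `&` box) = 0)%E.
Proof.
have mNb : measurable (N i `&` box) by apply: measurableI.
rewrite /lebesgue2 /product_measure1 integral0_eq// => z _ /=.
apply/eqP; rewrite eq_le measure_ge0 andbT.
rewrite -(lebesgue_measure_set1 (e i z)); apply: le_measure; rewrite ?inE//.
  exact: measurable_xsection.
move=> y; rewrite /xsection/= inE => -[Nzy /in_box[/= zr yr]].
by apply/(NP i zr yr).
Qed.

(** Off the graph the integrand differs from the model by O(eps^P) in the window
    and not at all outside it, so [integral_near_any] applies, with a bound that
    is infinite on the graph. *)
Lemma core_estimate : exists2 C : K, 0 <= C & forall i (Q : K), 0 <= Q ->
  (`|\int[@lebesgue2 K]_x (Q * (psi (T i x).1 * phi (T i x).2) * u i x)%:E|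
    <= (C * (Q * k i * (eps i ^+ P + eps i ^+ n)))%:E)%E.
Proof.
have [B1 B10 hB1] := psi_bound; have [B2 B20 hB2] := phi_bound.
have [C C0 hC] := model_integral.
pose C' := B1 * B2 * A * (2 * r) ^+ 2.
have C'0 : 0 <= C' by rewrite !mulr_ge0.
exists (C + C') => [|i Q Q0]; first by rewrite addr_ge0.
have eP0 d : 0 <= eps i ^+ d by rewrite exprn_ge0// ltW.
pose c := Q * (B1 * B2 * (A * eps i ^+ P)).
have c0 : 0 <= c by rewrite !mulr_ge0.
pose b0 (x : K * K) := (c%:E * (\1_box x)%:E + +oo * (\1_(N i `&` box) x)%:E)%E.
have mNb : measurable (N i `&` box) by apply: measurableI.
have mi1 : measurable_fun setT (fun x : K * K => (c%:E * (\1_box x)%:E)%E).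
  by apply/measurable_EFinP/measurable_funM => //; exact: measurable_indic.
have mi2 : measurable_fun setT (fun x : K * K => (+oo * (\1_(N i `&` box) x)%:E)%E : \bar K).
  apply: emeasurable_funM => //.
  by apply/measurable_EFinP; exact: measurable_indic.
have mb0 : measurable_fun setT b0 by apply: emeasurable_funD.
have nn1 (x : K * K) : (0 <= c%:E * (\1_box x)%:E)%E by rewrite mule_ge0// ?lee_fin.
have nn2 (x : K * K) : (0 <= +oo * (\1_(N i `&` box) x)%:E :> \bar K)%E.
  by rewrite mule_ge0// ?lee_fin.
have Ib0 : (\int[@lebesgue2 K]_x b0 x = (c * (2 * r) ^+ 2)%:E)%E.
  rewrite /lebesgue2 /b0.
  rewrite (ge0_integralD (mu \x mu)%E measurableT (fun x _ => nn1 x) mi1 (fun x _ => nn2 x) mi2).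
  rewrite ge0_integralZl_EFin//; last first.
    by apply/measurable_EFinP; exact: measurable_indic.
  rewrite ge0_integralZl//; last first.
    by apply/measurable_EFinP; exact: measurable_indic.
  rewrite !integral_indic// !setIT.
  by rewrite [X in (_ + +oo * X)%E]graph_null mule0 adde0 [X in (_ * X)%E]box_area.
pose f1 x := Q * F0 i x.
have if1 : (@lebesgue2 K).-integrable setT (EFin \o f1).
  exact: (integrableZl measurableT Q (integrable_F0 i)).
have mf1 : measurable_fun setT (EFin \o f1).
  by apply/measurable_EFinP; exact: measurable_funM.
have if0 : (@lebesgue2 K).-integrable setT (EFin \o (f1 \o T i)).
  apply/integrableP; split; first exact: (measurableT_comp mf1 (mT i)).
  have /integrableP[_ fin] := if1.
  have mabs : measurable_fun setT (abse \o (EFin \o f1)) by exact: measurableT_comp.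
  have lt : ((k i)%:E * \int[@lebesgue2 K]_x (abse \o (EFin \o f1)) x < +oo)%E.
    by apply: lte_mul_pinfty => //; rewrite lee_fin.
  by move: lt; rewrite -(integral_T i mabs).
have If0 : (`|\int[@lebesgue2 K]_x (f1 (T i x))%:E| <= (k i * Q * (C * eps i ^+ n))%:E)%E.
  have -> : (\int[@lebesgue2 K]_x (f1 (T i x))%:E =
      (k i)%:E * \int[@lebesgue2 K]_x (EFin \o f1) x)%E by exact: integral_T.
  have -> : (\int[@lebesgue2 K]_x (EFin \o f1) x =
      Q%:E * \int[@lebesgue2 K]_x (EFin \o F0 i) x)%E.
    exact: (integralZl measurableT (integrable_F0 i) Q).
  rewrite abseM abseM (@gee0_abs _ (k i)%:E) ?lee_fin//.
  rewrite (@gee0_abs _ Q%:E) ?lee_fin// muleA -EFinM.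
  rewrite [leRHS]EFinM; apply: lee_wpmul2l; first by rewrite lee_fin mulr_ge0.
  exact: hC.
have mb : measurable_fun setT (b0 \o T i) by exact: measurableT_comp.
have := @integral_near_any _ _ K (mu \x mu)%E
  (fun x => (Q * (psi (T i x).1 * phi (T i x).2) * u i x)%:E) (f1 \o T i) (b0 \o T i) if0 mb.
have -> : (\int[mu \x mu]_x (b0 \o T i) x = (k i)%:E * (c * (2 * r) ^+ 2)%:E)%E.
  by rewrite -Ib0; exact: integral_T.
move=> h; apply: le_trans (h _) _; last first.
  apply: (le_trans (leeD2r _ If0)); rewrite -EFinM -EFinD lee_fin.
  rewrite /c /C'; have := eP0 n; have := eP0 P; set x := _ ^+ P; set y := _ ^+ n.
  move=> x0 y0.
  have -> : k i * Q * (C * y) + k i * (Q * (B1 * B2 * (A * x)) * (2 * r) ^+ 2) =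
     (k i * Q) * (C * y + C' * x) by rewrite /C'; ring.
  have -> : (C + B1 * B2 * A * (2 * r) ^+ 2) * (Q * k i * (x + y)) =
     (k i * Q) * ((C + C') * (x + y)) by rewrite /C'; ring.
  rewrite ler_wpM2l ?mulr_ge0//.
  have := mulr_ge0 C0 x0; have := mulr_ge0 C'0 y0; lra.
move=> x; change (`|Q * (psi (T i x).1 * phi (T i x).2) * u i x - f1 (T i x)|%:E
  <= b0 (T i x))%E.
rewrite /b0 !indicE.
case: (boolP (T i x \in box)) => [|xb]; last first.
  have nb : ~ box (T i x) by move: xb; rewrite notin_setE.
  rewrite (_ : T i x \in N i `&` box = false) ?mule0 ?add0e; last first.
    by apply/negbTE; rewrite notin_setE => -[_ /nb].
  have h0 := F0_out i nb.
  have oo : (r < `|(T i x).1|) \/ (r < `|(T i x).2|).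
    by move: nb => /in_box/not_andP[] /negP; rewrite -ltNge => h'; [left|right].
  case: oo => o.
  - by rewrite /f1 h0 psi_out// !mul0r !mulr0 !mul0r subrr normr0.
  - by rewrite /f1 h0 phi_out// !mulr0 !mul0r subrr normr0.
rewrite inE => xb; have /in_box[x1 x2] := xb.
have [yN|yN] := pselect (N i (T i x)).
  rewrite (_ : T i x \in N i `&` box = true); last exact/mem_set.
  by rewrite mule1 mule1 addey ?leey.
rewrite (_ : T i x \in N i `&` box = false) ?mule0 ?adde0; last first.
  by apply/negbTE; rewrite notin_setE => -[/yN].
rewrite mulr1n mule1 lee_fin /f1 /F0.
have ne : (T i x).2 <> e i (T i x).1.
  by move=> /(NP i x1 x2); rewrite -surjective_pairing.
have -> : Q * (psi (T i x).1 * phi (T i x).2) * u i x -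
  Q * (psi (T i x).1 * phi (T i x).2 * model i (T i x)) =
  Q * (psi (T i x).1 * phi (T i x).2 * (u i x - model i (T i x))) by ring.
rewrite !normrM (ger0_norm Q0) ler_wpM2l// ler_pM ?mulr_ge0//; last exact: uP.
by rewrite ler_pM.
Qed.

End Core.

(** * Graphs: implicit solution, substitution in polynomials, and sides *)

Section Graph.
Variable K : realType.

(** The slope hypothesis says that G has slope s lam up to a relative error of one
    half.  Hence lam G increases at rate at least s lam^2 / 2; it changes sign
    within tau of y0, and its zero separates the two signs. *)
Lemma graph_solution (G : K -> K) (y0 lam s rho tau : K) :
  continuous G -> 0 < s -> lam != 0 -> 0 <= tau <= rho ->
  (forall y y', `|y - y0| <= rho -> `|y' - y0| <= rho ->
     `|G y - G y' - s * lam * (y - y')| <= s * `|lam| / 2 * `|y - y'|) ->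
  `|G y0| <= s * `|lam| / 2 * tau ->
  exists2 e, `|e - y0| <= tau & forall y, `|y - y0| <= rho ->
    (lam * G y <= 0 <-> y <= e) /\ (G y = 0 <-> y = e).
Proof.
move=> cG s0 lam0 /andP[tau0 taurho] slope G0.
have lam2 : 0 < lam ^+ 2 by rewrite exprn_even_gt0.
have lamn : `|lam| ^+ 2 = lam ^+ 2 by rewrite real_normK// num_real.
have l0 : 0 < `|lam| by rewrite normr_gt0.
have incr y y' : `|y - y0| <= rho -> `|y' - y0| <= rho -> y' <= y ->
    s * lam ^+ 2 / 2 * (y - y') <= lam * G y - lam * G y'.
  move=> yr y'r y'y; have := slope y y' yr y'r.
  rewrite (ger0_norm (_ : 0 <= y - y')) ?subr_ge0// => h.
  have {}h : `|lam * (G y - G y' - s * lam * (y - y'))| <=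
      s * `|lam| ^+ 2 / 2 * (y - y').
    rewrite normrM (_ : s * `|lam| ^+ 2 / 2 * (y - y') =
      `|lam| * (s * `|lam| / 2 * (y - y'))); last by rewrite expr2; field.
    by rewrite ler_wpM2l.
  move: h; rewrite lamn ler_norml => /andP[h _].
  have : lam * (G y - G y' - s * lam * (y - y')) =
    lam * G y - lam * G y' - s * lam ^+ 2 * (y - y') by ring.
  by move: h; lra.
have h0 : `|lam * G y0| <= s * lam ^+ 2 / 2 * tau.
  rewrite normrM -lamn (_ : s * `|lam| ^+ 2 / 2 * tau =
    `|lam| * (s * `|lam| / 2 * tau)); last by rewrite expr2; field.
  by rewrite ler_wpM2l.
have y00 : `|y0 - y0| <= rho by rewrite subrr normr0 (le_trans tau0).
have yp : `|(y0 + tau) - y0| <= rho by rewrite addrAC subrr add0r ger0_norm.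
have ym : `|(y0 - tau) - y0| <= rho by rewrite addrAC subrr add0r normrN ger0_norm.
have [|||e ein ee] := @IVT K (fun y => lam * G y) (y0 - tau) (y0 + tau) 0.
- by lra.
- apply: continuous_subspaceT => y; apply: continuousM; first exact: cvg_cst.
  exact: cG.
- have := incr _ _ yp y00 _; have := incr _ _ y00 ym _.
  move: h0; rewrite ler_norml => /andP[h1 h2] i1 i2.
  have := i1 ltac:(lra); have := i2 ltac:(lra); rewrite ge_min le_max => j1 j2.
  by apply/andP; split; apply/orP; [left|right]; lra.
have er : `|e - y0| <= tau by move: ein; rewrite in_itv/= ler_norml; lra.
have er' := le_trans er taurho.
exists e => // y yr.
have p0 : 0 < s * lam ^+ 2 / 2 by rewrite divr_gt0// mulr_gt0.
have le_y : lam * G y <= 0 -> y <= e.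
  move=> Gy; rewrite leNgt; apply/negP => ey.
  have := incr y e yr er' (ltW ey); rewrite ee subr0 => h.
  have : 0 < s * lam ^+ 2 / 2 * (y - e) by rewrite mulr_gt0// subr_gt0.
  by lra.
have ge_y : 0 <= lam * G y -> e <= y.
  move=> Gy; rewrite leNgt; apply/negP => ye.
  have := incr e y er' yr (ltW ye); rewrite ee sub0r => h.
  have : 0 < s * lam ^+ 2 / 2 * (e - y) by rewrite mulr_gt0// subr_gt0.
  by lra.
split; split=> [|ye].
- exact: le_y.
- have := incr e y er' yr ye; rewrite ee sub0r => h.
  have : 0 <= s * lam ^+ 2 / 2 * (e - y) by rewrite mulr_ge0 ?subr_ge0// ltW.
  by lra.
- by move=> Gy; apply/eqP; rewrite eq_le le_y ?ge_y// Gy mulr0.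
- by apply/eqP; move: ee; rewrite -ye => /eqP; rewrite mulf_eq0 (negbTE lam0).
Qed.

Lemma slope_bound (f : K -> K) (c d : K) (a b : K) :
  (forall x, derivable f x 1) ->
  (forall x, Num.min a b <= x <= Num.max a b -> `|derive1 f x - c| <= d) ->
  `|f b - f a - c * (b - a)| <= d * `|b - a|.
Proof.
move=> df fd.
have := @antiderivative_remainder K f (fun=> c) 1 a b d df.
rewrite big_ord1 divr1 expr1 opprD addrA; apply => s sab.
by rewrite big_ord1 expr0 mulr1; exact: fd.
Qed.

End Graph.

Section Substitution.
Variable K : realType.

(** The substitution keeps the degree in z below P, while the degree in y grows
    to at most 2 P - 2; the new coefficients are bounded in terms of the old ones
    alone. *)
Lemma linear_substitution (P : nat) (A : K) : 0 <= A ->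
  exists2 A' : K, 0 <= A' & forall (tau : nat -> nat -> K) (al be ka : K),
    (forall a b, `|tau a b| <= A) -> `|al| <= 2 -> `|be| <= 2 -> `|ka| <= 2 ->
    exists2 t : nat -> nat -> K, (forall l c, `|t l c| <= A') &
      forall z y, \sum_(a < P) \sum_(b < P)
          tau a b * (al * z + be * y) ^+ a * (ka * y) ^+ b =
        \sum_(l < P) \sum_(c < P + P) t l c * z ^+ l * y ^+ c.
Proof.
move=> A0.
(* The bound 2 on al and be turns the terms of the binomial formula into
   'C(a, l) 2^a. *)
pose bd (a : nat) := \sum_(l < P) 'C(a, l)%:R * 2 ^+ a : K.
have bd0 a : 0 <= bd a by rewrite /bd; apply: sumr_ge0 => l _; rewrite mulr_ge0.
exists (\sum_(a < P) \sum_(b < P) A * (bd a * 2 ^+ b)).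
  by do 2!apply: sumr_ge0 => ? _; rewrite !mulr_ge0.
move=> tau al be ka tauA al2 be2 ka2.
pose co a b l := tau a b * ('C(a, l)%:R * (al ^+ l * be ^+ (a - l)) * ka ^+ b).
pose t l c := if (l < P)%N then \sum_(a < P) \sum_(b < P)
  (if (c == a - l + b)%N then co a b l else 0) else 0.
exists t => [l c|z y].
- rewrite /t; case: ltnP => lP; last first.
    by rewrite normr0; do 2!apply: sumr_ge0 => ? _; rewrite !mulr_ge0.
  rewrite (le_trans (ler_norm_sum _ _ _))// ler_sum// => a _.
  rewrite (le_trans (ler_norm_sum _ _ _))// ler_sum// => b _.
  case: ifP => _; last by rewrite normr0 !mulr_ge0.
  rewrite /co normrM ler_pM// !normrM ler_pM ?mulr_ge0//; last first.
    by rewrite normrX lerXn2r ?nnegrE.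
  rewrite ger0_norm//.
  have [la|al'] := leqP l a; last first.
    by rewrite bin_small// mul0r.
  rewrite /bd (bigD1 (Ordinal lP))//= -[leLHS]addr0 lerD//; last first.
    by apply: sumr_ge0 => j _; rewrite mulr_ge0.
  rewrite ler_wpM2l// !normrX -[in leRHS](subnKC la) exprD.
  by rewrite ler_pM ?exprn_ge0// lerXn2r ?nnegrE.
- transitivity (\sum_(a < P) \sum_(b < P) \sum_(l < P)
     co a b l * z ^+ l * y ^+ (a - l + b)).
    apply: eq_bigr => a _; apply: eq_bigr => b _.
    rewrite exprDn.
    have -> : \sum_(i < a.+1) (al * z) ^+ (a - i) * (be * y) ^+ i *+ 'C(a, i) =
      \sum_(i < a.+1) (al * z) ^+ i * (be * y) ^+ (a - i) *+ 'C(a, i).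
      rewrite (reindex_inj rev_ord_inj)/=; apply: eq_bigr => i _.
      have ia : (i <= a)%N by rewrite -ltnS.
      by rewrite subSS subKn// bin_sub.
    rewrite -(big_mkord predT (fun i => (al * z) ^+ i * (be * y) ^+ (a - i) *+ 'C(a, i))).
    rewrite -(big_mkord predT (fun l => co a b l * z ^+ l * y ^+ (a - l + b))).
    rewrite (@big_cat_nat _ _ _ a.+1 0 P)//= [X in _ = _ + X]big_nat_cond.
    rewrite [X in _ = _ + X]big1 ?addr0; last first.
      by move=> l /andP[/andP[la _] _]; rewrite /co bin_small// !(mul0r, mulr0).
    rewrite mulr_sumr mulr_suml; apply: eq_bigr => l _.
    rewrite -mulr_natr !exprMn exprD /co; ring.
  under [RHS]eq_bigr => l _ do (under eq_bigr do rewrite /t ltn_ord mulr_suml mulr_suml).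
  under [RHS]eq_bigr do rewrite exchange_big/=.
  rewrite [RHS]exchange_big/=; apply: eq_bigr => a _.
  under [RHS]eq_bigr do under eq_bigr do rewrite mulr_suml mulr_suml.
  under [RHS]eq_bigr do rewrite exchange_big/=.
  rewrite [RHS]exchange_big/=; apply: eq_bigr => b _; apply: eq_bigr => l _.
  have clt : (a - l + b < P + P)%N.
    by rewrite -addnS leq_add// (leq_trans (leq_subr _ _))// ltnW.
  rewrite (bigD1 (Ordinal clt))//= eqxx big1 ?addr0// => c /negbTE cne.
  by rewrite (_ : (_ == _) = false) ?mul0r.
Qed.

End Substitution.

Section Geometry.
Variable K : realType.
Implicit Types (B gamma : set (K * K)).

(** Along a segment that avoids the boundary, B coincides both with its interior
    and with its closure, so it cuts out a clopen part of a connected set. *)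
Lemma segment_side B (p q : K * K) :
  (forall s, 0 <= s <= 1 ->
    ~ boundary B (p.1 + s * (q.1 - p.1), p.2 + s * (q.2 - p.2))) ->
  B p -> B q.
Proof.
move=> nb Bp.
pose path s : K * K := (p.1 + s * (q.1 - p.1), p.2 + s * (q.2 - p.2)).
have clin (a b : K) : continuous (fun s : K => a + s * b).
  by move=> s; apply: cvgD; [exact: cvg_cst|apply: cvgM; [exact: cvg_id|exact: cvg_cst]].
have cpath : continuous path.
  move=> s; exact: (cvg_pair (clin p.1 (q.1 - p.1) s) (clin p.2 (q.2 - p.2) s)).
have p0 : path 0 = p by rewrite /path !mul0r !addr0 -surjective_pairing.
have p1 : path 1 = q.
  by rewrite /path !mul1r ![_ + (_ - _)]addrC !subrK -surjective_pairing.
have itv01 (s : K) : `[0, 1]%classic s -> 0 <= s <= 1 by rewrite /= in_itv.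
have E : `[0, 1]%classic `&` path @^-1` B = `[0, 1]%classic.
  apply: (@segment_connected K 0 1).
  - by exists 0; split; rewrite /= ?in_itv/= ?lexx ?ler01// p0.
  - exists (path @^-1` (interior B)).
      by apply: open_comp => [s _|]; [exact: cpath|exact: open_interior].
    apply/seteqP; split=> s [s01 Bs]; split=> //.
      apply: contrapT => nint; apply: (nb s (itv01 _ s01)); split=> //.
      exact: subset_closure.
    exact: (interior_subset Bs).
  - exists (path @^-1` (closure B)).
      by apply: closed_comp => [s _|]; [exact: cpath|exact: closed_closure].
    apply/seteqP; split=> s [s01 Bs]; split=> //; first exact: subset_closure.
    have : interior B (path s).
      by apply: contrapT => nint; apply: (nb s (itv01 _ s01)).
    by move=> h; exact: (interior_subset h).
have : `[0, 1]%classic (1 : K) by rewrite /= in_itv/= lexx ler01.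
by rewrite -E => -[_]; rewrite /= p1.
Qed.

Definition frame_pt (t : K * K) (theta a b : K) : K * K :=
  (t.1 + a * cos theta - b * sin theta, t.2 + a * sin theta + b * cos theta).
Definition frame_x (t : K * K) (theta : K) (x : K * K) : K :=
  (x.1 - t.1) * cos theta + (x.2 - t.2) * sin theta.
Definition frame_y (t : K * K) (theta : K) (x : K * K) : K :=
  (x.2 - t.2) * cos theta - (x.1 - t.1) * sin theta.

Lemma frame_ptK t theta x :
  frame_pt t theta (frame_x t theta x) (frame_y t theta x) = x.
Proof.
rewrite /frame_pt /frame_x /frame_y; case: x => x1 x2 /=.
have := cos2Dsin2 theta => h.
congr (_, _).
- transitivity (t.1 + (x1 - t.1) * (cos theta ^+ 2 + sin theta ^+ 2)); first by ring.
  by rewrite h; ring.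
- transitivity (t.2 + (x2 - t.2) * (cos theta ^+ 2 + sin theta ^+ 2)); first by ring.
  by rewrite h; ring.
Qed.

Lemma frame_pt_line t theta a b a' b' s :
  ((frame_pt t theta a b).1 + s * ((frame_pt t theta a' b').1 - (frame_pt t theta a b).1),
   (frame_pt t theta a b).2 + s * ((frame_pt t theta a' b').2 - (frame_pt t theta a b).2)) =
  frame_pt t theta (a + s * (a' - a)) (b + s * (b' - b)).
Proof. by rewrite /frame_pt/=; congr (_, _); ring. Qed.

Lemma convex_norm_lt (s x y R : K) : 0 <= s <= 1 -> `|x| < R -> `|y| < R ->
  `|x + s * (y - x)| < R.
Proof.
move=> /andP[s0 s1] xR yR; pose m := Num.max `|x| `|y|.
apply: (@le_lt_trans _ _ m); last by rewrite /m gt_max xR.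
have -> : x + s * (y - x) = (1 - s) * x + s * y by ring.
rewrite (le_trans (ler_normD _ _))// !normrM (ger0_norm s0) ger0_norm ?subr_ge0//.
rewrite [leRHS](_ : m = (1 - s) * m + s * m); last by ring.
by rewrite lerD// ler_wpM2l ?subr_ge0// /m le_max lexx ?orbT.
Qed.

Lemma convex_lt0 (s p q : K) : 0 <= s <= 1 -> p < 0 -> q < 0 ->
  (1 - s) * p + s * q < 0.
Proof.
move=> /andP[s0 s1] p0 q0; pose m := Num.max p q.
apply: (@le_lt_trans _ _ m); last by rewrite /m gt_max p0.
rewrite [leRHS](_ : m = (1 - s) * m + s * m); last by ring.
by rewrite lerD// ler_wpM2l ?subr_ge0// /m le_max lexx ?orbT.
Qed.

(** Two points on the same side of the graph are joined by three segments that do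
    not meet it: vertically to the height - sg 3/4 rc, which the graph does
    not reach, along this height, and vertically again. *)
Lemma graph_side (B : set (K * K)) t theta (f : K -> K) (rc rho sg : K) :
  0 < rc -> sg = 1 \/ sg = -1 ->
  (forall a, `|a| < rho -> `|f a| < rc / 2) ->
  (forall a b, `|a| < rho -> `|b| < rc ->
     boundary B (frame_pt t theta a b) -> b = f a) ->
  forall a b a' b', `|a| < rho -> `|b| < rc -> `|a'| < rho -> `|b'| < rc ->
    sg * (b - f a) < 0 -> sg * (b' - f a') < 0 ->
  B (frame_pt t theta a b) -> B (frame_pt t theta a' b').
Proof.
move=> rc0 sgE fr bd a b a' b' ar br a'r b'r bf bf' Bab.
have step c d c' d' : `|c| < rho -> `|d| < rc -> `|c'| < rho -> `|d'| < rc ->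
    (forall s, 0 <= s <= 1 -> sg * (d + s * (d' - d) - f (c + s * (c' - c))) < 0) ->
    B (frame_pt t theta c d) -> B (frame_pt t theta c' d').
  move=> cr dr c'r d'r sgn; apply: segment_side => s s01.
  rewrite frame_pt_line => /bd h.
  have conv (x y R : K) : `|x| < R -> `|y| < R -> `|x + s * (y - x)| < R.
    exact: convex_norm_lt.
  have := sgn s s01; rewrite h ?subrr ?mulr0 ?ltxx//; exact: conv.
have lowf c : `|c| < rho -> sg * (- sg * (3 / 4 * rc) - f c) < 0.
  by move=> /fr; rewrite ltr_norml; case: sgE => ->; lra.
have low : `|- sg * (3 / 4 * rc)| < rc.
  by case: sgE => ->; rewrite ltr_norml; lra.
have B1 : B (frame_pt t theta a (- sg * (3 / 4 * rc))).
  apply: (step a b) => // s s01.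
  rewrite subrr mulr0 addr0.
  have := convex_lt0 s01 bf (lowf a ar); congr (_ < 0); ring.
have B2 : B (frame_pt t theta a' (- sg * (3 / 4 * rc))).
  apply: (step a (- sg * (3 / 4 * rc))) => // s s01.
  rewrite subrr mulr0 addr0; apply: lowf.
  exact: convex_norm_lt.
apply: (step a' (- sg * (3 / 4 * rc))) => // s s01.
rewrite subrr mulr0 addr0.
have := convex_lt0 s01 (lowf a' a'r) bf'; congr (_ < 0); ring.
Qed.

End Geometry.

(** * Normals and transversality *)

Section Tangent.
Variable K : realType.

(** The normal at t is defined through some local graph g at t, in a frame that
    has no reason to be the given one.  Both graphs parametrise the same curve
    near t, so writing the points of the graph of g in the given frame and
    differentiating at t yields the same tangent line. *)
Lemma curve_tangent (gamma : set (K * K)) (t0 t n : K * K) theta (f : K -> K) (rc : K) :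
  0 < rc -> class_C 1 f ->
  (forall a b, `|a| < rc -> `|b| < rc ->
     gamma (frame_pt t0 theta a b) -> b = f a) ->
  `|frame_x t0 theta t| < rc -> `|frame_y t0 theta t| < rc ->
  unit_normal gamma t n ->
  let f' := derive1 f (frame_x t0 theta t) in
  n.1 * (cos theta - f' * sin theta) + n.2 * (sin theta + f' * cos theta) = 0.
Proof.
move=> rc0 /class_CS[df _] gf xr yr [n1 [th [g [[/class_CS[dg _] g0 [r1 r10 hg]] ng]]]] f'.
have cg : continuous g := derivable1_continuous dg.
pose x s := frame_pt t th s (g s).
pose c1 := cos th * cos theta + sin th * sin theta.
pose c2 := cos th * sin theta - sin th * cos theta.
have xE s : frame_x t0 theta (x s) = frame_x t0 theta t + (c1 * s + c2 * g s).
  by rewrite /frame_x /x /frame_pt/= /c1 /c2; ring.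
have yE s : frame_y t0 theta (x s) = frame_y t0 theta t + (c1 * g s - c2 * s).
  by rewrite /frame_y /x /frame_pt/= /c1 /c2; ring.
pose X s := frame_x t0 theta t + (c1 * s + c2 * g s).
pose Y s := frame_y t0 theta t + (c1 * g s - c2 * s).
have cX : continuous X.
  move=> s; apply: cvgD; first exact: cvg_cst.
  apply: cvgD; apply: cvgM; try exact: cvg_cst; [exact: cvg_id|exact: cg].
have cY : continuous Y.
  move=> s; apply: cvgD; first exact: cvg_cst.
  apply: cvgB; apply: cvgM; try exact: cvg_cst; [exact: cg|exact: cvg_id].
have X0 : X 0 = frame_x t0 theta t by rewrite /X g0 !mulr0 !addr0.
have Y0 : Y 0 = frame_y t0 theta t by rewrite /Y g0 !mulr0 subrr addr0.
have near_lt (h : K -> K) (R : K) : continuous h -> `|h 0| < R ->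
    \forall s \near 0, `|h s| < R.
  move=> ch h0; have cn : (fun s => `|h s|) @ 0 --> `|h 0|.
    by apply: cvg_norm; exact: ch.
  exact: (cvgr_lt _ cn).
have near_id : \forall s \near (0 : K), `|s| < r1.
  by apply: (near_lt (fun s => s)) => [s|]; [exact: cvg_id|rewrite normr0].
have nearE : \forall s \near (0 : K), Y s = f (X s).
  near=> s; apply: gf.
  - by near: s; apply: near_lt; rewrite ?X0.
  - by near: s; apply: near_lt; rewrite ?Y0.
  rewrite (_ : frame_pt _ _ _ _ = x s); last first.
    by rewrite -[RHS](frame_ptK t0 theta) xE yE.
  apply/hg => //.
  by near: s; apply: near_lt; rewrite ?g0 ?normr0.
have dgi : is_derive (0 : K) (1 : K) g (derive1 g 0).
  by rewrite derive1E; exact: derivableP.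
have dX : is_derive (0 : K) (1 : K) X (c1 + derive1 g 0 * c2).
  have h := is_deriveD (is_derive_cst (frame_x t0 theta t) (0 : K) (1 : K))
    (is_deriveD (is_deriveZ c1 (is_derive_id (0 : K) (1 : K))) (is_deriveZ c2 dgi)).
  apply: (is_derive_eq h); rewrite add0r; congr (_ + _); first exact: mulr1.
  exact: mulrC.
have dY : is_derive (0 : K) (1 : K) Y (derive1 g 0 * c1 - c2).
  have h := is_deriveD (is_derive_cst (frame_y t0 theta t) (0 : K) (1 : K))
    (is_deriveB (is_deriveZ c1 dgi) (is_deriveZ c2 (is_derive_id (0 : K) (1 : K)))).
  apply: (is_derive_eq h); rewrite add0r; congr (_ - _); last exact: mulr1.
  exact: mulrC.
have E : derive1 g 0 * c1 - c2 = f' * (c1 + derive1 g 0 * c2).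
  have dfX : is_derive (0 : K) (1 : K) (f \o X) (f' * (c1 + derive1 g 0 * c2)).
    apply: is_derive1_comp dX; rewrite X0 /f' derive1E; exact: derivableP.
  have /(near_eq_is_derive nearE)[_ <-] := dY.
  by case: dfX.
(* (N1, N2) is normal to the graph of f and (p, q) is tangent to the graph of g;
   E says that they are orthogonal.  Since n is orthogonal to (p, q) too, it is
   a multiple of (N1, N2). *)
set p := cos th - derive1 g 0 * sin th in ng.
set q := sin th + derive1 g 0 * cos th in ng.
pose N1 := - sin theta - f' * cos theta; pose N2 := cos theta - f' * sin theta.
have EN : N1 * p + N2 * q = 0.
  rewrite (_ : _ + _ = derive1 g 0 * c1 - c2 - f' * (c1 + derive1 g 0 * c2)).
    by rewrite E subrr.
  by rewrite /N1 /N2 /p /q /c1 /c2; ring.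
have pq : p ^+ 2 + q ^+ 2 = 1 + derive1 g 0 ^+ 2.
  transitivity ((1 + derive1 g 0 ^+ 2) * (cos th ^+ 2 + sin th ^+ 2)).
    by rewrite /p /q; ring.
  by rewrite cos2Dsin2 mulr1.
have pq0 : p ^+ 2 + q ^+ 2 != 0.
  by rewrite pq gt_eqF// ltr_pwDl// sqr_ge0.
have -> : n.1 * (cos theta - f' * sin theta) + n.2 * (sin theta + f' * cos theta) =
  n.1 * N2 - n.2 * N1 by rewrite /N1 /N2; ring.
apply: (mulfI pq0); rewrite mulr0.
have -> : (p ^+ 2 + q ^+ 2) * (n.1 * N2 - n.2 * N1) =
  (n.1 * p + n.2 * q) * (N2 * p - N1 * q) - (N1 * p + N2 * q) * (n.2 * p - n.1 * q).
  by ring.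
by rewrite ng EN !mul0r subrr.
Unshelve. all: by end_near.
Qed.

(** The right-hand side is the scalar product of d with the normal
    (- sin theta - f' cos theta, cos theta - f' sin theta) of the graph, a
    multiple of n by a factor of absolute value
    sqrt (1 + f'^2) >= 1. *)
Lemma transversality (n d : K * K) theta f' :
  n.1 ^+ 2 + n.2 ^+ 2 = 1 ->
  n.1 * (cos theta - f' * sin theta) + n.2 * (sin theta + f' * cos theta) = 0 ->
  `|d.1 * n.1 + d.2 * n.2| <=
  `|(d.2 * cos theta - d.1 * sin theta) - f' * (d.1 * cos theta + d.2 * sin theta)|.
Proof.
move=> nn nt.
pose N1 := - sin theta - f' * cos theta; pose N2 := cos theta - f' * sin theta.
have nt' : n.1 * N2 = n.2 * N1.
  by apply/eqP; rewrite -subr_eq0 -[X in _ == X]nt; apply/eqP; rewrite /N1 /N2; ring.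
pose p := n.1 * N1 + n.2 * N2.
have N1E : N1 = p * n.1.
  transitivity (N1 * (n.1 ^+ 2 + n.2 ^+ 2)); first by rewrite nn mulr1.
  transitivity (n.1 ^+ 2 * N1 + n.2 * (n.2 * N1)); first by ring.
  by rewrite -nt' /p; ring.
have N2E : N2 = p * n.2.
  transitivity (N2 * (n.1 ^+ 2 + n.2 ^+ 2)); first by rewrite nn mulr1.
  transitivity (n.1 * (n.1 * N2) + n.2 ^+ 2 * N2); first by ring.
  by rewrite nt' /p; ring.
have p2 : p ^+ 2 = 1 + f' ^+ 2.
  transitivity (p ^+ 2 * (n.1 ^+ 2 + n.2 ^+ 2)); first by rewrite nn mulr1.
  transitivity ((p * n.1) ^+ 2 + (p * n.2) ^+ 2); first by ring.
  rewrite -N1E -N2E.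
  transitivity ((1 + f' ^+ 2) * (cos theta ^+ 2 + sin theta ^+ 2)).
    by rewrite /N1 /N2; ring.
  by rewrite cos2Dsin2 mulr1.
have p1 : 1 <= `|p|.
  rewrite -(@ler_pXn2r _ 2) ?nnegrE// expr1n real_normK ?num_real// p2.
  by rewrite lerDl sqr_ge0.
have -> : (d.2 * cos theta - d.1 * sin theta) - f' * (d.1 * cos theta + d.2 * sin theta)
  = p * (d.1 * n.1 + d.2 * n.2).
  transitivity (d.1 * N1 + d.2 * N2); first by rewrite /N1 /N2; ring.
  by rewrite N1E N2E; ring.
by rewrite normrM ler_peMl.
Qed.

Lemma sin_bound (beta x : K) : 0 < beta -> beta <= `|x| -> beta <= pi - `|x| ->
  sin beta <= `|sin x|.
Proof.
move=> b0 bx bpx.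
have -> : `|sin x| = `|sin `|x| |.
  by case: (ger0P x) => // _; rewrite sinN normrN.
have mono (y : K) : beta <= y -> y <= pi / 2 -> sin beta <= sin y.
  rewrite le_eqVlt => /predU1P[->//|by_] yp.
  by rewrite ltW// ltr_sin// in_itv/=; lra.
have [h|h] := leP `|x| (pi / 2).
  by rewrite (le_trans _ (ler_norm _))// mono.
rewrite (le_trans _ (ler_norm _))//.
have -> : sin `|x| = sin (pi - `|x|) by rewrite addrC sinDpi sinN opprK.
by apply: mono => //; lra.
Qed.

Lemma torus_dist_sin (beta a b : K) : 0 < beta -> beta <= torus_dist a b ->
  0 < sin beta /\ sin beta <= `|sin (a - b)|.
Proof.
move=> b0; rewrite /torus_dist le_min => /andP[h1 h2].
have {}h2 : beta <= pi - `|a - b|.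
  move: h2; case: (leP a b) => ab.
    by rewrite ler0_norm ?subr_le0//; lra.
  by rewrite gtr0_norm ?subr_gt0//; lra.
split; last exact: sin_bound.
by apply: sin_gt0_pi; apply/andP; split=> //; lra.
Qed.

End Tangent.

(** * The coordinates adapted to a shearlet *)

Section Direction.
Variable K : realType.

Lemma norm_cos_le1 (x : K) : `|cos x| <= 1.
Proof.
by rewrite -(@ler_pXn2r _ 2) ?nnegrE// expr1n real_normK ?num_real.
Qed.

Lemma norm_sin_le1 (x : K) : `|sin x| <= 1.
Proof.
by rewrite -(@ler_pXn2r _ 2) ?nnegrE// expr1n real_normK ?num_real.
Qed.

(** A direction of the lines on which the coordinate z of a shearlet is
    constant. *)
Definition ridge (flip : bool) (kap : K) : K * K :=
  if flip then (1, - kap) else (- kap, 1).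

(** With alpha the angle attached to the shearlet, the ridge is proportional to
    (- sin alpha, cos alpha), by a factor of absolute value at least 1, so its
    scalar product with (cos rho0, sin rho0) is at least |sin (alpha - rho0)| in
    absolute value. *)
Lemma ridge_transversal (flip : bool) (kap beta rho0 : K) (n : K * K) :
  0 < beta -> n = (cos rho0, sin rho0) \/ n = - (cos rho0, sin rho0) ->
  beta <= torus_dist (atan_exp kap (if flip then -1 else 1)) rho0 ->
  0 < sin beta /\ sin beta <= `|(ridge flip kap).1 * n.1 + (ridge flip kap).2 * n.2|.
Proof.
move=> b0 nE /(torus_dist_sin b0)[s0 sb]; split=> //.
set alpha := atan_exp _ _ in sb.
suff h : `|sin (alpha - rho0)| <=
    `|(ridge flip kap).1 * cos rho0 + (ridge flip kap).2 * sin rho0|.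
  apply: le_trans sb (le_trans h _).
  by case: nE => ->//=; rewrite !mulrN -opprD normrN.
rewrite sinB.
have key c (X Y : K) : X = c * Y -> `|c| <= 1 -> `|X| <= `|Y|.
  by move=> -> c1; rewrite normrM ler_piMl.
rewrite /alpha; case: flip {alpha sb} => /=.
- rewrite /atan_exp eqxx andbT; have [->|k0] := eqVneq kap 0.
    by rewrite sin_pihalf cos_pihalf mul0r subr0 oppr0 mul0r addr0 mul1r lexx.
  set a := atan _; have ta : tan a = kap^-1 by rewrite atanK exprN1.
  have ca : cos a != 0 by rewrite cos_atan invr_eq0 gt_eqF// sqrtr_gt0 ltr_pwDl// sqr_ge0.
  have kE : cos a = sin a * kap.
    by have := ta; rewrite /tan => /(congr1 (fun z => z * cos a * kap)); 
      rewrite divfK// => ->; field.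
  apply: (key (sin a)); last exact: norm_sin_le1.
  by rewrite kE; ring.
- rewrite /atan_exp andbF expr1z; set a := atan _.
  have ta : tan a = kap by rewrite atanK.
  have ca : cos a != 0 by rewrite cos_atan invr_eq0 gt_eqF// sqrtr_gt0 ltr_pwDl// sqr_ge0.
  have kE : sin a = kap * cos a.
    by have := ta; rewrite /tan => /(congr1 (fun z => z * cos a)); rewrite divfK// => ->.
  apply: (key (- cos a)); last by rewrite normrN norm_cos_le1.
  by rewrite kE; ring.
Qed.

End Direction.

Section Affine.
Variable K : realType.

Definition flip_pt (flip : bool) (x : K * K) : K * K := if flip then (x.2, x.1) else x.

Definition shearlet_coord (eps kap : K) (mu : K * K) (flip : bool) (x : K * K) : K * K :=
  shear_map (eps ^- 2) (eps^-1) kap mu.1 mu.2 (flip_pt flip x).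

Lemma measurable_shearlet_coord eps kap mu flip :
  measurable_fun setT (shearlet_coord eps kap mu flip).
Proof.
apply: measurableT_comp; first exact: measurable_shear_map.
case: flip; rewrite /flip_pt; last exact: measurable_id.
by apply: measurable_fun_pair => /=.
Qed.

Lemma integral_shearlet_coord eps kap mu flip (F : K * K -> \bar K) : 0 < eps ->
  measurable_fun setT F ->
  (\int[@lebesgue2 K]_x F (shearlet_coord eps kap mu flip x) =
   (eps ^+ 3)%:E * \int[@lebesgue2 K]_x F x)%E.
Proof.
move=> e0 mF; have s1 : 0 < eps ^- 2 by rewrite invr_gt0 exprn_gt0.
have s2 : 0 < eps^-1 by rewrite invr_gt0.
have E := integral_shear kap mu.1 mu.2 s1 s2 mF.
have -> : eps ^+ 3 = (eps ^- 2 * eps^-1)^-1 by field; rewrite gt_eqF.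
rewrite -E /shearlet_coord; case: flip => //=.
apply: (@integral_swap K (F \o shear_map (eps ^- 2) (eps^-1) kap mu.1 mu.2)).
by apply: measurableT_comp => //; exact: measurable_shear_map.
Qed.

(** [shift1] and [shift2] are the components of a displacement x - t in terms of
    the differences dz, dy of the adapted coordinates of x and t. *)
Definition shift1 (eps kap : K) (flip : bool) (dz dy : K) : K :=
  if flip then eps * dy else eps ^+ 2 * dz - kap * (eps * dy).
Definition shift2 (eps kap : K) (flip : bool) (dz dy : K) : K :=
  if flip then eps ^+ 2 * dz - kap * (eps * dy) else eps * dy.

Lemma shearlet_coord_shift eps kap mu flip (x t : K * K) : 0 < eps ->
  let dz := (shearlet_coord eps kap mu flip x).1 - (shearlet_coord eps kap mu flip t).1 in
  let dy := (shearlet_coord eps kap mu flip x).2 - (shearlet_coord eps kap mu flip t).2 in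
  x.1 - t.1 = shift1 eps kap flip dz dy /\ x.2 - t.2 = shift2 eps kap flip dz dy.
Proof.
move=> e0 /=; have en : eps != 0 by rewrite gt_eqF.
rewrite /shearlet_coord /shear_map /shift1 /shift2.
by case: flip => /=; split; field.
Qed.

Definition shearlet_origin (eps kap : K) (mu : K * K) (flip : bool) : K * K :=
  flip_pt flip (eps ^+ 2 * mu.1 - kap * (eps * mu.2), eps * mu.2).

Lemma shearlet_coord_origin eps kap mu flip : 0 < eps ->
  shearlet_coord eps kap mu flip (shearlet_origin eps kap mu flip) = (0, 0).
Proof.
move=> e0; have en : eps != 0 by rewrite gt_eqF.
rewrite /shearlet_coord /shear_map /shearlet_origin.
by case: flip => /=; congr (_, _); field.
Qed.

End Affine.

(** * The boundary curve in the adapted coordinates *)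

Section ChartGap.
Variables (K : realType) (f : K -> K).
Hypothesis df : forall x, derivable f x 1.

(** The height b - f a above the graph of a point with frame coordinates (a, b),
    as a function of its adapted coordinates, when the point (z0, y0) lies on the
    graph; the ai and bi are the frame coordinates of the directions of
    displacement.  The variable z enters with the factor eps^2, the variable y
    with eps. *)
Definition chart_gap (eps at0 a1 a2 b1 b2 z0 y0 z y : K) : K :=
  eps * (b2 * (y - y0) + b1 * (eps * (z - z0)))
  - (f (at0 + eps * (a2 * (y - y0) + a1 * (eps * (z - z0)))) - f at0).

Lemma measurable_chart_gap eps at0 a1 a2 b1 b2 z0 y0 :
  measurable_fun setT (fun x : K * K => chart_gap eps at0 a1 a2 b1 b2 z0 y0 x.1 x.2).
Proof.
have mlin (c d : K) : measurable_fun setT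
    (fun x : K * K => eps * (c * (x.2 - y0) + d * (eps * (x.1 - z0)))).
  apply: measurable_funM => //; apply: measurable_funD => //.
    by apply: measurable_funM => //; apply: measurable_funB.
  by do 2!apply: measurable_funM => //; apply: measurable_funB.
apply: measurable_funB; first exact: mlin.
apply: measurable_funB => //; apply: measurableT_comp.
  by apply: continuous_measurable_fun; exact: derivable1_continuous.
by apply: measurable_funD => //; exact: mlin.
Qed.

Lemma continuous_chart_gap eps at0 a1 a2 b1 b2 z0 y0 z :
  continuous (chart_gap eps at0 a1 a2 b1 b2 z0 y0 z).
Proof.
have clin (c d : K) : continuous (fun y : K => eps * (c * (y - y0) + d * (eps * (z - z0)))).
  move=> y; apply: cvgM; first exact: cvg_cst.
  apply: cvgD; last exact: cvg_cst.
  apply: cvgM; first exact: cvg_cst.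
  by apply: cvgB; [exact: cvg_id|exact: cvg_cst].
have carg : continuous (fun y : K => at0 + eps * (a2 * (y - y0) + a1 * (eps * (z - z0)))).
  by move=> y; apply: cvgD; [exact: cvg_cst|exact: clin].
have cf := derivable1_continuous df.
move=> y; apply: cvgB; first exact: clin.
apply: cvgB; last exact: cvg_cst.
exact: (continuous_comp (carg y) (cf _)).
Qed.

Variables (r eta rho F : K).
Hypothesis r_ge0 : 0 <= r.
Hypothesis eta_gt0 : 0 < eta.
Hypothesis F_ge0 : 0 <= F.
Hypothesis df_bound : forall x, `|x| < rho -> `|derive1 f x| <= F.
Hypothesis df_osc : forall x y, `|x| < rho -> `|y| < rho ->
  `|derive1 f x - derive1 f y| <= eta / 8.

Lemma chart_displacement eps c2 c1 z0 y0 z y : 0 < eps -> eps <= 1 ->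
  `|c1| <= 1 -> `|c2| <= 3 ->
  eps * (8 * r + 3) <= rho / 2 ->
  `|z| <= r -> `|z0| <= r -> `|y - y0| <= 2 * r + 1 ->
  `|eps * (c2 * (y - y0) + c1 * (eps * (z - z0)))| <= rho / 2.
Proof.
move=> e0 e1 a1b a2b er zr z0r yr.
have dz : `|z - z0| <= 2 * r.
  by rewrite (le_trans (ler_normB _ _))//; lra.
have h1 : `|c2 * (y - y0)| <= 3 * (2 * r + 1) by rewrite normrM ler_pM.
have h2 : `|c1 * (eps * (z - z0))| <= 2 * r.
  rewrite !normrM (gtr0_norm e0) -[leRHS]mul1r ler_pM ?mulr_ge0 ?(ltW e0)//.
  by rewrite -[leRHS]mul1r ler_pM ?(ltW e0).
rewrite normrM (gtr0_norm e0) (le_trans _ er)// ler_wpM2l ?(ltW e0)//.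
by rewrite (le_trans (ler_normD _ _))//; lra.
Qed.

Lemma chart_arg eps at0 a1 a2 z0 y0 z y : 0 < eps -> eps <= 1 ->
  `|at0| < rho / 2 -> `|a1| <= 1 -> `|a2| <= 3 ->
  eps * (8 * r + 3) <= rho / 2 ->
  `|z| <= r -> `|z0| <= r -> `|y - y0| <= 2 * r + 1 ->
  `|at0 + eps * (a2 * (y - y0) + a1 * (eps * (z - z0)))| < rho.
Proof.
move=> e0 e1 at_lt a1b a2b er zr z0r yr.
have h := chart_displacement e0 e1 a1b a2b er zr z0r yr.
by rewrite (le_lt_trans (ler_normD _ _))//; lra.
Qed.

(** The slope of the gap in y is eps lam up to 3/8 eps eta, because f' oscillates
    by at most eta / 8 and |a2| <= 3; this is within the tolerance
    eps |lam| / 2 of [graph_solution].  At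
    y0 the gap is O(eps^2), since moving from z0 to z displaces the point by
    O(eps^2) only.  Hence the zero lies within O(eps) of y0. *)
Lemma chart_zero eps at0 a1 a2 b1 b2 z0 y0 z :
  0 < eps -> eps <= 1 -> `|at0| < rho / 2 ->
  `|a1| <= 1 -> `|a2| <= 3 -> `|b1| <= 1 ->
  eps * (8 * r + 3) <= rho / 2 -> eps * (4 * r * (1 + F) / eta) <= 1 ->
  `|z0| <= r -> `|y0| <= r -> `|z| <= r ->
  let lam := b2 - derive1 f at0 * a2 in
  let gap := chart_gap eps at0 a1 a2 b1 b2 z0 y0 z in
  eta <= `|lam| ->
  exists e, [/\ `|e - y0| <= 4 * r * (1 + F) / eta * eps, gap e = 0 &
    forall y, `|y| <= r -> (lam * gap y <= 0 <-> y <= e) /\ (gap y = 0 <-> y = e)].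
Proof.
move=> e0 e1 at_lt a1b a2b b1b er eF z0r y0r zr lam gap lamb.
have lam0 : lam != 0 by rewrite -normr_gt0 (lt_le_trans eta_gt0).
have rho0 : 0 < rho by move: (le_lt_trans (normr_ge0 _) at_lt); lra.
have at_rho : `|at0| < rho by lra.
have dz : `|z - z0| <= 2 * r.
  by rewrite (le_trans (ler_normB _ _))//; lra.
pose C := 4 * r * (1 + F) / eta.
have C0 : 0 <= C by rewrite divr_ge0 ?(ltW eta_gt0)// !mulr_ge0// addr_ge0.
have Ce : C * eps <= 1 by rewrite mulrC.
have arg y : `|y - y0| <= 2 * r + 1 ->
    `|at0 + eps * (a2 * (y - y0) + a1 * (eps * (z - z0)))| < rho.
  by move=> yr; apply: chart_arg.
have btw (u v s : K) : `|u| < rho -> `|v| < rho ->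
    Num.min u v <= s <= Num.max u v -> `|s| < rho.
  move=> ur vr suv; have m : `|s| <= Num.max `|u| `|v|.
    by apply: between_norm suv; rewrite le_max lexx ?orbT.
  by rewrite (le_lt_trans m)// gt_max ur.
have slope y y' : `|y - y0| <= 2 * r + 1 -> `|y' - y0| <= 2 * r + 1 ->
    `|gap y - gap y' - eps * lam * (y - y')| <= eps * `|lam| / 2 * `|y - y'|.
  move=> yr y'r; rewrite /gap /chart_gap.
  set u := at0 + eps * (a2 * (y' - y0) + _); set v := at0 + eps * (a2 * (y - y0) + _).
  have uv : v - u = eps * a2 * (y - y') by rewrite /u /v; ring.
  have -> : eps * (b2 * (y - y0) + b1 * (eps * (z - z0))) - (f v - f at0) -
      (eps * (b2 * (y' - y0) + b1 * (eps * (z - z0))) - (f u - f at0)) -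
      eps * lam * (y - y') = - (f v - f u - derive1 f at0 * (v - u)).
    by rewrite uv /lam; ring.
  rewrite normrN.
  have := @slope_bound K f (derive1 f at0) (eta / 8) u v df.
  move=> /(_ _)/le_trans; apply.
    move=> x xuv; apply: df_osc => //; apply: btw xuv; exact: arg.
  rewrite uv !normrM (gtr0_norm e0).
  rewrite (_ : eps * `|lam| / 2 * `|y - y'| = (eps * `|y - y'|) * (`|lam| / 2)); last by ring.
  rewrite (_ : eta / 8 * _ = (eps * `|y - y'|) * (eta / 8 * `|a2|)); last by ring.
  rewrite ler_wpM2l ?mulr_ge0 ?(ltW e0)//.
  have : eta / 8 * `|a2| <= eta / 8 * 3 by rewrite ler_wpM2l ?divr_ge0 ?(ltW eta_gt0).
  move=> hh; rewrite (le_trans hh)//; move: lamb eta_gt0; move: (`|lam|) => l; lra.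
have gap0 : `|gap y0| <= eps * `|lam| / 2 * (C * eps).
  rewrite /gap /chart_gap subrr !mulr0 !add0r.
  set v := at0 + _.
  have vr : `|v| < rho.
    have := arg y0; rewrite subrr mulr0 add0r normr0; apply.
    by rewrite addr_ge0// mulr_ge0.
  have h1 : `|f v - f at0| <= F * (eps * (eps * (2 * r))).
    apply: (le_trans (@mvt_bound K f F at0 v df _)).
      by move=> x xv; apply: df_bound; apply: btw xv.
    rewrite ler_wpM2l// /v addrAC subrr add0r !normrM (gtr0_norm e0).
    rewrite ler_wpM2l ?(ltW e0)// -[leRHS]mul1r ler_pM ?mulr_ge0 ?(ltW e0)//.
    by rewrite ler_wpM2l ?(ltW e0).
  have h2 : `|eps * (b1 * (eps * (z - z0)))| <= eps * (eps * (2 * r)).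
    rewrite !normrM (gtr0_norm e0) ler_wpM2l ?(ltW e0)//.
    rewrite -[leRHS]mul1r ler_pM ?mulr_ge0 ?(ltW e0)//.
    by rewrite ler_wpM2l ?(ltW e0).
  rewrite (le_trans (ler_normB _ _))// (le_trans (lerD h2 h1))//.
  rewrite (_ : eps * `|lam| / 2 * (C * eps) =
    (eps * (eps * (2 * r)) * (1 + F)) * (`|lam| / eta)); last first.
    by rewrite /C; field; rewrite gt_eqF.
  rewrite [leLHS](_ : _ = (eps * (eps * (2 * r)) * (1 + F)) * 1); last by ring.
  rewrite ler_wpM2l ?ler_pdivlMr ?mul1r//.
  by rewrite !mulr_ge0 ?(ltW e0)// addr_ge0.
have taub : 0 <= C * eps <= 2 * r + 1.
  by rewrite mulr_ge0 ?(ltW e0)//= (le_trans Ce)// lerDr mulr_ge0.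
have [e er' eP] := graph_solution (@continuous_chart_gap eps at0 a1 a2 b1 b2 z0 y0 z)
  e0 lam0 taub slope gap0.
exists e; split=> //.
  by apply/(eP e _).2 => //; apply: (le_trans er'); case/andP: taub.
move=> y yr; apply: eP; rewrite (le_trans (ler_normB _ _))//; lra.
Qed.

End ChartGap.

(** * The window of a shearlet *)

(** All that the estimate depends on: the scale, the shear eps k, the translation,
    the cone, and the point of the boundary at which the direction is
    measured. *)
Record shear_data (K : realType) := ShearData {
  sd_eps : K; sd_kap : K; sd_mu : K * K; sd_flip : bool; sd_pt : K * K }.

Section Data.
Variables (K : realType) (r R0 : K).
Hypothesis r_ge0 : 0 <= r.

Definition sd_coord (d : shear_data K) : K * K -> K * K :=
  shearlet_coord (sd_eps d) (sd_kap d) (sd_mu d) (sd_flip d).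

Definition in_window (d : shear_data K) (x : K * K) : Prop :=
  `|(sd_coord d x).1| <= r /\ `|(sd_coord d x).2| <= r.

(** The bound 2 on the shear accounts for k up to 2^uphalf j, which exceeds
    2^(j/2) by at most the square root of 2. *)
Definition admissible (d : shear_data K) : Prop :=
  [/\ 0 < sd_eps d <= 1, `|sd_kap d| <= 2, in_window d (sd_pt d) &
      `|(sd_pt d).1| <= R0 /\ `|(sd_pt d).2| <= R0].

Lemma norm_shift (eps kap dz dy R : K) flip : 0 < eps -> eps <= 1 -> `|kap| <= 2 ->
  `|dz| <= R -> `|dy| <= R ->
  `|shift1 eps kap flip dz dy| <= eps * (3 * R) /\
  `|shift2 eps kap flip dz dy| <= eps * (3 * R).
Proof.
move=> e0 e1 k2 zR yR; have R_ge0 : 0 <= R := le_trans (normr_ge0 _) zR.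
have eR : eps * R <= eps * (3 * R) by rewrite ler_wpM2l ?(ltW e0)//; lra.
have h1 : `|eps * dy| <= eps * (3 * R).
  by rewrite normrM (gtr0_norm e0) (le_trans _ eR)// ler_wpM2l ?(ltW e0).
have h2 : `|eps ^+ 2 * dz - kap * (eps * dy)| <= eps * (3 * R).
  rewrite (le_trans (ler_normB _ _))// expr2 !normrM (gtr0_norm e0).
  have -> : eps * (3 * R) = eps * R + 2 * (eps * R) by ring.
  apply: lerD.
    rewrite -mulrA ler_wpM2l ?(ltW e0)// -[leRHS]mul1r ler_pM ?(ltW e0)//.
  by rewrite ler_pM ?mulr_ge0 ?(ltW e0)// ler_wpM2l ?(ltW e0).
by rewrite /shift1 /shift2; case: flip; split.
Qed.

Lemma window_bounded d x : admissible d -> in_window d x ->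
  `|x.1| <= R0 + 6 * r /\ `|x.2| <= R0 + 6 * r.
Proof.
move=> [/andP[e0 e1] k2 [tz ty] [t1 t2]] [xz xy].
have [E1 E2] := shearlet_coord_shift (sd_kap d) (sd_mu d) (sd_flip d) x (sd_pt d) e0.
move: E1 E2; rewrite -/(sd_coord d) => E1 E2.
have dz : `|(sd_coord d x).1 - (sd_coord d (sd_pt d)).1| <= 2 * r.
  by rewrite (le_trans (ler_normB _ _))//; lra.
have dy : `|(sd_coord d x).2 - (sd_coord d (sd_pt d)).2| <= 2 * r.
  by rewrite (le_trans (ler_normB _ _))//; lra.
have [h1 h2] := norm_shift (sd_flip d) e0 e1 k2 dz dy.
have le6 : sd_eps d * (3 * (2 * r)) <= 6 * r.
  rewrite (_ : 3 * (2 * r) = 6 * r); last by ring.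
  by rewrite -[leRHS]mul1r ler_wpM2r// mulr_ge0.
rewrite -(subrK (sd_pt d).1 x.1) -(subrK (sd_pt d).2 x.2) E1 E2.
by split; rewrite (le_trans (ler_normD _ _))//; lra.
Qed.

(** Expand g at the point with adapted coordinates (0, 0), at distance O(eps), so
    that powers of z and y themselves appear.  The degree in z stays below P:
    only z is integrated against a function with vanishing moments. *)
Lemma taylor_coord (P : nat) (g : K * K -> K) : class_C2 P g ->
  exists2 A : K, 0 <= A & forall d, admissible d ->
  exists2 t : nat -> nat -> K, (forall l c, `|t l c| <= A) &
    forall x, in_window d x ->
    `|g x - \sum_(l < P) \sum_(c < P + P)
         t l c * (sd_coord d x).1 ^+ l * (sd_coord d x).2 ^+ c|
    <= A * sd_eps d ^+ P.
Proof.
move=> Cg; have [A A0 hA] := taylor2_remainder (R0 + 6 * r) Cg.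
have [A' A'0 hA'] := linear_substitution P A0.
exists (A' + A * (6 * r) ^+ P) => [|d ad].
  by rewrite addr_ge0// mulr_ge0// exprn_ge0// mulr_ge0.
have [/andP[e0 e1] k2 _ _] := ad.
pose x0 := shearlet_origin (sd_eps d) (sd_kap d) (sd_mu d) (sd_flip d).
have c0 : sd_coord d x0 = (0, 0) by exact: shearlet_coord_origin.
have [x01 x02] : `|x0.1| <= R0 + 6 * r /\ `|x0.2| <= R0 + 6 * r.
  by apply: (@window_bounded d) => //; rewrite /in_window c0 /= normr0.
have [tau tauA tauP] := hA x0 x01 x02.
have al2 : `|sd_eps d ^+ 2| <= 2.
  by rewrite ger0_norm ?sqr_ge0// (@le_trans _ _ 1)//; rewrite ?exprn_ile1 ?(ltW e0)// ler1n.
have ka2 : `|sd_eps d| <= 2 by rewrite gtr0_norm//; lra.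
have be2 : `|- (sd_kap d * sd_eps d)| <= 2.
  by rewrite normrN normrM (gtr0_norm e0) -[leRHS]mulr1 ler_pM ?(ltW e0).
pose tau' a b := if sd_flip d then tau b a else tau a b.
have tau'A a b : `|tau' a b| <= A by rewrite /tau'; case: ifP.
have [t tA tE] := hA' tau' (sd_eps d ^+ 2) (- (sd_kap d * sd_eps d)) (sd_eps d)
  tau'A al2 be2 ka2.
exists t => [l c|x wx].
  by rewrite (le_trans (tA _ _))// lerDl mulr_ge0// exprn_ge0// mulr_ge0.
have [x1 x2] := window_bounded ad wx.
have := tauP x x1 x2.
have [E1 E2] := shearlet_coord_shift (sd_kap d) (sd_mu d) (sd_flip d) x x0 e0.
move: E1 E2; rewrite -/(sd_coord d) c0 /= !subr0 => E1 E2.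
have [xz xy] := wx.
have [h1 h2] := norm_shift (sd_flip d) e0 e1 k2 xz xy.
rewrite E1 E2; set z := (sd_coord d x).1 in tE * => //; set y := (sd_coord d x).2.
have -> : \sum_(a < P) \sum_(b < P)
      tau a b * shift1 (sd_eps d) (sd_kap d) (sd_flip d) z y ^+ a *
      shift2 (sd_eps d) (sd_kap d) (sd_flip d) z y ^+ b =
    \sum_(l < P) \sum_(c < P + P) t l c * z ^+ l * y ^+ c.
  rewrite -tE /tau' /shift1 /shift2; case: (sd_flip d).
    rewrite exchange_big/=; apply: eq_bigr => b _; apply: eq_bigr => a _.
    by rewrite mulrAC mulNr mulrA.
  by apply: eq_bigr => a _; apply: eq_bigr => b _; rewrite mulNr mulrA.
move=> /le_trans; apply.
rewrite (@le_trans _ _ (A * (6 * r * sd_eps d) ^+ P))//.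
  rewrite ler_wpM2l// lerXn2r ?nnegrE ?addr_ge0 ?mulr_ge0 ?(ltW e0)//.
  rewrite (le_trans (lerD h1 h2))//; lra.
rewrite exprMn mulrA ler_wpM2r ?exprn_ge0 ?(ltW e0)// lerDr//.
Qed.

End Data.

(** * The estimate near a boundary point *)

Section Estimates.
Variables (K : realType) (n P M : nat) (psi1 phi1 : K -> K) (r R0 : K).
Hypothesis r_ge0 : 0 <= r.
Hypothesis psi1_C : class_C n.+1 psi1.
Hypothesis phi1_C : class_C n.+1 phi1.
Hypothesis psi1_out : forall x, r < `|x| -> psi1 x = 0.
Hypothesis phi1_out : forall x, r < `|x| -> phi1 x = 0.
Hypothesis moments : vanishing_moments M psi1.
Hypothesis PnM : (P + n <= M)%N.
Variables (g1 g2 : K * K -> K) (B : set (K * K)).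
Hypothesis g1_C : class_C2 P g1.
Hypothesis g2_C : class_C2 P g2.

Let u (x : K * K) : K := g1 x + \1_B x * g2 x.

Let cpsi : continuous psi1 := class_C_continuous psi1_C.
Let cphi : continuous phi1 := class_C_continuous phi1_C.

Definition pairing (d : shear_data K) (Q : K) : \bar K :=
  (\int[@lebesgue2 K]_x
    (Q * (psi1 (sd_coord d x).1 * phi1 (sd_coord d x).2) * u x)%:E)%E.

Lemma indic_norm_le1 (x : K * K) : `|\1_B x : K| <= 1.
Proof. by rewrite indicE normr_nat lern1 leq_b1. Qed.

(** For eps bounded below, a bound by a constant times the area of the window is
    enough: this is [core_estimate] with the empty model and P = n = 0. *)
Lemma coarse_estimate (eps0 : K) : 0 < eps0 ->
  exists2 C : K, 0 <= C & forall d, admissible r R0 d -> eps0 <= sd_eps d ->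
    forall Q, 0 <= Q ->
    (`|pairing d Q| <= (C * (Q * sd_eps d ^+ 3 *
       (sd_eps d ^+ P + sd_eps d ^+ n)))%:E)%E.
Proof.
move=> eps00.
pose I := {d : shear_data K | admissible r R0 d}.
pose d_ (i : I) := sval i.
have ad (i : I) : admissible r R0 (d_ i) by exact: svalP.
pose eps i := sd_eps (d_ i).
have e0 i : 0 < eps i by case: (ad i) => /andP[].
have e1 i : eps i <= 1 by case: (ad i) => /andP[].
have [U1 U10 hU1] := continuous_bounded_box (R0 + 6 * r) (class_C2_continuous g1_C).
have [U2 U20 hU2] := continuous_bounded_box (R0 + 6 * r) (class_C2_continuous g2_C).
pose A := U1 + U2.
have A0 : 0 <= A by rewrite addr_ge0.
pose z0 : I -> nat -> nat -> K := fun _ _ _ => 0.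
have zA i l c : `|z0 i l c| <= A by rewrite normr0.
pose S (i : I) : set (K * K) := [set x | x.2 <= 0].
pose N (i : I) : set (K * K) := [set x | x.2 = 0].
have mS i : measurable (S i).
  rewrite (_ : S i = setT `*` `]-oo, 0]%classic); first exact: measurableX.
  by apply/seteqP; split=> [x|x [_]]; rewrite /S /setX/= in_itv/=.
have mN i : measurable (N i).
  rewrite (_ : N i = setT `*` [set 0]); first exact: measurableX.
  by apply/seteqP; split=> [x|x [_]].
have ap c : approximable eps r 0 (fun (i : I) (z : K) => primitive phi1 c 0).
  apply: approximable_cst => //; exact: bounded_family_cst.
have uP i x : `|(sd_coord (d_ i) x).1| <= r -> `|(sd_coord (d_ i) x).2| <= r ->
    (sd_coord (d_ i) x).2 <> 0 ->
    `|u x - model 0 0 z0 z0 S i (sd_coord (d_ i) x)| <= A * eps i ^+ 0.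
  move=> xz xy _; rewrite /model big_ord0 subr0 expr0 mulr1.
  have [x1 x2] := window_bounded r_ge0 (ad i) (conj xz xy).
  rewrite (le_trans (ler_normD _ _))// lerD ?hU1// normrM -[leRHS]mul1r.
  by rewrite ler_pM ?indic_norm_le1 ?hU2.
have [C C0 hC] := @core_estimate K I eps r e0 e1 r_ge0 psi1 phi1 cpsi cphi psi1_out
  phi1_out M 0 0 0 (leq0n M) moments z0 z0 A A0 zA zA (fun _ _ => 0) S ap mS
  (fun i z y _ _ => iff_refl _) (fun i => sd_coord (d_ i)) (fun i => eps i ^+ 3)
  (fun i => exprn_ge0 3 (ltW (e0 i)))
  (fun i => measurable_shearlet_coord _ _ _ _)
  (fun i F mF => integral_shearlet_coord _ _ _ (e0 i) mF)
  (fun _ => u) N mN (fun i z y _ _ => iff_refl _) uP.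
exists (C * 2 / eps0 ^+ P) => [|d adm e0d Q Q0].
  by rewrite divr_ge0 ?mulr_ge0// exprn_ge0// ltW.
have [/andP[d0 d1] _ _ _] := adm.
apply: le_trans (hC (exist _ d adm) Q Q0) _.
rewrite lee_fin /eps /d_ /= !expr0.
have -> : C * (Q * sd_eps d ^+ 3 * (1 + 1)) = C * (Q * sd_eps d ^+ 3) * 2 * 1 by ring.
have -> : C * 2 / eps0 ^+ P * (Q * sd_eps d ^+ 3 * (sd_eps d ^+ P + sd_eps d ^+ n)) =
  C * (Q * sd_eps d ^+ 3) * 2 * ((sd_eps d ^+ P + sd_eps d ^+ n) / eps0 ^+ P) by ring.
rewrite ler_wpM2l//.
  by rewrite mulr_ge0// mulr_ge0// mulr_ge0// exprn_ge0// ltW.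
rewrite ler_pdivlMr ?exprn_gt0// mul1r (@le_trans _ _ (sd_eps d ^+ P))//.
  by rewrite lerXn2r ?nnegrE// ltW.
by rewrite lerDl exprn_ge0// ltW.
Qed.

(** Around the boundary point t0 the curve is the graph of f in the frame rotated
    by theta; on ]-rho, rho[ it stays inside the chart and its slope varies little. *)
Variables (t0 : K * K) (theta : K) (f : K -> K) (rc rho F eta : K).
Hypothesis f_C : class_C n.+1 f.
Hypothesis rc_gt0 : 0 < rc.
Hypothesis rho_gt0 : 0 < rho.
Hypothesis rho_le : rho <= rc.
Hypothesis chart : forall a b, `|a| < rc -> `|b| < rc ->
  boundary B (frame_pt t0 theta a b) <-> b = f a.
Hypothesis f_small : forall a, `|a| < rho -> `|f a| < rc / 2.
Hypothesis eta_gt0 : 0 < eta.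
Hypothesis F_ge0 : 0 <= F.
Hypothesis df_bound : forall x, `|x| < rho -> `|derive1 f x| <= F.
Hypothesis df_osc : forall x y, `|x| < rho -> `|y| < rho ->
  `|derive1 f x - derive1 f y| <= eta / 8.

(** The sign sg selects the side; the value is 1 as soon as B meets it. *)
Lemma side_value (sg : K) : sg = 1 \/ sg = -1 -> exists2 c : K, `|c| <= 1 &
  forall x, `|frame_x t0 theta x| < rho -> `|frame_y t0 theta x| < rc ->
    sg * (frame_y t0 theta x - f (frame_x t0 theta x)) < 0 -> \1_B x = c.
Proof.
move=> sgE.
have bd a b : `|a| < rho -> `|b| < rc -> boundary B (frame_pt t0 theta a b) -> b = f a.
  by move=> ar br /(chart (lt_le_trans ar rho_le) br).
have [[x [xr yr sx Bx]]|no] := pselect (exists x,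
    [/\ `|frame_x t0 theta x| < rho, `|frame_y t0 theta x| < rc,
        sg * (frame_y t0 theta x - f (frame_x t0 theta x)) < 0 & B x]).
- exists 1; first by rewrite normr1.
  move=> y yx yy sy; rewrite indicE mem_set//.
  rewrite -(frame_ptK t0 theta y).
  apply: (graph_side rc_gt0 sgE f_small bd xr yr yx yy sx sy).
  by rewrite frame_ptK.
- exists 0; first by rewrite normr0.
  move=> y yx yy sy; rewrite indicE memNset// => By.
  by apply: no; exists y.
Qed.

(** Moving by dz and dy in the adapted coordinates displaces a point by
    eps^2 dz times the unit vector of one axis plus eps dy times the ridge; these
    are the frame coordinates of the two directions. *)
Definition dir_x1 (flip : bool) : K := if flip then sin theta else cos theta.
Definition dir_y1 (flip : bool) : K := if flip then cos theta else - sin theta.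
Definition dir_x2 (flip : bool) (kap : K) : K :=
  (ridge flip kap).1 * cos theta + (ridge flip kap).2 * sin theta.
Definition dir_y2 (flip : bool) (kap : K) : K :=
  (ridge flip kap).2 * cos theta - (ridge flip kap).1 * sin theta.

(** The transversality of the ridge to the graph of f, as in [transversality]. *)
Definition slope_factor (d : shear_data K) : K :=
  dir_y2 (sd_flip d) (sd_kap d)
  - derive1 f (frame_x t0 theta (sd_pt d)) * dir_x2 (sd_flip d) (sd_kap d).

Definition charted (d : shear_data K) : Prop :=
  [/\ boundary B (sd_pt d), `|frame_x t0 theta (sd_pt d)| < rho / 2,
      `|frame_y t0 theta (sd_pt d)| < rc / 2,
      eta <= `|slope_factor d| &
      sd_eps d * (8 * r + 3) <= rho / 2 /\
      sd_eps d * (4 * r * (1 + F) / eta) <= 1].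

Let gap (d : shear_data K) (z y : K) : K :=
  chart_gap f (sd_eps d) (frame_x t0 theta (sd_pt d)) (dir_x1 (sd_flip d))
    (dir_x2 (sd_flip d) (sd_kap d)) (dir_y1 (sd_flip d)) (dir_y2 (sd_flip d) (sd_kap d))
    (sd_coord d (sd_pt d)).1 (sd_coord d (sd_pt d)).2 z y.

Let dir_bounds (flip : bool) (kap : K) : `|kap| <= 2 ->
  [/\ `|dir_x1 flip| <= 1, `|dir_y1 flip| <= 1, `|dir_x2 flip kap| <= 3 &
      `|dir_y2 flip kap| <= 3].
Proof.
move=> k2; have c1 := norm_cos_le1 theta; have s1 := norm_sin_le1 theta.
have kc : `|kap * cos theta| <= 2 by rewrite normrM -[leRHS]mulr1 ler_pM.
have ks : `|kap * sin theta| <= 2 by rewrite normrM -[leRHS]mulr1 ler_pM.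
rewrite /dir_x1 /dir_y1 /dir_x2 /dir_y2 /ridge; case: flip => /=; split;
  rewrite ?normrN// ?mul1r ?mulNr ?opprK.
- by rewrite (le_trans (ler_normB _ _))//; lra.
- by rewrite -opprD normrN (le_trans (ler_normD _ _))//; lra.
- by rewrite (le_trans (ler_normD _ _)) ?normrN//; lra.
- by rewrite (le_trans (ler_normD _ _))//; lra.
Qed.

Let gap_frame d x : admissible r R0 d -> charted d -> in_window r d x ->
  [/\ `|frame_x t0 theta x| < rho, `|frame_y t0 theta x| < rc &
      frame_y t0 theta x - f (frame_x t0 theta x) =
      gap d (sd_coord d x).1 (sd_coord d x).2].
Proof.
move=> [/andP[e0 e1] k2 [tz ty] _] [bt xt yt _ [er _]] [xz xy].
have [E1 E2] := shearlet_coord_shift (sd_kap d) (sd_mu d) (sd_flip d) x (sd_pt d) e0.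
move: E1 E2; rewrite -/(sd_coord d).
set z := (sd_coord d x).1; set y := (sd_coord d x).2.
set z0 := (sd_coord d (sd_pt d)).1; set y0 := (sd_coord d (sd_pt d)).2.
move=> E1 E2; have [a1b b1b a2b b2b] := dir_bounds (sd_flip d) k2.
set at0 := frame_x t0 theta (sd_pt d).
have fx : frame_x t0 theta x = at0 + sd_eps d *
    (dir_x2 (sd_flip d) (sd_kap d) * (y - y0) + dir_x1 (sd_flip d) * (sd_eps d * (z - z0))).
  transitivity (at0 + ((x.1 - (sd_pt d).1) * cos theta + (x.2 - (sd_pt d).2) * sin theta)).
    by rewrite /at0 /frame_x; ring.
  rewrite E1 E2 /shift1 /shift2 /dir_x1 /dir_x2 /ridge.
  by case: (sd_flip d) => /=; ring.
have fy : frame_y t0 theta x = frame_y t0 theta (sd_pt d) + sd_eps d *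
    (dir_y2 (sd_flip d) (sd_kap d) * (y - y0) + dir_y1 (sd_flip d) * (sd_eps d * (z - z0))).
  transitivity (frame_y t0 theta (sd_pt d) +
      ((x.2 - (sd_pt d).2) * cos theta - (x.1 - (sd_pt d).1) * sin theta)).
    by rewrite /frame_y; ring.
  rewrite E1 E2 /shift1 /shift2 /dir_y1 /dir_y2 /ridge.
  by case: (sd_flip d) => /=; ring.
have fat : frame_y t0 theta (sd_pt d) = f at0.
  have rho2 : rho / 2 <= rc by move: rho_le rho_gt0; lra.
  have xr : `|at0| < rc := lt_le_trans xt rho2.
  have rc2 : rc / 2 <= rc by move: rc_gt0; lra.
  have yr : `|frame_y t0 theta (sd_pt d)| < rc := lt_le_trans yt rc2.
  by apply/(chart xr yr); rewrite frame_ptK.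
have yy : `|y - y0| <= 2 * r + 1.
  by rewrite (le_trans (ler_normB _ _))//; lra.
split.
- by rewrite fx; apply: (@chart_arg _ r rho).
- rewrite fy (le_lt_trans (ler_normD _ _))//.
  have hy : `|sd_eps d * (dir_y2 (sd_flip d) (sd_kap d) * (y - y0) +
      dir_y1 (sd_flip d) * (sd_eps d * (z - z0)))| <= rho / 2.
    exact: (@chart_displacement _ r rho).
  by move: rho_le yt; lra.
- by rewrite fx fy fat /gap /chart_gap -/z -/y -/z0 -/y0 -/at0; ring.
Qed.

(** All admissible shearlets are treated at once, as a family indexed by a
    subtype, so that [core_estimate] delivers a single constant. *)
Lemma fine_estimate :
  exists2 C : K, 0 <= C & forall d, admissible r R0 d -> charted d ->
    forall Q, 0 <= Q ->
    (`|pairing d Q| <= (C * (Q * sd_eps d ^+ 3 *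
       (sd_eps d ^+ P + sd_eps d ^+ n)))%:E)%E.
Proof.
have df : forall x, derivable f x 1 by case/class_CS: f_C.
pose I := {d : shear_data K | admissible r R0 d /\ charted d}.
pose d_ (i : I) := sval i.
have ad (i : I) : admissible r R0 (d_ i) by case: (svalP i).
have fd (i : I) : charted (d_ i) by case: (svalP i).
pose eps i := sd_eps (d_ i).
have e0 i : 0 < eps i by case: (ad i) => /andP[].
have e1 i : eps i <= 1 by case: (ad i) => /andP[].
have k2 i : `|sd_kap (d_ i)| <= 2 by case: (ad i).
pose z0 i := (sd_coord (d_ i) (sd_pt (d_ i))).1.
pose y0 i := (sd_coord (d_ i) (sd_pt (d_ i))).2.
have z0r i : `|z0 i| <= r by case: (ad i) => _ _ [].
have y0r i : `|y0 i| <= r by case: (ad i) => _ _ [].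
pose lam i := slope_factor (d_ i).
pose at0 i := frame_x t0 theta (sd_pt (d_ i)).
have at_lt i : `|at0 i| < rho / 2 by case: (fd i).
pose a1 i := dir_x1 (sd_flip (d_ i)).
pose b1 i := dir_y1 (sd_flip (d_ i)).
pose a2 i := dir_x2 (sd_flip (d_ i)) (sd_kap (d_ i)).
pose b2 i := dir_y2 (sd_flip (d_ i)) (sd_kap (d_ i)).
have a1b i : `|a1 i| <= 1 by have [] := dir_bounds (sd_flip (d_ i)) (k2 i).
have b1b i : `|b1 i| <= 1 by have [] := dir_bounds (sd_flip (d_ i)) (k2 i).
have a2b i : `|a2 i| <= 3 by have [] := dir_bounds (sd_flip (d_ i)) (k2 i).
have lamb i : eta <= `|lam i| by case: (fd i).
have lam0 i : lam i != 0 by rewrite -normr_gt0 (lt_le_trans eta_gt0).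
(* Any value of e will do where psi1 vanishes, outside [-r, r]. *)
have ez (p : I * K) : exists e, `|p.2| <= r ->
    [/\ `|e - y0 p.1| <= 4 * r * (1 + F) / eta * eps p.1, gap (d_ p.1) p.2 e = 0 &
    forall y, `|y| <= r -> (lam p.1 * gap (d_ p.1) p.2 y <= 0 <-> y <= e) /\
      (gap (d_ p.1) p.2 y = 0 <-> y = e)].
  case: p => i z /=; have [zr|zr] := leP `|z| r; last by exists 0.
  have [_ _ _ _ [er eF]] := fd i.
  have [e he] := @chart_zero K f df r eta rho F r_ge0 eta_gt0 F_ge0 df_bound df_osc
    (eps i) (at0 i) (a1 i) (a2 i) (b1 i) (b2 i) (z0 i) (y0 i) z
    (e0 i) (e1 i) (at_lt i) (a1b i) (a2b i) (b1b i) er eF (z0r i) (y0r i) zr (lamb i).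
  by exists e.
have [e_ he] := choice ez.
pose e i z := e_ (i, z).
have eP i z : `|z| <= r -> _ := he (i, z).
pose S i : set (K * K) := [set x | lam i * gap (d_ i) x.1 x.2 <= 0].
pose N i : set (K * K) := [set x | gap (d_ i) x.1 x.2 = 0].
have mgap i : measurable_fun setT (fun x : K * K => gap (d_ i) x.1 x.2).
  exact: measurable_chart_gap.
have mS i : measurable (S i).
  rewrite (_ : S i = setT `&` (fun x => lam i * gap (d_ i) x.1 x.2) @^-1` `]-oo, 0]%classic).
    by apply: measurable_funM => //.
  by apply/seteqP; split=> [x|x [_]]; rewrite /S /= in_itv/=.
have mN i : measurable (N i).
  rewrite (_ : N i = setT `&` (fun x => gap (d_ i) x.1 x.2) @^-1` [set 0]).
    exact: mgap.
  by apply/seteqP; split=> [x|x [_]].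
have SP i z y : `|z| <= r -> `|y| <= r -> S i (z, y) <-> y <= e i z.
  by move=> zr yr; have [_ _ /(_ y yr)[]] := eP i z zr.
have NP i z y : `|z| <= r -> `|y| <= r -> N i (z, y) <-> y = e i z.
  by move=> zr yr; have [_ _ /(_ y yr)[]] := eP i z zr.
have bz0 : bounded_family z0 by exists r.
have by0 : bounded_family y0 by exists r.
have bat : bounded_family at0 by exists (rho / 2) => i; apply: ltW.
have ba1 : bounded_family a1 by exists 1.
have bb1 : bounded_family b1 by exists 1.
have ba2 : bounded_family a2 by exists 3.
pose ell i z := eps i * (z - z0 i).
have aell m : approximable eps r m ell.
  have h : approximable eps r m (fun i z => eps i * z + - (eps i * z0 i)).
    apply: approximableD => //; first exact: approximable_epsX.
    apply: approximable_cst => //; exists r => i.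
    by rewrite normrN normrM (gtr0_norm (e0 i)) -[leRHS]mul1r ler_pM// ltW.
  by apply: (approximable_eq e0 e1 r_ge0 _ h) => i z _; rewrite /ell; ring.
pose w i z := e i z - y0 i.
pose Cw := 4 * r * (1 + F) / eta.
have Cw0 : 0 <= Cw by rewrite divr_ge0 ?(ltW eta_gt0)// !mulr_ge0// addr_ge0.
have wb i z : `|z| <= r -> `|w i z| <= Cw * eps i by move=> /(eP i z)[].
have aw : approximable eps r n w.
  apply: (@approximable_implicit K I eps r e0 e1 r_ge0 n f at0 a1 a2 b1 b2 w ell eta
    f_C eta_gt0 bat ba1 ba2 bb1 lamb aell).
    exists Cw => i z zr; rewrite (le_trans (wb i z zr))// ler_piMr//.
  move=> i z zr; have [_ + _] := eP i z zr.
  by rewrite /gap /chart_gap => /eqP; rewrite subr_eq0 => /eqP.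
have ae c : approximable eps r n (fun i z => primitive phi1 c (e i z)).
  have CP : class_C n (primitive phi1 c).
    apply: (@class_C_le K n n.+2); first by rewrite ltnW.
    exact: (class_C_primitive r_ge0 phi1_out c phi1_C).
  have h := approximable_comp e0 e1 r_ge0 CP by0 aw wb.
  by apply: (approximable_eq e0 e1 r_ge0 _ h) => i z _; rewrite /w addrC subrK.
(* cb and ca are the values of the indicator of B below and above the graph.
   According to the sign of lam, the set S is the part below or above. *)
have [cb cb1 cbP] := side_value (or_introl erefl).
have [ca ca1 caP] := side_value (or_intror erefl).
pose cS i := if 0 < lam i then cb else ca.
pose cN i := if 0 < lam i then ca else cb.
have cS1 i : `|cS i| <= 1 by rewrite /cS; case: ifP.
have cN1 i : `|cN i| <= 1 by rewrite /cN; case: ifP.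
have [A1 A10 hA1] := taylor_coord R0 r_ge0 g1_C.
have [A2 A20 hA2] := taylor_coord R0 r_ge0 g2_C.
have ext1 (i : I) : exists t : nat -> nat -> K,
    (forall l c, `|t l c| <= A1) /\ forall x, in_window r (d_ i) x ->
    `|g1 x - \sum_(l < P) \sum_(c < P + P)
       t l c * (sd_coord (d_ i) x).1 ^+ l * (sd_coord (d_ i) x).2 ^+ c|
    <= A1 * eps i ^+ P.
  by have [t tA tP] := hA1 _ (ad i); exists t.
have [t1 ht1] := choice ext1.
have ext2 (i : I) : exists t : nat -> nat -> K,
    (forall l c, `|t l c| <= A2) /\ forall x, in_window r (d_ i) x ->
    `|g2 x - \sum_(l < P) \sum_(c < P + P)
       t l c * (sd_coord (d_ i) x).1 ^+ l * (sd_coord (d_ i) x).2 ^+ c|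
    <= A2 * eps i ^+ P.
  by have [t tA tP] := hA2 _ (ad i); exists t.
have [t2 ht2] := choice ext2.
pose A := A1 + 2 * A2.
have A0 : 0 <= A by rewrite addr_ge0// mulr_ge0.
pose t i l c := t1 i l c + cN i * t2 i l c.
pose s i l c := (cS i - cN i) * t2 i l c.
have tA i l c : `|t i l c| <= A.
  rewrite (le_trans (ler_normD _ _))// lerD ?(ht1 i).1//.
  by rewrite normrM ler_pM ?(ht2 i).1// (le_trans (cN1 i))// ler1n.
have sA i l c : `|s i l c| <= A.
  apply: (@le_trans _ _ (2 * A2)); last by rewrite lerDr.
  rewrite normrM ler_pM ?(ht2 i).1//.
  by rewrite (le_trans (ler_normB _ _))//; have := cS1 i; have := cN1 i; lra.
have uP i x : `|(sd_coord (d_ i) x).1| <= r -> `|(sd_coord (d_ i) x).2| <= r ->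
    (sd_coord (d_ i) x).2 <> e i (sd_coord (d_ i) x).1 ->
    `|u x - model P (P + P) t s S i (sd_coord (d_ i) x)| <= A * eps i ^+ P.
  move=> xz xy xe; have xw : in_window r (d_ i) x by [].
  pose chi := cN i + (cS i - cN i) * \1_(S i) (sd_coord (d_ i) x).
  have chi1 : \1_B x = chi.
    have [fx fy fg] := gap_frame (ad i) (fd i) xw.
    have Gn : gap (d_ i) (sd_coord (d_ i) x).1 (sd_coord (d_ i) x).2 != 0.
      by apply/eqP => /(NP i _ _ xz xy).
    have below : gap (d_ i) (sd_coord (d_ i) x).1 (sd_coord (d_ i) x).2 < 0 -> \1_B x = cb.
      by move=> h; apply: cbP => //; rewrite fg mul1r.
    have above : 0 < gap (d_ i) (sd_coord (d_ i) x).1 (sd_coord (d_ i) x).2 -> \1_B x = ca.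
      by move=> h; apply: caP => //; rewrite fg mulN1r oppr_lt0.
    rewrite /chi [X in _ = _ + _ * X]indicE.
    case: (boolP (sd_coord (d_ i) x \in S i)) => [/set_mem hS|/negP nS].
      rewrite mulr1 [RHS]addrC subrK /cS; move: hS; rewrite /S /mkset.
      case: (ltrP 0 (lam i)) => l0 hS.
        by apply: below; move: hS; rewrite pmulr_rle0// le_eqVlt (negbTE Gn).
      apply: above; move: hS; rewrite nmulr_rle0 ?lt_neqAle ?lam0//.
      by rewrite le_eqVlt eq_sym (negbTE Gn).
    have {}nS : ~ S i (sd_coord (d_ i) x) by move=> h; apply: nS; exact/mem_set.
    rewrite mulr0 addr0 /cN; move: nS; rewrite /S /mkset => /negP; rewrite -ltNge.
    case: (ltrP 0 (lam i)) => l0; first by rewrite pmulr_rgt0// => h; exact: above.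
    have l0' : lam i < 0 by rewrite lt_neqAle lam0.
    by rewrite (nmulr_rgt0 _ l0') => h; exact: below.
  have -> : model P (P + P) t s S i (sd_coord (d_ i) x) =
    \sum_(l < P) \sum_(c < P + P)
       t1 i l c * (sd_coord (d_ i) x).1 ^+ l * (sd_coord (d_ i) x).2 ^+ c +
    chi * \sum_(l < P) \sum_(c < P + P)
       t2 i l c * (sd_coord (d_ i) x).1 ^+ l * (sd_coord (d_ i) x).2 ^+ c.
    rewrite mulr_sumr -big_split/=; apply: eq_bigr => l _.
    rewrite mulr_sumr -big_split/=; apply: eq_bigr => c _.
    by rewrite /t /s /chi; ring.
  rewrite /u chi1 opprD addrACA -mulrBr (le_trans (ler_normD _ _))//.
  have -> : A * eps i ^+ P = A1 * eps i ^+ P + 2 * (A2 * eps i ^+ P).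
    by rewrite /A; ring.
  apply: lerD; first exact: (ht1 i).2.
  rewrite normrM; apply: ler_pM => //; last exact: (ht2 i).2.
  by rewrite -chi1 (le_trans (indic_norm_le1 x))// ler1n.
have [C C0 hC] := @core_estimate K I eps r e0 e1 r_ge0 psi1 phi1 cpsi cphi psi1_out
  phi1_out M n P (P + P) PnM moments t s A A0 tA sA e S ae mS
  SP (fun i => sd_coord (d_ i)) (fun i => eps i ^+ 3)
  (fun i => exprn_ge0 3 (ltW (e0 i)))
  (fun i => measurable_shearlet_coord _ _ _ _)
  (fun i F mF => integral_shearlet_coord _ _ _ (e0 i) mF)
  (fun _ => u) N mN NP uP.
exists C => // d adm fdm Q Q0.
exact: (hC (exist _ d (conj adm fdm)) Q Q0).
Qed.

End Estimates.

(** * Uniformity over the boundary *)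

Section Global.
Variables (K : realType) (n P M : nat) (psi1 phi1 : K -> K) (r : K).
Hypothesis r_ge0 : 0 <= r.
Hypothesis psi1_C : class_C n.+1 psi1.
Hypothesis phi1_C : class_C n.+1 phi1.
Hypothesis psi1_out : forall x, r < `|x| -> psi1 x = 0.
Hypothesis phi1_out : forall x, r < `|x| -> phi1 x = 0.
Hypothesis moments : vanishing_moments M psi1.
Hypothesis PnM : (P + n <= M)%N.
Variables (g1 g2 : K * K -> K) (B : set (K * K)).
Hypothesis g1_C : class_C2 P g1.
Hypothesis g2_C : class_C2 P g2.
Variable eta : K.
Hypothesis eta_gt0 : 0 < eta.

Definition transversal (d : shear_data K) : Prop :=
  exists2 nv : K * K, unit_normal (boundary B) (sd_pt d) nv &
    eta <= `|(ridge (sd_flip d) (sd_kap d)).1 * nv.1 +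
             (ridge (sd_flip d) (sd_kap d)).2 * nv.2|.

Definition estimate (C : K) (d : shear_data K) : Prop := forall Q, 0 <= Q ->
  (`|pairing psi1 phi1 g1 g2 B d Q| <=
    (C * (Q * sd_eps d ^+ 3 * (sd_eps d ^+ P + sd_eps d ^+ n)))%:E)%E.

Lemma estimate_le (C C' : K) d : 0 < sd_eps d -> C <= C' -> estimate C d -> estimate C' d.
Proof.
move=> e0 CC h Q Q0; apply: le_trans (h Q Q0) _; rewrite lee_fin ler_wpM2r//.
by rewrite mulr_ge0 ?addr_ge0 ?mulr_ge0 ?exprn_ge0 ?(ltW e0).
Qed.

Lemma continuous_near0 (h : K -> K) (e : K) : continuous h -> 0 < e ->
  exists2 rho : K, 0 < rho & forall x, `|x| < rho -> `|h x - h 0| < e.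
Proof.
move=> ch e0; have := ch 0; move=> /cvgrPdist_lt/(_ _ e0)/nbhs_ballP[rho rho0 hb].
exists rho => // x xr; rewrite distrC; apply: hb.
by rewrite /ball/= sub0r normrN.
Qed.

(** Choose rho so that f and f' vary little on ]-rho, rho[; then use the fine
    estimate at the scales below the resulting threshold eps0, and the coarse
    estimate above it. *)
Lemma local_estimate (t0 : K * K) theta f :
  local_graph n.+1 (boundary B) t0 theta f ->
  exists2 delta : K, 0 < delta & exists2 C : K, 0 <= C &
    forall d, admissible r 1 d -> boundary B (sd_pt d) -> transversal d ->
      `|(sd_pt d).1 - t0.1| < delta -> `|(sd_pt d).2 - t0.2| < delta ->
      estimate C d.
Proof.
move=> [fC f0 [rc rc0 chart]].
have df : forall x, derivable f x 1 by case/class_CS: fC.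
have cf : continuous f by exact: derivable1_continuous.
have cdf : continuous (derive1 f).
  by have [_ h] := (class_CS n f).1 fC; exact: class_C_continuous h.
have [rho1 rho10 h1] := continuous_near0 cf (ltac:(by rewrite divr_gt0) : 0 < rc / 2).
have [rho2 rho20 h2] := continuous_near0 cdf (ltac:(by rewrite divr_gt0) : 0 < eta / 16).
pose rho := Num.min rc (Num.min rho1 rho2).
have rho0 : 0 < rho by rewrite /rho !lt_min rc0 rho10.
have rho_rc : rho <= rc by rewrite /rho ge_min lexx.
have rho_1 : rho <= rho1 by rewrite /rho !ge_min lexx orbT.
have rho_2 : rho <= rho2 by rewrite /rho !ge_min lexx !orbT.
have fsmall a : `|a| < rho -> `|f a| < rc / 2.
  by move=> ar; have := h1 a (lt_le_trans ar rho_1); rewrite f0 subr0.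
have d0 a : `|a| < rho -> `|derive1 f a - derive1 f 0| < eta / 16.
  by move=> ar; exact: h2 (lt_le_trans ar rho_2).
have dosc a b : `|a| < rho -> `|b| < rho -> `|derive1 f a - derive1 f b| <= eta / 8.
  move=> /d0 ha /d0 hb.
  have -> : derive1 f a - derive1 f b =
    (derive1 f a - derive1 f 0) - (derive1 f b - derive1 f 0) by ring.
  by rewrite (le_trans (ler_normB _ _))//; lra.
pose F := `|derive1 f 0| + eta / 16.
have F0 : 0 <= F by rewrite addr_ge0// divr_ge0// ltW.
have dF a : `|a| < rho -> `|derive1 f a| <= F.
  move=> /d0 ha; rewrite -(subrK (derive1 f 0) (derive1 f a)) addrC.
  by rewrite (le_trans (ler_normD _ _))// lerD2l ltW.
have chart' a b : `|a| < rc -> `|b| < rc ->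
  boundary B (frame_pt t0 theta a b) <-> b = f a by exact: chart.
pose D1 := 8 * r + 3; pose D2 := 4 * r * (1 + F) / eta + 1.
have D10 : 0 < D1 by rewrite /D1; move: r_ge0; lra.
have D20 : 0 < D2.
  by rewrite /D2 ltr_wpDl// divr_ge0 ?(ltW eta_gt0)// !mulr_ge0// addr_ge0.
pose eps0 := Num.min (rho / 2 / D1) (1 / D2).
have eps00 : 0 < eps0 by rewrite /eps0 lt_min !divr_gt0.
have [C1 C10 hC1] := @coarse_estimate K n P M psi1 phi1 r 1 r_ge0 psi1_C phi1_C
  psi1_out phi1_out moments g1 g2 B g1_C g2_C eps0 eps00.
have [C2 C20 hC2] := @fine_estimate K n P M psi1 phi1 r 1 r_ge0 psi1_C phi1_C
  psi1_out phi1_out moments PnM g1 g2 B g1_C g2_C t0 theta f rc rho F eta fC rc0 rho0 rho_rc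
  chart' fsmall eta_gt0 F0 dF dosc.
exists (rho / 8); first by rewrite divr_gt0.
exists (C1 + C2) => [|d ad bd [nv nvn tr] dt1 dt2]; first by rewrite addr_ge0.
have [/andP[e0 e1] _ _ _] := ad.
have [le0|lt0] := leP eps0 (sd_eps d).
  by apply: (@estimate_le C1) => //; [rewrite lerDl|exact: hC1].
apply: (@estimate_le C2) => //; first by rewrite lerDr.
apply: hC2 => //.
have fr (x y c s : K) : `|x| < rho / 8 -> `|y| < rho / 8 -> `|c| <= 1 -> `|s| <= 1 ->
    `|x * c + y * s| < rho / 2.
  move=> xr yr c1 s1; rewrite (le_lt_trans (ler_normD _ _))// !normrM.
  have p1 : `|x| * `|c| <= rho / 8 * 1 by rewrite ler_pM// ltW.
  have p2 : `|y| * `|s| <= rho / 8 * 1 by rewrite ler_pM// ltW.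
  by move: p1 p2 rho0; lra.
have fx : `|frame_x t0 theta (sd_pt d)| < rho / 2.
  by apply: fr => //; [exact: norm_cos_le1|exact: norm_sin_le1].
have fy : `|frame_y t0 theta (sd_pt d)| < rho / 2.
  rewrite /frame_y -mulrN; apply: fr => //; first exact: norm_cos_le1.
  by rewrite normrN norm_sin_le1.
split=> //.
- by rewrite (lt_le_trans fy)// ler_pM2r.
- have [nn _] := nvn.
  have rr : rho / 2 <= rc by move: rho_rc rho0; lra.
  have tan := @curve_tangent K (boundary B) t0 (sd_pt d) nv theta f rc rc0
    (class_C_le (ltn0Sn n : (1 <= n.+1)%N) fC) (fun a b ha hb => (chart' a b ha hb).1)
    (lt_le_trans fx rr) (lt_le_trans fy rr) nvn.
  apply: le_trans tr _; exact: transversality nn tan.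
- move: lt0; rewrite /eps0 lt_min => /andP[l1 l2].
  rewrite ltr_pdivlMr// in l1; rewrite ltr_pdivlMr// in l2.
  split; first exact: ltW.
  apply: ltW; apply: le_lt_trans l2.
  by rewrite ler_wpM2l ?(ltW e0)// /D2 lerDl.
Qed.

Lemma compact_boundary : (forall x, B x -> (0 < x.1 < 1) && (0 < x.2 < 1)) ->
  compact (boundary B) /\ forall t, boundary B t -> `|t.1| <= 1 /\ `|t.2| <= 1.
Proof.
move=> Bsub; pose S : set (K * K) := `[0, 1]%classic `*` `[0, 1]%classic.
have cS : compact S by apply: compact_setX; exact: segment_compact.
have clS : closed S.
  by apply: compact_closed => //; exact: norm_hausdorff.
have BS : closure B `<=` S.
  move=> y cy; rewrite ((closure_id S).1 clS); apply: closure_subset cy.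
  move=> x /Bsub /andP[/andP[a b] /andP[c d]].
  by split; rewrite /= in_itv/= !ltW.
have bS : boundary B `<=` S by move=> x [/BS].
split.
  apply: (subclosed_compact _ cS bS).
  rewrite /boundary setDE; apply: closedI; first exact: closed_closure.
  exact/open_closedC/open_interior.
move=> t /bS[]; rewrite /= !in_itv/= => /andP[a b] /andP[c d].
by rewrite !ger0_norm.
Qed.

(** The local constants are bounded near each boundary point, hence on the compact
    boundary: the near-covering form of compactness is applied to the filter of
    large constants. *)
Lemma global_estimate :
  (forall x, B x -> (0 < x.1 < 1) && (0 < x.2 < 1)) ->
  curve_of_class n.+1 (boundary B) ->
  exists2 C : K, 0 <= C & forall d, admissible r 1 d -> boundary B (sd_pt d) ->
    transversal d -> estimate C d.
Proof.
move=> Bsub curve; have [cB _] := compact_boundary Bsub.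
pose Pr (C : K) (t : K * K) : Prop := forall d, sd_pt d = t -> admissible r 1 d ->
  boundary B (sd_pt d) -> transversal d -> estimate C d.
have /compact_near_coveringP ncov := cB.
have [C0 [_ hC0]] : \forall C \near +oo, boundary B `<=` Pr C.
  apply: ncov => t0 bt0; have [theta [f lg]] := curve t0 bt0.
  have [delta d0 [C C0 hC]] := local_estimate lg.
  exists (ball t0 delta, [set C' | C <= C']).
    by split; [exact: nbhsx_ballx|apply: nbhs_pinfty_ge; exact: num_real].
  move=> [t C'] /= [[b1 b2] CC'] d dE ad bd tr.
  have [/andP[e0 _] _ _ _] := ad.
  apply: (@estimate_le C) => //; apply: hC => //; rewrite dE.
  - by move: b1; rewrite /ball/= distrC.
  - by move: b2; rewrite /ball/= distrC.
(* Every constant beyond C0 works at all boundary points. *)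
pose C := Num.max (C0 + 1) 0.
exists C; first by rewrite /C le_max lexx orbT.
move=> d ad bd tr; apply: (hC0 C _ (sd_pt d)) => //.
by rewrite /C lt_max ltrDl ltr01.
Qed.

End Global.

(** * The pairing with the scaling functions *)

Section SquareIntegrable.
Local Open Scope ereal_scope.
Context d (T : measurableType d) (R : realType).
Variable mu : {measure set T -> \bar R}.
Import HBNNSimple.

(** If a simple function h lies below f + w, then max (h - f, 0) is measurable and
    lies below w. *)
Lemma integralD_any (f : T -> R) (w : T -> \bar R) :
  measurable_fun setT f -> (forall x, 0 <= f x)%R -> (forall x, 0 <= w x) ->
  \int[mu]_x ((f x)%:E + w x) <= \int[mu]_x (f x)%:E + \int[mu]_x w x.
Proof.
move=> mf f0 w0.
have fw0 x : 0 <= (f x)%:E + w x by rewrite adde_ge0// lee_fin.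
rewrite (ge0_integralTE _ fw0); apply: ub_ereal_sup => _ [h hfw <-].
pose e x : R := Num.max (h x - f x)%R 0%R.
have me : measurable_fun setT e.
  by apply: measurable_maxr => //; apply: measurable_funB.
have e0 x : (0 <= e x)%R by rewrite /e le_max lexx orbT.
rewrite -integralT_nnsfun.
apply: (@le_trans _ _ (\int[mu]_x ((f x)%:E + (e x)%:E))).
  apply: le_integral_any => x; rewrite -EFinD lee_fin -lerBlDl.
  by rewrite /e le_max lexx.
rewrite ge0_integralD//; last 4 first.
- by move=> x _; rewrite lee_fin.
- exact/measurable_EFinP.
- by move=> x _; rewrite lee_fin.
- exact/measurable_EFinP.
apply: leeD2l; apply: le_integral_any => x.
rewrite /e EFin_max ge_max w0 andbT.
by rewrite EFinB leeBlDl//; exact: hfw.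
Qed.

(** The inequality |f u| <= f^2 + u^2 stands in for Cauchy-Schwarz, which would
    need u to be measurable. *)
Lemma integral_product_any (f u : T -> R) : measurable_fun setT f ->
  `|\int[mu]_x (f x * u x)%:E| <=
  \int[mu]_x (f x ^+ 2)%:E + \int[mu]_x (`|u x| `^ 2)%:E.
Proof.
move=> mf; apply: (@le_trans _ _ (\int[mu]_x ((f x ^+ 2)%:E + (`|u x| `^ 2)%:E))).
  have fu x : (`|f x * u x| <= f x ^+ 2 + `|u x| `^ 2)%R.
    rewrite powR_mulrn// normrM -(real_normK (num_real (f x))).
    by have := sqr_ge0 (`|f x| - `|u x|)%R; have := sqr_ge0 `|f x|%R;
      have := sqr_ge0 `|u x|%R; set a := `|f x|%R; set b := `|u x|%R; nra.
  have w0 x : 0 <= (f x ^+ 2 + `|u x| `^ 2)%:E.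
    by rewrite lee_fin addr_ge0 ?sqr_ge0// powR_ge0.
  rewrite (_ : \int[mu]_x ((f x ^+ 2)%:E + (`|u x| `^ 2)%:E) =
    \int[mu]_x (f x ^+ 2 + `|u x| `^ 2)%:E)//.
  have le1 : \int[mu]_x (f x * u x)%:E <= \int[mu]_x (f x ^+ 2 + `|u x| `^ 2)%:E.
    by apply: le_integral_any => x; rewrite lee_fin (le_trans (ler_norm _))// fu.
  have le2 : (- (\int[mu]_x (f x ^+ 2 + `|u x| `^ 2)%:E)) <= \int[mu]_x (f x * u x)%:E.
    rewrite -(integral_ge0N mu (fun x (_ : setT x) => w0 x)).
    apply: le_integral_any => x; rewrite -EFinN lee_fin.
    by rewrite lerNl (le_trans _ (fu x))// -normrN ler_norm.
  move: le1 le2; case: (\int[mu]_x _) => [x| |]; case: (\int[mu]_x _) => [y| |]//=.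
    by rewrite !lee_fin ler_norml => -> ->.
  by move=> _ _; rewrite leey.
apply: (@integralD_any (fun x => f x ^+ 2)%R (fun x => (`|u x| `^ 2)%:E)).
- exact: measurable_funX.
- by move=> x; exact: sqr_ge0.
- by move=> x; rewrite lee_fin powR_ge0.
Qed.
End SquareIntegrable.

Section Scaling.
Variable K : realType.

Lemma mfun_of_Lfun d (T : measurableType d) (mu : {measure set T -> \bar K}) p (f : T -> K) :
  f \in Lfun mu p -> measurable_fun setT f.
Proof. by move=> /sub_Lfun_mfun; rewrite inE. Qed.

Lemma finite_norm2_integral d (T : measurableType d) (mu : {measure set T -> \bar K})
    (u : T -> K) : finite_norm mu 2%:E u ->
  (\int[mu]_x (`|u x| `^ 2)%:E < +oo)%E.
Proof.
rewrite /finite_norm => fin.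
have := @poweR_Lnorm _ _ _ mu (EFin \o u) 2 (ltac:(by rewrite pnatr_eq0) : 2 != 0 :> K).
have : ('N[mu]_2%:E [EFin \o u] `^ 2 < +oo)%E by exact: poweR_lty.
by move=> + E; rewrite E.
Qed.

(** The constant does not depend on v, since the norm of phi is invariant under
    translations. *)
Lemma scaling_estimate (phi u : K * K -> K) : phi \in Lfun (@lebesgue2 K) 2%:E ->
  finite_norm (@lebesgue2 K) 2%:E u ->
  exists2 C : K, 0 <= C & forall v : K * K,
    (`|\int[@lebesgue2 K]_x (phi (x - v) * u x)%:E| <= C%:E)%E.
Proof.
move=> phi2 u2; have mphi := mfun_of_Lfun phi2.
have phisq := Lfun2_integrable_sqr phi2.
have fin1 := integrable_lty measurableT phisq.
have fin2 := finite_norm2_integral u2.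
have I10 : (0 <= \int[@lebesgue2 K]_x (phi x ^+ 2)%:E)%E.
  by apply: integral_ge0 => x _; rewrite lee_fin sqr_ge0.
have I20 : (0 <= \int[@lebesgue2 K]_x (`|u x| `^ 2)%:E)%E.
  by apply: integral_ge0 => x _; rewrite lee_fin powR_ge0.
exists (fine (\int[@lebesgue2 K]_x (phi x ^+ 2)%:E + \int[@lebesgue2 K]_x (`|u x| `^ 2)%:E)%E).
  by rewrite fine_ge0// adde_ge0.
move=> v; rewrite fineK; last first.
  by rewrite fin_numD (ge0_fin_numE I10) (ge0_fin_numE I20); apply/andP; split.
have E x : x - v = shear_map 1 1 0 v.1 v.2 x.
  by rewrite /shear_map; congr (_, _); rewrite /= mul1r// mul0r addr0.
have mT : measurable_fun setT (fun x : K * K => phi (x - v)).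
  rewrite (_ : (fun x : K * K => phi (x - v)) = phi \o shear_map 1 1 0 v.1 v.2); last first.
    by apply/funext => x; rewrite /= -E.
  by apply: measurableT_comp => //; exact: measurable_shear_map.
have mphisq : measurable_fun setT (fun x => (phi x ^+ 2)%:E).
  by apply/measurable_EFinP; exact: measurable_funX.
have Es := @integral_shear K 1 1 0 v.1 v.2 (fun x => (phi x ^+ 2)%:E) ltr01 ltr01 mphisq.
rewrite mulr1 invr1 mul1e in Es.
apply: (le_trans (@integral_product_any _ _ K
  (@lebesgue_measure K \x @lebesgue_measure K)%E (fun x : K * K => phi (x - v)) u mT)).
rewrite leeD2r// -Es le_eqVlt; apply/orP; left; apply/eqP.
by apply: eq_integral => x _; rewrite E.
Qed.

End Scaling.

(** * Shearlets in the adapted coordinates *)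

Section ShearletCoord.
Variable K : realType.

Lemma mxact_mx2 (a b c d : K) (x : K * K) :
  mxact (mx2 a b c d) x = (a * x.1 + b * x.2, c * x.1 + d * x.2).
Proof. by rewrite /mxact /mx2 !mxE. Qed.

Lemma mxact_mul (A A' : 'M[K]_2) (x : K * K) : mxact (A *m A') x = mxact A (mxact A' x).
Proof.
rewrite /mxact !mxE !big_ord_recl !big_ord0 !addr0 /=.
by rewrite (_ : lift ord0 ord0 = 1); [congr (_, _); ring|exact/val_inj].
Qed.

Lemma tr_shear_mx (k : int) : (shear_mx K k)^T = mx2 1 0 k%:~R 1.
Proof.
apply/matrixP => p q; rewrite !mxE.
by case: (p == 0); case: (q == 0).
Qed.

Definition shearlet_scale (j : nat) : K := 2 `^ (- (j%:R / 2)).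

Lemma shearlet_scale_gt0 j : 0 < shearlet_scale j.
Proof. by rewrite powR_gt0. Qed.

Lemma shearlet_scaleX j (d : nat) : shearlet_scale j ^+ d = 2 `^ (- (d%:R * (j%:R / 2))).
Proof.
by rewrite -powR_mulrn ?powR_ge0// -powRrM; congr (_ `^ _); ring.
Qed.

Lemma shearlet_scaleV j : 2 `^ (j%:R / 2) = (shearlet_scale j)^-1.
Proof. by rewrite /shearlet_scale powRN invrK. Qed.

Lemma shearlet_scaleV2 j : 2 ^+ j = shearlet_scale j ^- 2.
Proof.
rewrite -exprVn -shearlet_scaleV -[RHS]powR_mulrn ?powR_ge0// -[RHS]powRrM.
by rewrite -powR_mulrn//; congr (_ `^ _); field.
Qed.

Definition shearlet_data (c : K * K) (j : nat) (k : int) (m : int * int) (flip : bool)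
    (t : K * K) : shear_data K :=
  ShearData (shearlet_scale j) (shearlet_scale j * k%:~R)
    (if flip then (c.1 * m.2%:~R, c.2 * m.1%:~R) else (c.1 * m.1%:~R, c.2 * m.2%:~R))
    flip t.

Lemma shearletE (phi : K * K -> K) (psi1 phi1 : K -> K) c j k m flip t x :
  shearlet phi (tensor psi1 phi1) c j k m (if flip then -1 else 1) x =
  2 `^ (3 / 4 * j%:R) *
  (psi1 (sd_coord (shearlet_data c j k m flip t) x).1 *
   phi1 (sd_coord (shearlet_data c j k m flip t) x).2).
Proof.
have e0 : shearlet_scale j != 0 by rewrite gt_eqF// shearlet_scale_gt0.
rewrite /shearlet /sd_coord /shearlet_coord /shear_map /shearlet_data /=.
case: flip => /=; rewrite mxact_mul /scale_mx /scale_mx' ?tr_shear_mx /shear_mx !mxact_mx2/=;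
  rewrite shearlet_scaleV shearlet_scaleV2 /tensor /swap_args /=; congr (_ * (psi1 _ * phi1 _)).
all: by field.
Qed.

End ShearletCoord.

Section Reduction.
Variable K : realType.

Lemma compact_supp_radius (f : K -> K) : compact (supp f) ->
  exists2 r : K, 0 <= r & forall x, r < `|x| -> f x = 0.
Proof.
move=> /compact_bounded [r0 [_ h]]; pose r := Num.max (r0 + 1) 0.
exists r; first by rewrite /r le_max lexx orbT.
move=> x rx; apply/eqP/negPn/negP => fx.
have : `|x| <= r.
  apply: h; first by rewrite /r lt_max ltrDl ltr01.
  exact: subset_closure.
by rewrite leNgt rx.
Qed.

Lemma continuous_sd_coord (d : shear_data K) : continuous (sd_coord d).
Proof.
have c1 : continuous (fun x : K * K => x.1) by move=> x; exact: cvg_fst.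
have c2 : continuous (fun x : K * K => x.2) by move=> x; exact: cvg_snd.
have cfl : continuous (flip_pt (K := K) (sd_flip d)).
  rewrite /flip_pt; case: (sd_flip d) => x; last exact: cvg_id.
  exact: (cvg_pair (c2 x) (c1 x)).
have csh s1 s2 kap m1 m2 : continuous (shear_map (K := K) s1 s2 kap m1 m2).
  have l1 : continuous (fun x : K * K => s1 * (x.1 + kap * x.2) - m1).
    move=> x; apply: cvgB; last exact: cvg_cst.
    apply: cvgM; first exact: cvg_cst.
    apply: cvgD; first exact: c1.
    by apply: cvgM; [exact: cvg_cst|exact: c2].
  have l2 : continuous (fun x : K * K => s2 * x.2 - m2).
    move=> x; apply: cvgB; last exact: cvg_cst.
    by apply: cvgM; [exact: cvg_cst|exact: c2].
  move=> x; exact: (cvg_pair (l1 x) (l2 x)).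
by move=> x; exact: (continuous_comp (cfl x) (csh _ _ _ _ _ _)).
Qed.

(** The window is closed, so it contains the closure of the set where F does not
    vanish. *)
Lemma supp_in_window (r : K) (d : shear_data K) (F : K * K -> K) t :
  (forall x, F x != 0 -> in_window r d x) -> supp F t -> in_window r d t.
Proof.
move=> Fw; pose W : set (K * K) := [set x | in_window r d x].
have clW : closed W.
  have cl1 (g : K * K -> K) : continuous g -> closed [set x | `|g (sd_coord d x)| <= r].
    move=> cg.
    rewrite (_ : [set _ | _] =
      (fun x => `|g (sd_coord d x)|) @^-1` `]-oo, r]%classic); last first.
      by apply/seteqP; split=> x; rewrite /= in_itv.
    apply: closed_comp => [x _|]; last exact: closed_le.
    apply: continuous_comp; last exact: norm_continuous.
    by apply: continuous_comp; [exact: continuous_sd_coord|exact: cg].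
  rewrite (_ : W = [set x | `|(sd_coord d x).1| <= r] `&` [set x | `|(sd_coord d x).2| <= r]).
    by apply: closedI; apply: cl1 => x; [exact: cvg_fst|exact: cvg_snd].
  by apply/seteqP; split=> x [].
rewrite /supp => ct; have : closure W t by apply: closure_subset ct => x; exact: Fw.
by rewrite -(closure_id W).1.
Qed.

Lemma shearlet_scale_le1 (j : nat) : shearlet_scale K j <= 1.
Proof.
rewrite -(powRr0 (2 : K)); apply: ler_powR; first by rewrite ler1n.
by rewrite oppr_le0 divr_ge0.
Qed.

Lemma shear_bounded (j : nat) (k : int) : (`|k| <= 2 ^ uphalf j)%N ->
  `|shearlet_scale K j * k%:~R| <= 2.
Proof.
move=> kj; rewrite normrM gtr0_norm ?shearlet_scale_gt0// -intr_norm -natr_absz.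
apply: (@le_trans _ _ (shearlet_scale K j * 2 ^+ uphalf j)).
  by rewrite ler_wpM2l ?(ltW (shearlet_scale_gt0 K j))// -natrX ler_nat.
rewrite -powR_mulrn// -powRD ?pnatr_eq0 ?implybT// -[leRHS](powRr1 (ler0n _ 2)).
apply: ler_powR; first by rewrite ler1n.
have : (uphalf j * 2 <= j + 1)%N by rewrite uphalfE muln2 -[leqRHS]odd_double_half addn1 leq_addl.
by rewrite -(ler_nat K) natrM natrD; lra.
Qed.

(** With eps = 2^(-j/2), the factor 2^(3j/4) eps^3 = 2^(-3j/4) is at most
    2^(-j/2), which gives the first term, and 2^(3j/4) eps^(n + 3) is at most
    2^(3j/4) eps^(n + 2), which gives the second. *)
Lemma final_exponents (j n P : nat) :
  2 `^ (3 / 4 * j%:R) * shearlet_scale K j ^+ 3 *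
    (shearlet_scale K j ^+ P + shearlet_scale K j ^+ n) <=
  2 `^ (- (P.+1%:R * (j%:R / 2))) + 2 `^ (- (n.+2%:R * (j%:R / 2)) + 3 / 4 * j%:R).
Proof.
set Q := 2 `^ (3 / 4 * j%:R); set e := shearlet_scale K j.
have -> : Q * e ^+ 3 * (e ^+ P + e ^+ n) = Q * e ^+ (P + 3) + Q * e ^+ (n + 3).
  by rewrite !exprD; ring.
rewrite /Q /e !shearlet_scaleX -!powRD ?pnatr_eq0 ?implybT//.
have j0 : 0 <= j%:R :> K by [].
apply: lerD; apply: ler_powR; rewrite ?ler1n//.
  by rewrite natrD -(natr1 P); lra.
have n2 : n.+2%:R = n%:R + 2 :> K by rewrite -natrD addn2.
by rewrite natrD n2; lra.
Qed.

End Reduction.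

(** * The theorem *)

Theorem lemma3p4 (K : realType) (L P R M : nat)
  (L_gt0 : (0 < L)%N) (P_gt0 : (0 < P)%N) (R_gt0 : (0 < R)%N) (M_gt0 : (0 < M)%N)
  (le_LR : (L <= R)%N) (le_LPM : (L + P <= M)%N)
  (psi1 phi1 : K -> K)
  (psi1_C : class_C L psi1) (phi1_C : class_C L phi1)
  (psi1_L2 : psi1 \in Lfun (@lebesgue_measure K) 2%:E)
  (phi1_L2 : phi1 \in Lfun (@lebesgue_measure K) 2%:E)
  (psi1_supp : compact (supp psi1)) (phi1_supp : compact (supp phi1))
  (psi1_moments : vanishing_moments M psi1)
  (phi : K * K -> K) (phi_L2 : phi \in Lfun (@lebesgue2 K) 2%:E)
  (c : K * K) (c1_gt0 : 0 < c.1) (c2_gt0 : 0 < c.2)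
  (g1 g2 : K * K -> K) (g1_C : class_C2 P g1) (g2_C : class_C2 P g2)
  (B : set (K * K))
  (B_sub : B `<=` [set x | (0 < x.1 < 1) && (0 < x.2 < 1)])
  (B_curve : curve_of_class R (boundary B))
  (B_curv : bounded_curvature (boundary B))
  (beta : K) (beta_gt0 : 0 < beta) :
  let psi := tensor psi1 phi1 in
  let gamma := boundary B in
  let u := fun x : K * K => g1 x + \1_B x * g2 x in
  exists C : K, forall (j : nat) (k : int) (m : int * int) (i : int),
    shearlet_index j k m i ->
    (* the pairing with the scaling functions presupposes that u is in L_2 *)
    (i = 0 -> finite_norm (@lebesgue2 K) 2%:E u) ->
    (exists t n rho0,
      [/\ (supp (shearlet phi psi c j k m i) `&` gamma) t,
          unit_normal gamma t n,
          n = (cos rho0, sin rho0) \/ n = - (cos rho0, sin rho0),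
          - (pi / 2) <= rho0 <= pi / 2 &
          beta <= torus_dist (atan_exp (2 `^ (- (j%:R / 2)) * k%:~R) i) rho0]) ->
    (`| inner (shearlet phi psi c j k m i) u | <=
      (C * (2 `^ (- (P.+1%:R * (j%:R / 2)))
            + 2 `^ (- (L.+1%:R * (j%:R / 2)) + 3 / 4 * j%:R)))%:E)%E.
Proof.
move=> psi gamma u.
case: L L_gt0 le_LR le_LPM psi1_C phi1_C => // n _ le_LR le_LPM psi1_C phi1_C.
have PnM : (P + n <= M)%N.
  by rewrite addnC (leq_trans _ le_LPM)// leq_add2r.
have [ra ra0 raP] := compact_supp_radius psi1_supp.
have [rb rb0 rbP] := compact_supp_radius phi1_supp.
pose r := Num.max ra rb.
have r0 : 0 <= r by rewrite /r le_max ra0.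
have psi_out x : r < `|x| -> psi1 x = 0 by rewrite /r gt_max => /andP[/raP].
have phi_out x : r < `|x| -> phi1 x = 0 by rewrite /r gt_max => /andP[_ /rbP].
have curve : curve_of_class n.+1 gamma.
  move=> t gt; have [theta [f [fC f0 h]]] := B_curve t gt.
  exists theta, f; split; [exact: (class_C_le le_LR fC)|exact: f0|exact: h].
(* Whether sin beta > 0, and whether u has finite norm, is known only once an
   index is given, so the constants C1 and C2 exist unconditionally and their
   bounds are conditional. *)
have [C1 C10 hC1] : exists2 C : K, 0 <= C & 0 < sin beta ->
    forall d, admissible r 1 d -> gamma (sd_pt d) ->
    transversal B (sin beta) d -> estimate n P psi1 phi1 g1 g2 B C d.
  have [s0|s0] := ltP 0 (sin beta); last by exists 0.
  have [C C0 hC] := @global_estimate K n P M psi1 phi1 r r0 psi1_C phi1_C psi_out phi_out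
    psi1_moments PnM g1 g2 B g1_C g2_C (sin beta) s0 B_sub curve.
  by exists C.
have [C2 C20 hC2] : exists2 C : K, 0 <= C & finite_norm (@lebesgue2 K) 2%:E u ->
    forall v : K * K, (`|\int[@lebesgue2 K]_x (phi (x - v) * u x)%:E| <= C%:E)%E.
  have [fu|fu] := boolP (finite_norm (@lebesgue2 K) 2%:E u); last by exists 0.
  by have [C C0 hC] := scaling_estimate phi_L2 fu; exists C.
exists (C1 + C2) => j k m i ind fin [t [nv [rho0 [[st gt] nvn nvE _ dist]]]].
set RHS := (2 `^ _ + 2 `^ _).
have RHS0 : 0 <= RHS by rewrite addr_ge0// powR_ge0.
case: ind => [[j0 k0 i0]|[kj iE]].
- apply: (@le_trans _ _ C2%:E).
    have := hC2 (fin i0) (mxact (mx2 c.1 0 0 c.1) (lattice_pt K m)).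
    by rewrite /inner /shearlet i0 eqxx.
  rewrite lee_fin /RHS j0 !(mul0r, mulr0, oppr0, addr0) !powRr0.
  by move: C10 C20; lra.
have [flip iF] : exists flip : bool, i = if flip then -1 else 1.
  by case: iE => ->; [exists false|exists true].
pose d := shearlet_data c j k m flip t.
have e0 := shearlet_scale_gt0 K j.
have shE x := shearletE phi psi1 phi1 c j k m flip t x.
have wt : in_window r d t.
  apply: supp_in_window st => x; rewrite iF shE mulf_eq0 negb_or => /andP[_].
  rewrite mulf_eq0 negb_or => /andP[p1 p2]; split; rewrite leNgt; apply/negP => h.
    by rewrite psi_out ?eqxx in p1.
  by rewrite phi_out ?eqxx in p2.
have kap2 : `|shearlet_scale K j * k%:~R| <= 2.
  exact: shear_bounded.
have [_ tb] := compact_boundary B_sub.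
have adm : admissible r 1 d.
  split=> //; last exact: tb.
  by rewrite /= e0 shearlet_scale_le1.
have [s0 tr] := ridge_transversal beta_gt0 nvE (flip := flip) (kap := shearlet_scale K j * k%:~R)
  ltac:(by rewrite -iF).
have trd : transversal B (sin beta) d by exists nv.
have Q0 : 0 <= 2 `^ (3 / 4 * j%:R) :> K by rewrite powR_ge0.
have := hC1 s0 d adm gt trd _ Q0.
rewrite /pairing /inner iF => h.
apply: le_trans (le_trans _ h) _.
  by under eq_integral do rewrite shE.
rewrite lee_fin; apply: (@le_trans _ _ (C1 * RHS)).
  by rewrite ler_wpM2l//; exact: final_exponents.
by rewrite ler_wpM2r// lerDl.
Qed.
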